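(* Let $(X_t,Y_t)$ be the position at time $t$ of the generalized alternate quantum walk started at the origin with initial coin state $\nu_0|0\rangle+\nu_1|1\rangle$, $|\nu_0|^2+|\nu_1|^2=1$, and coin $\hat{U}=\begin{pmatrix}c&s\\ s&-c\end{pmatrix}$, $c=\cos\gamma$, $s=\sin\gamma$, $\gamma\in(0,2\pi)$, $\gamma\ne\pi/2,\pi,3\pi/2$. Then \begin{equation*} \lim_{t\rightarrow\infty}P\left(\frac{X_t}{t}\le x,\frac{Y_t}{t}\le y\right)=\int_{-\infty}^x du\int_{-\infty}^y dv\,f(u,v), \end{equation*} where \begin{equation*} f(x,y)=\frac{1}{\pi^2(1-x^2)(1-y^2)}\Big\{1-(|\nu_0|^2-|\nu_1|^2)y-\frac{\nu_0\nu_1^*+\nu_0^*\nu_1}{2cs}[c^2(x-y)+s^2(x+y)]\Big\}I_D(x,y), \end{equation*} \begin{equation*} D=\left\{(x,y)\,\middle|\,\frac{(x+y)^2}{4c^2}+\frac{(x-y)^2}{4s^2}<1\right\}, \end{equation*} and $I_D(x,y)=1$ if $(x,y)\in D$, $I_D(x,y)=0$ otherwise.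
   Context: The generalized alternate quantum walk acts on $\mathcal{H}_W\otimes\mathcal{H}_C$, with walker basis $\{|x,y\rangle\}$, $x,y\in\mathbb{Z}$, and a two-level coin with basis $|0\rangle,|1\rangle$. One time step consists of: apply $\hat{U}$ to the coin, then the shift $\hat{S}_x$ (moves $x\to x-1$ if coin is $|0\rangle$, $x\to x+1$ if coin is $|1\rangle$), then apply $\hat{U}$, then the shift $\hat{S}_y$ (moves $y\to y-1$ if coin is $|0\rangle$, $y\to y+1$ if coin is $|1\rangle$). The walker starts at $(0,0)$, and $P[(X_t,Y_t)=(x,y)]$ is the probability of finding the walker at $(x,y)$ after tracing out the coin. In Fourier space the one-step operator is $\hat{V}(k_x,k_y)=\hat{R}(k_y)\hat{U}\hat{R}(k_x)\hat{U}$ with $\hat{R}(k)=\mathrm{diag}(e^{ik},e^{-ik})$. *)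

(* Defs.v *)
From HB Require Import structures.
From mathcomp Require Import all_boot all_order all_algebra.
From mathcomp Require Import all_classical all_reals all_analysis.
From mathcomp.real_closed Require Import complex.
Set Implicit Arguments. Unset Strict Implicit. Unset Printing Implicit Defensive.
Import Order.TTheory GRing.Theory Num.Theory.
Local Open Scope ring_scope.
Local Open Scope complex_scope.

Section QW.
Variable R : realType.
Local Notation C := R[i].

(* coin states: column vectors in C^2, index 0 <-> |0>, index 1 <-> |1> *)
Definition coin := 'cV[C]_2.
Definition qstate := int -> int -> coin.

Definition normsq (z : C) : R := complex.Re z ^+ 2 + complex.Im z ^+ 2.

Definition coinU (c s : R) : 'M[C]_2 :=
  \matrix_(i < 2, j < 2)
     if i == j then (if i == ord0 then c%:C else (- c)%:C) else s%:C.

Definition applyU (U : 'M[C]_2) (psi : qstate) : qstate :=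
  fun x y => U *m psi x y.

(* S_x : |x,y>|0> -> |x-1,y>|0>,  |x,y>|1> -> |x+1,y>|1> *)
Definition shiftX (psi : qstate) : qstate :=
  fun x y => \col_i psi (x + (if i == ord0 then 1 else -1)) y i ord0.

(* S_y : |x,y>|0> -> |x,y-1>|0>,  |x,y>|1> -> |x,y+1>|1> *)
Definition shiftY (psi : qstate) : qstate :=
  fun x y => \col_i psi x (y + (if i == ord0 then 1 else -1)) i ord0.

Definition qw_step (U : 'M[C]_2) (psi : qstate) : qstate :=
  shiftY (applyU U (shiftX (applyU U psi))).

Definition qw_init (nu0 nu1 : C) : qstate :=
  fun x y => if (x == 0) && (y == 0) then
               \col_i (if i == ord0 then nu0 else nu1)
             else 0.

Definition qw_state (U : 'M[C]_2) (nu0 nu1 : C) (t : nat) : qstate :=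
  iter t (qw_step U) (qw_init nu0 nu1).

Definition qw_prob (U : 'M[C]_2) (nu0 nu1 : C) (t : nat) (a b : int) : R :=
  \sum_(i < 2) normsq (qw_state U nu0 nu1 t a b i ord0).

(* P(X_t/t <= x, Y_t/t <= y).  After t steps the walker is supported in
   [-t,t]^2, so the sum over this finite box is the full probability. *)
Definition qw_cdf (U : 'M[C]_2) (nu0 nu1 : C) (t : nat) (x y : R) : R :=
  \sum_(0 <= i < (2 * t).+1) \sum_(0 <= j < (2 * t).+1)
    let a : int := i%:Z - t%:Z in
    let b : int := j%:Z - t%:Z in
    if (a%:~R / t%:R <= x) && (b%:~R / t%:R <= y)
    then qw_prob U nu0 nu1 t a b else 0.

Definition inD (c s x y : R) : bool :=
  (x + y) ^+ 2 / (4 * c ^+ 2) + (x - y) ^+ 2 / (4 * s ^+ 2) < 1.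

Definition qw_density (c s : R) (nu0 nu1 : C) (x y : R) : R :=
  if inD c s x y then
    (1 - (normsq nu0 - normsq nu1) * y
       - complex.Re (nu0 * nu1^* + nu0^* * nu1) / (2 * c * s)
         * (c ^+ 2 * (x - y) + s ^+ 2 * (x + y)))
    / (pi ^+ 2 * (1 - x ^+ 2) * (1 - y ^+ 2))
  else 0.

End QW.

(* Main.v *)
Require Import Defs.
From HB Require Import structures.
From mathcomp Require Import all_boot all_order all_algebra.
From mathcomp Require Import all_classical all_reals all_analysis.
From mathcomp.real_closed Require Import complex.
From mathcomp Require Import measurable_realfun zify ring lra.
Import Order.TTheory GRing.Theory Num.Theory.
Import numFieldNormedType.Exports.
Local Open Scope classical_set_scope.
Local Open Scope ring_scope.
Set Implicit Arguments. Unset Strict Implicit. Unset Printing Implicit Defensive.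

(** In Fourier space one step of the walk is an SU(2) matrix V(k) with eigenvalues
    exp(+- i w(k)), where cos w = cos kx cos ky + (s^2 - c^2) sin kx sin ky: the law of
    cosines for a spherical triangle with sides kx, ky, w and a fixed angle. Cayley-Hamilton
    gives V^t = cos(t w) + i sin(t w) N, so by Parseval and dominated convergence the
    characteristic function of (X_t, Y_t) / t tends to an integral over k of cos(xi . h) and
    sin(xi . h), where h = grad w; the even part in k of the initial-state term cancels,
    and its odd part is linear in h. The components of h are the cosines of the two other
    angles of the triangle. Fixing kx, the map ky |-> h1 is decreasing, and fixing h1, the
    component h2 is affine in cos kx; two one-dimensional substitutions thus carry dkx dky
    on (0, pi)^2 to du dv / ((1 - u^2) (1 - v^2)) on the ellipse D. Finally the indicator
    of a quadrant is squeezed between trigonometric polynomials. *)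

(** Parseval turns the phase e^(i xi.X/t) into a shift of the frequency by xi/t: the characteristic
    function is a mean over frequencies p of the pairing of V(p)^t phi with V(p - xi/t)^t phi. Each
    factor oscillates without limit, but their phases differ by t (w(p - xi/t) - w(p)), up to sign a
    difference quotient of w; this is where the gradient comes from. In the code [k] is not a
    frequency but s^2 - c^2 = - cos (2 gamma), the cosine of the fixed angle of the triangle; its
    sine is 2 |c s| = |sin (2 gamma)|. The excluded values of gamma are those at which the triangle
    degenerates. Real and imaginary parts, that is, cosine and sine means, are kept apart, so that
    all integrals are real. Trigonometric polynomials are closed under products. Iterating a cubic
    polynomial on a sine therefore gives steepening steps that stay among the functions whose limit
    is known. The squeeze takes place on [-1, 1]^2, which carries both the rescaled walk and the
    ellipse. *)

(** * Substitution on open intervals *)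

(** The denominators start at 3 so that e n <= (b - a) / 3: the end points of even the first closed
    interval are in order. *)
Lemma itvcc_exhaust (R : realType) (a b : R) : a < b ->
  let e := fun n : nat => (b - a) / n.+3%:R in
  \bigcup_n `[a + e n, b - e n]%classic = `]a, b[%classic.
Proof.
move=> ab e; apply/seteqP; split => x /=.
  move=> [n _]; rewrite /= !in_itv/= => /andP[h1 h2].
  have e0 : 0 < e n by rewrite divr_gt0// subr_gt0.
  by apply/andP; split; lra.
rewrite in_itv/= => /andP[ax xb].
pose m := Num.min (x - a) (b - x).
have m0 : 0 < m by rewrite lt_min !subr_gt0 ax xb.
have [n hn] : exists n : nat, (b - a) / m < n%:R.
  exists (Num.truncn ((b - a) / m)).+1; exact: truncnS_gt.
exists n => //=; rewrite in_itv/=.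
have : e n <= m.
  rewrite /e ler_pdivrMr// mulrC -ler_pdivrMr//.
  by apply/ltW/(lt_trans hn); rewrite ltr_nat (leq_addl 2 n.+1).
by rewrite /m le_min => /andP[h1 h2]; apply/andP; split; lra.
Qed.

(* On an open interval [G] may blow up at the end points, as the densities below do. *)
Lemma ge0_substitution_decreasing_oo (R : realType) (F f G : R -> R) (a b : R) :
  a < b ->
  (forall x, x \in `]a, b[ -> is_derive x 1 F (f x)) ->
  (forall x, x \in `]a, b[ -> {for x, continuous f}) ->
  (forall x, x \in `]a, b[ -> f x < 0) ->
  {within `[a, b], continuous F} ->
  (forall x, x \in `]F b, F a[ -> {for x, continuous G}) ->
  (forall x, x \in `]F b, F a[ -> 0 <= G x) ->
  (\int[lebesgue_measure]_(x in `]F b, F a[) (G x)%:E =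
   \int[lebesgue_measure]_(x in `]a, b[) (G (F x) * - f x)%:E)%E.
Proof.
move=> ab dF cf f0 cF cG G0.
have decF : {in `[a, b] &, {homo F : x y /~ x < y}}.
  move=> x y xab yab yx.
  apply: (ltr0_derive1_lt_cc (f := F) (a := a) (b := b)) => //.
  - by move=> z zab; have [] := dF _ zab.
  - by move=> z zab; rewrite derive1E; have := dF _ zab => dFz; rewrite derive_val f0.
have decleF x y : x \in `[a, b] -> y \in `[a, b] -> x <= y -> F y <= F x.
  by move=> xI yI; rewrite le_eqVlt => /orP[/eqP->//|xy]; apply/ltW/decF.
pose e := fun n : nat => (b - a) / n.+3%:R.
pose u n := a + e n; pose v n := b - e n.
have e0 n : 0 < e n by rewrite divr_gt0// subr_gt0.
have ndece n m : (n <= m)%N -> e m <= e n.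
  move=> nm; apply: ler_wpM2l; first by rewrite subr_ge0 ltW.
  by rewrite lef_pV2 ?posrE// ler_nat !ltnS.
have e3 n : e n <= (b - a) / 3.
  apply: ler_wpM2l; first by rewrite subr_ge0 ltW.
  by rewrite lef_pV2 ?posrE// ler_nat.
have uab n : u n \in `]a, b[.
  rewrite in_itv/= /u; have := e0 n; have := e3 n; lra.
have vab n : v n \in `]a, b[.
  rewrite in_itv/= /v; have := e0 n; have := e3 n; lra.
have uv n : u n < v n.
  by rewrite /u /v; have := e0 n; have := e3 n; lra.
have oocc : {subset `]a, b[ <= `[a, b]} by apply: subset_itv_oo_cc.
have aI : a \in `[a, b] by rewrite in_itv/= lexx ltW.
have bI : b \in `[a, b] by rewrite in_itv/= lexx ltW.
have Fin x : x \in `]a, b[ -> F x \in `]F b, F a[.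
  move=> xab; have := xab; rewrite !in_itv/= => /andP[ax xb].
  by rewrite !decF// oocc.
(* Both sides are monotone limits of integrals over closed intervals inside the open ones; there the
   integrands are continuous and the classical formula applies. *)
have cvg1 : (\int[lebesgue_measure]_(x in `[F (v n), F (u n)]) (G x)%:E)%E
     @[n --> \oo] --> (\int[lebesgue_measure]_(x in `]F b, F a[) (G x)%:E)%E.
  have -> : `]F b, F a[%classic = \bigcup_n `[F (v n), F (u n)]%classic.
    apply/seteqP; split => y /=.
      move=> yI.
      have := yI; rewrite in_itv/= => /andP[y1 y2].
      have [x xab Fxy] : exists2 x, x \in `[a, b] & F x = y.
        apply: IVT => //; first exact: ltW.
        by rewrite ge_min le_max (ltW y1) (ltW y2) orbT.
      have : `]a, b[%classic x.
        move: xab; rewrite /= !in_itv/= !le_eqVlt => /andP[/orP[/eqP xa|->]/=].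
          by move: y2; rewrite -Fxy xa ltxx.
        move=> /orP[/eqP xb|->//].
        by move: y1; rewrite -Fxy xb ltxx.
      rewrite -itvcc_exhaust// => -[n _ /=]; rewrite -/(u n) -/(v n) in_itv/= => /andP[h1 h2].
      exists n => //=; rewrite in_itv/= -Fxy.
      by rewrite !decleF// oocc.
    move=> [n _] /=; rewrite !in_itv/= => /andP[h1 h2].
    have := Fin _ (uab n); have := Fin _ (vab n); rewrite !in_itv/=; lra.
  have sub n : `[F (v n), F (u n)]%classic `<=` `]F b, F a[%classic.
    move=> x /=; rewrite !in_itv/= => /andP[h1 h2].
    have := Fin _ (uab n); have := Fin _ (vab n); rewrite !in_itv/=; lra.
  apply: ge0_nondecreasing_set_cvg_integral => //.
  - move=> n m nm; apply/subsetPset => x /=; rewrite !in_itv/= => /andP[h1 h2].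
    have := ndece _ _ nm => em.
    apply/andP; split; first apply: le_trans h1; last apply: (le_trans h2).
      by apply: decleF; rewrite ?oocc// /v lerD2l lerN2.
    by apply: decleF; rewrite ?oocc// /u lerD2l.
  - move=> n; apply/measurable_EFinP.
    apply: (@measurable_funS _ _ _ _ `]F b, F a[%classic) => //.
    apply: open_continuous_measurable_fun; first exact: interval_open.
    by move=> x; rewrite inE /= => xI; exact: cG.
  - by move=> n x xI; rewrite lee_fin G0//; exact: (sub n).
have cvg2 : (\int[lebesgue_measure]_(x in `[u n, v n]) (G (F x) * - f x)%:E)%E
     @[n --> \oo] --> (\int[lebesgue_measure]_(x in `]a, b[) (G (F x) * - f x)%:E)%E.
  rewrite -itvcc_exhaust//.
  have sub n : `[u n, v n]%classic `<=` `]a, b[%classic.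
    by rewrite -itvcc_exhaust// => x xI; exists n.
  apply: ge0_nondecreasing_set_cvg_integral => //.
  - move=> n m nm; apply/subsetPset => x /=; rewrite !in_itv/= => /andP[h1 h2].
    have em := ndece _ _ nm.
    apply/andP; split; first by apply: le_trans h1; rewrite lerD2l.
    by apply: (le_trans h2); rewrite lerD2l lerN2.
  - move=> n; apply/measurable_EFinP.
    apply: (@measurable_funS _ _ _ _ `]a, b[%classic) => //.
    apply: open_continuous_measurable_fun; first exact: interval_open.
    move=> x; rewrite inE /= => xI.
    apply: cvgM; last by apply: cvgN; exact: cf.
    apply: (@continuous_comp _ _ _ F G); last exact/cG/Fin.
    by apply: differentiable_continuous; apply/derivable1_diffP; have [] := dF _ xI.
  - move=> n x xI; rewrite lee_fin mulr_ge0//.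
      by rewrite G0// Fin//; exact: (sub n).
    by rewrite oppr_ge0 ltW// f0//; exact: (sub n).
have E n : (\int[lebesgue_measure]_(x in `[F (v n), F (u n)]) (G x)%:E =
  \int[lebesgue_measure]_(x in `[u n, v n]) (G (F x) * - f x)%:E)%E.
  have suv x : x \in `[u n, v n] -> x \in `]a, b[.
    rewrite !in_itv/= => /andP[h1 h2].
    by have := uab n; have := vab n; rewrite !in_itv/=; lra.
  have suv' : {subset `]u n, v n[ <= `]a, b[} by move=> x /subset_itv_oo_cc/suv.
  have F'E x : x \in `]a, b[ -> derive1 F x = f x.
    by move=> xI; rewrite derive1E; have := dF _ xI => dFx; rewrite derive_val.
  have F'c x : x \in `]a, b[ -> {for x, continuous (derive1 F)}.
    move=> xI; rewrite /prop_for /continuous_at F'E//.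
    have := cf _ xI; rewrite /prop_for /continuous_at; apply: cvg_trans.
    apply: near_eq_cvg; near=> z; rewrite F'E//; near: z; exact: near_in_itvoo.
  have Fc x : x \in `]a, b[ -> {for x, continuous F}.
    move=> xI; apply: differentiable_continuous; apply/derivable1_diffP.
    by have [] := dF _ xI.
  rewrite integration_by_substitution_decreasing; [|exact/ltW| | | | | |].
  - apply: eq_integral => x; rewrite inE/= => xI.
    by rewrite !fctE F'E// suv.
  - by move=> x y xI yI; apply: decF; apply/oocc/suv.
  - by move=> x xI; apply: F'c; exact: suv'.
  - apply/cvg_ex; exists (derive1 F (u n)); apply: cvg_at_right_filter; exact: F'c.
  - apply/cvg_ex; exists (derive1 F (v n)); apply: cvg_at_left_filter; exact: F'c.
  - split.
    + by move=> x xI; have [] := dF _ (suv' _ xI).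
    + by apply: cvg_at_right_filter; exact: Fc.
    + by apply: cvg_at_left_filter; exact: Fc.
  - apply: continuous_in_subspaceT => x; rewrite inE/= in_itv/= => /andP[h1 h2].
    apply: cG.
    have := Fin _ (uab n); have := Fin _ (vab n); rewrite !in_itv/=; lra.
move: cvg1; rewrite (funext E) => cvg1.
exact: (cvg_unique _ cvg1 cvg2).
Unshelve. all: end_near. Qed.

(** * The dispersion relation as spherical trigonometry *)

Section spherical.
Variable R : realType.
Variables k s : R.
Hypothesis ks : s ^+ 2 = 1 - k ^+ 2.
Hypothesis s0 : 0 < s.

(* [cosw] and [sinw] are the cosine and sine of the side w opposite to the angle arccos k;
   [velu] and [velv] are the partial derivatives of w with respect to a and b, that is,
   the cosines of the two other angles. *)
Definition cosw a b : R := cos a * cos b + k * sin a * sin b.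
Definition sinw a b : R := Num.sqrt (1 - cosw a b ^+ 2).
Definition numu a b : R := sin a * cos b - k * cos a * sin b.
Definition numv a b : R := cos a * sin b - k * sin a * cos b.
Definition velu a b : R := numu a b / sinw a b.
Definition velv a b : R := numv a b / sinw a b.

Let c2s (x : R) : cos x ^+ 2 = 1 - sin x ^+ 2.
Proof. by rewrite -(cos2Dsin2 x) addrK. Qed.

Lemma cosw_sym a b : cosw a b = cosw b a.
Proof. by rewrite /cosw; ring. Qed.

(** ([cosw], [numu]) is the image of the vector (cos b, k sin b) under an orthogonal map depending
    on a, so the squares add up to cos^2 b + k^2 sin^2 b. *)
Lemma sinw_sqE a b : 1 - cosw a b ^+ 2 = numu a b ^+ 2 + s ^+ 2 * sin b ^+ 2.
Proof.
apply/eqP; rewrite -subr_eq0; apply/eqP; rewrite /cosw /numu.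
have := c2s a; have := c2s b; move: ks.
move: (cos a) (sin a) (cos b) (sin b) => ca sa cb sb hk hb ha.
(* The difference of the two sides lies in the ideal generated by the Pythagorean relations for a
   and b and by [ks]; these are explicit cofactors. *)
transitivity ((- cb ^+ 2 - k ^+ 2 * sb ^+ 2) * (ca ^+ 2 - (1 - sa ^+ 2))
  - (cb ^+ 2 - (1 - sb ^+ 2)) - sb ^+ 2 * (s ^+ 2 - (1 - k ^+ 2))); first by ring.
by rewrite ha hb hk !subrr !mulr0 !subr0.
Qed.

Lemma sinw_sqE' a b : 1 - cosw a b ^+ 2 = numv a b ^+ 2 + s ^+ 2 * sin a ^+ 2.
Proof. by rewrite cosw_sym sinw_sqE /numu /numv; congr (_ ^+ 2 + _); ring. Qed.

(** A condition on a alone keeps sin w away from 0, whatever b is; this leaves b free to vary in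
    derivatives and substitutions. *)
Lemma sinw_sq_gt0 a b : sin a != 0 -> 0 < 1 - cosw a b ^+ 2.
Proof.
move=> sa; rewrite sinw_sqE'; apply: ltr_wpDl; first exact: sqr_ge0.
by rewrite mulr_gt0// exprn_even_gt0//= gt_eqF.
Qed.

Lemma sinw_gt0 a b : sin a != 0 -> 0 < sinw a b.
Proof. by move=> sa; rewrite sqrtr_gt0 sinw_sq_gt0. Qed.

Lemma sqr_sinw a b : sin a != 0 -> sinw a b ^+ 2 = 1 - cosw a b ^+ 2.
Proof. by move=> sa; rewrite sqr_sqrtr// ltW// sinw_sq_gt0. Qed.

(** The law of sines, [velu] being the cosine of the angle opposite to b. *)
Lemma onem_velu_sq a b : sin a != 0 ->
  1 - velu a b ^+ 2 = (s * sin b / sinw a b) ^+ 2.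
Proof.
move=> sa; have S0 : sinw a b != 0 by rewrite gt_eqF// sinw_gt0.
have := sqr_sinw b sa; rewrite sinw_sqE => E.
rewrite /velu !expr_div_n -[X in X - _](divff (expf_neq0 2 S0)) -mulrBl.
by congr (_ / _); rewrite E exprMn; ring.
Qed.

Lemma onem_velv_sq a b : sin a != 0 ->
  1 - velv a b ^+ 2 = (s * sin a / sinw a b) ^+ 2.
Proof.
move=> sa; have S0 : sinw a b != 0 by rewrite gt_eqF// sinw_gt0.
have := sqr_sinw b sa; rewrite sinw_sqE' => E.
rewrite /velv !expr_div_n -[X in X - _](divff (expf_neq0 2 S0)) -mulrBl.
by congr (_ / _); rewrite E exprMn; ring.
Qed.

Lemma numvE a b : numv a b = - k * numu a b + s ^+ 2 * sin b * cos a.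
Proof. by rewrite /numv /numu ks; ring. Qed.

Lemma sqrt_onem_velu a b : 0 < sin a -> 0 <= sin b ->
  Num.sqrt (1 - velu a b ^+ 2) = s * sin b / sinw a b.
Proof.
move=> sa sb; rewrite onem_velu_sq ?gt_eqF// sqrtr_sqr ger0_norm//.
by rewrite divr_ge0 ?mulr_ge0 ?(ltW s0)// sqrtr_ge0.
Qed.

(* The law of cosines for the angles of the triangle. *)
Lemma velvE a b : 0 < sin a -> 0 <= sin b ->
  velv a b = - k * velu a b + Num.sqrt (1 - velu a b ^+ 2) * s * cos a.
Proof.
move=> sa sb; rewrite sqrt_onem_velu// /velv numvE /velu.
have S0 : sinw a b != 0 by rewrite gt_eqF// sinw_gt0// gt_eqF.
by field.
Qed.

Lemma is_derive_cosw (a b : R) : is_derive b 1 (cosw a) (- numv a b).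
Proof.
have D := is_deriveD (is_deriveZ (cos a) (is_derive_cos b))
  (is_deriveZ (k * sin a) (is_derive_sin b)).
have -> : - numv a b = cos a *: - sin b + (k * sin a) *: cos b.
  by rewrite /numv /GRing.scale/=; ring.
exact: D.
Qed.

Lemma is_derive_numu (a b : R) : is_derive b 1 (numu a) (- sin a * sin b - k * cos a * cos b).
Proof.
have -> : numu a = (sin a *: (@cos R) - (k * cos a) *: (@sin R))%R.
  by apply/funext => x; rewrite /numu !fctE.
apply: is_derive_eq; rewrite /GRing.scale/=; ring.
Qed.

Lemma is_derive_sinw (a b : R) : sin a != 0 ->
  is_derive b 1 (sinw a) (cosw a b * numv a b / sinw a b).
Proof.
move=> sa.
have hd : is_derive b 1 (fun x => 1 - cosw a x ^+ 2) (2 * cosw a b * numv a b).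
  have dc := is_derive_cosw a b.
  have -> : (fun x => 1 - cosw a x ^+ 2) = (cst 1 - (cosw a) ^+ 2)%R.
    by apply/funext => x; rewrite !fctE.
  apply: is_derive_eq; rewrite /GRing.scale/=; ring.
have hs := is_derive1_sqrt (sinw_sq_gt0 b sa).
have H : is_derive b 1 (sinw a) _ :=
  @is_derive1_comp _ Num.sqrt (fun x => 1 - cosw a x ^+ 2) b _ _ hs hd.
apply: is_derive_eq.
have S0 : sinw a b != 0 by rewrite gt_eqF// sinw_gt0.
by rewrite -/(sinw a b); field.
Qed.

(** The numerator of the quotient rule collapses to one product, of constant sign for a and b in (0,
    pi); hence b |-> [velu] is a decreasing substitution there. *)
Lemma is_derive_velu (a b : R) : sin a != 0 ->
  is_derive b 1 (velu a) (- (s ^+ 2 * sin a * sin b / sinw a b ^+ 3)).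
Proof.
move=> sa; have S0 : sinw a b != 0 by rewrite gt_eqF// sinw_gt0.
have dS := is_derive_sinw b sa; have dN := is_derive_numu a b.
have dV := is_deriveV S0 dS.
have -> : velu a = (numu a * (fun x => (sinw a x)^-1))%R.
  by apply/funext => x; rewrite /velu !fctE.
apply: is_derive_eq; rewrite /GRing.scale/=.
have E : (- sin a * sin b - k * cos a * cos b) * (1 - cosw a b ^+ 2)
   - numu a b * numv a b * cosw a b + s ^+ 2 * sin a * sin b = 0.
  rewrite /cosw /numu /numv.
  have := c2s a; have := c2s b; move: ks.
  move: (cos a) (sin a) (cos b) (sin b) => ca sa' cb sb hk hb ha.
  transitivity ((ca * cb ^+ 3 * k + cb ^+ 2 * k ^+ 2 * sa' * sb +
     ca * cb * k * sb ^+ 2 + k ^+ 2 * sa' * sb ^+ 3) * (ca ^+ 2 - (1 - sa' ^+ 2))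
   + (ca * cb * k + k ^+ 2 * sa' * sb) * (cb ^+ 2 - (1 - sb ^+ 2))
   + sa' * sb * (s ^+ 2 - (1 - k ^+ 2))); first by ring.
  by rewrite ha hb hk !subrr !mulr0 !addr0.
rewrite -sqr_sinw// in E.
apply/eqP; rewrite -subr_eq0; apply/eqP.
transitivity (((- sin a * sin b - k * cos a * cos b) * sinw a b ^+ 2
   - numu a b * numv a b * cosw a b + s ^+ 2 * sin a * sin b) / sinw a b ^+ 3).
  by field.
by rewrite E mul0r.
Qed.

End spherical.

(** Inversion is continuous off 0, and a single point is harmless. Quotients such as [velu] are then
    measurable on the whole plane, the zeros of sin w included. *)
Lemma measurable_invr (R : realType) : measurable_fun [set: R] (@GRing.inv R).
Proof.
rewrite -(setUv [set 0]); apply/measurable_funU => //; first exact: measurableC.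
split; first exact: measurable_fun_set1.
apply: open_continuous_measurable_fun; first exact/closed_openC/closed_eq.
by move=> x; rewrite inE/= => /eqP x0; exact: inv_continuous.
Qed.

Lemma measurable_funV d (T : measurableType d) (R : realType) (f : T -> R) :
  measurable_fun setT f -> measurable_fun setT (fun x => (f x)^-1).
Proof. by move=> mf; apply: measurableT_comp => //; exact: measurable_invr. Qed.

(** * Measurability and iterated integrals *)

Section measurability_rules.
Context d (T : measurableType d) (R : realType).
Implicit Types f g : T -> R.

(** This rule and the following ones are stated pointwise and on the whole space, the form that the
    tactic [mfun] matches. *)
Lemma mfunM f g : measurable_fun setT f -> measurable_fun setT g ->
  measurable_fun setT (fun x => f x * g x).
Proof. exact: measurable_funM. Qed.

Lemma mfunD f g : measurable_fun setT f -> measurable_fun setT g ->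
  measurable_fun setT (fun x => f x + g x).
Proof. exact: measurable_funD. Qed.

Lemma mfunN f : measurable_fun setT f -> measurable_fun setT (fun x => - f x).
Proof. by move=> mf; apply: measurableT_comp mf. Qed.

Lemma mfunX n f : measurable_fun setT f -> measurable_fun setT (fun x => f x ^+ n).
Proof. exact: measurable_funX. Qed.

Lemma mfun_cos f : measurable_fun setT f -> measurable_fun setT (fun x => cos (f x)).
Proof.
apply: measurableT_comp; apply: continuous_measurable_fun; exact: continuous_cos.
Qed.

Lemma mfun_sin f : measurable_fun setT f -> measurable_fun setT (fun x => sin (f x)).
Proof.
apply: measurableT_comp; apply: continuous_measurable_fun; exact: continuous_sin.
Qed.

Lemma mfun_sqrt f : measurable_fun setT f ->
  measurable_fun setT (fun x => Num.sqrt (f x)).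
Proof.
apply: measurableT_comp; apply: continuous_measurable_fun; exact: sqrt_continuous.
Qed.

Lemma mfun_lt f g : measurable_fun setT f -> measurable_fun setT g ->
  measurable_fun setT (fun x => f x < g x).
Proof. exact: measurable_fun_ltr. Qed.

Lemma mfun_if (b : T -> bool) f g : measurable_fun setT b ->
  measurable_fun setT f -> measurable_fun setT g ->
  measurable_fun setT (fun x => if b x then f x else g x).
Proof. exact: measurable_fun_ifT. Qed.

End measurability_rules.

Ltac mfun := repeat first
  [ assumption | exact: measurable_cst | exact: measurable_fst
  | exact: measurable_snd | exact: measurable_id | apply: mfunM | apply: mfunD | apply: mfunN
  | apply: mfunX | apply: measurable_funV | apply: mfun_cos | apply: mfun_sin
  | apply: mfun_sqrt | apply: mfun_if | apply: mfun_lt ].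

Section tonelli_rect.
Variables (R : realType) (A B : set R) (g : R * R -> R).
Hypotheses (mA : measurable A) (mB : measurable B).
Hypothesis mg : measurable_fun setT g.
Hypothesis g0 : forall x y, A x -> B y -> 0 <= g (x, y).
Local Notation mu := (@lebesgue_measure R).

Let gAB := patch (cst 0%E) (A `*` B) (EFin \o g).

Let mgAB : measurable_fun setT gAB.
Proof.
apply/(measurable_restrictT _ _).1; first exact: measurableX.
by apply: measurable_funTS; exact/measurable_EFinP.
Qed.

Let gAB0 z : (0 <= gAB z)%E.
Proof.
rewrite /gAB patchE; case: z => x y; case: ifPn => // /set_mem [] /= xA yB.
by rewrite lee_fin g0.
Qed.

(** Extension by 0 reduces this to the whole plane. Positivity is asked on the rectangle only,
    because the Jacobians below change sign outside it. *)
Lemma tonelli_rect1 : (\int[mu \x mu]_(z in A `*` B) (g z)%:E =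
  \int[mu]_(x in A) \int[mu]_(y in B) (g (x, y))%:E)%E.
Proof.
rewrite integral_mkcond [LHS]fubini_tonelli1//.
rewrite [RHS]integral_mkcond; apply: eq_integral => x _.
rewrite /fubini_F patchE; case: ifPn => xA.
  rewrite [RHS]integral_mkcond; apply: eq_integral => y _.
  by rewrite !patchE in_setX/= xA.
rewrite integral0_eq// => y _.
by rewrite patchE in_setX/= (negbTE xA).
Qed.

Lemma tonelli_rect2 : (\int[mu \x mu]_(z in A `*` B) (g z)%:E =
  \int[mu]_(y in B) \int[mu]_(x in A) (g (x, y))%:E)%E.
Proof.
rewrite integral_mkcond fubini_tonelli1// fubini_tonelli//.
rewrite [RHS]integral_mkcond; apply: eq_integral => y _.
rewrite /fubini_G patchE; case: ifPn => yB.
  rewrite [RHS]integral_mkcond; apply: eq_integral => x _.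
  by rewrite !patchE in_setX/= yB andbT.
rewrite integral0_eq// => x _.
by rewrite patchE in_setX/= (negbTE yB) andbF.
Qed.

End tonelli_rect.

(** * The law of the group velocity *)

(** For k = s^2 - c^2 this is D with denominators cleared. Geometrically, 1 - u^2 - v^2 - k^2 - 2 k
    u v > 0 is the Gram condition for a spherical triangle whose angles have cosines u, v, k. *)
Definition in_ellipse (R : realType) (k u v : R) : bool :=
  u ^+ 2 + v ^+ 2 + 2 * k * u * v < 1 - k ^+ 2.

Definition arcsine_density (R : realType) (k u v : R) : R :=
  if in_ellipse k u v then ((1 - u ^+ 2) * (1 - v ^+ 2))^-1 else 0.

Section change_of_variables.
Variable R : realType.
Variables k s : R.
Hypothesis ks : s ^+ 2 = 1 - k ^+ 2.
Hypothesis s0 : 0 < s.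
Local Notation mu := (@lebesgue_measure R).
Local Notation uk := (velu k).
Local Notation vk := (velv k).
Local Notation swk := (sinw k).

(** The second velocity component at fixed u, by [velvE]. As a runs through (0, pi), it sweeps the
    slice of the ellipse at u. *)
Definition chord (u a : R) : R := - k * u + Num.sqrt (1 - u ^+ 2) * s * cos a.

(** The squared terms are, up to sign, the coordinates of (k, s c) in an orthonormal frame built on
    the unit vector (u, r), so the squares add up to k^2 + s^2 c^2. *)
Lemma onem_chord_sq (u r c : R) : r ^+ 2 = 1 - u ^+ 2 ->
  1 - (- k * u + r * s * c) ^+ 2
  = s ^+ 2 * (1 - c ^+ 2) + (k * r + s * c * u) ^+ 2.
Proof.
move=> hr; apply/eqP; rewrite -subr_eq0; apply/eqP.
transitivity ((c ^+ 2 * s ^+ 2 + k ^+ 2) * (1 - u ^+ 2 - r ^+ 2)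
  + (1 - k ^+ 2 - s ^+ 2)); first by ring.
by rewrite hr ks !subrr mulr0 addr0.
Qed.

Lemma sqrt_onem_gt0 (u : R) : u \in `]-1, 1[ -> 0 < Num.sqrt (1 - u ^+ 2).
Proof. by rewrite in_itv/= => /andP[h1 h2]; rewrite sqrtr_gt0; nra. Qed.

Lemma sqr_sqrt_onem (u : R) : u \in `]-1, 1[ -> Num.sqrt (1 - u ^+ 2) ^+ 2 = 1 - u ^+ 2.
Proof. by rewrite in_itv/= => /andP[h1 h2]; rewrite sqr_sqrtr//; nra. Qed.

Lemma sin_gt0_itv (a : R) : a \in `]0, pi[ -> 0 < sin a.
Proof. by rewrite in_itv/=; exact: sin_gt0_pi. Qed.

Lemma onem_chord_gt0 (u a : R) : u \in `]-1, 1[ -> a \in `]0, pi[ -> 0 < 1 - chord u a ^+ 2.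
Proof.
move=> uI /sin_gt0_itv sa; rewrite /chord onem_chord_sq ?sqr_sqrt_onem//.
rewrite -(cos2Dsin2 a) (addrC (cos a ^+ 2)) addrK ltr_pwDl ?sqr_ge0//.
by rewrite mulr_gt0 ?exprn_gt0.
Qed.

Lemma velu0 (a : R) : 0 < sin a -> uk a 0 = 1.
Proof.
move=> sa; rewrite /velu /numu /sinw /cosw sin0 cos0.
rewrite !mulr1 !mulr0 subr0 addr0 -sin2cos2.
by rewrite sqrtr_sqr gtr0_norm// divff ?gt_eqF.
Qed.

Lemma velu_pi (a : R) : 0 < sin a -> uk a pi = -1.
Proof.
move=> sa; rewrite /velu /numu /sinw /cosw sinpi cospi.
rewrite !mulrN1 !mulr0 subr0 addr0 sqrrN -sin2cos2.
by rewrite sqrtr_sqr gtr0_norm// mulNr divff ?gt_eqF.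
Qed.

Lemma continuous_is_derive (f : R -> R) (x d : R) :
  is_derive x 1 f d -> {for x, continuous f}.
Proof. by move=> [df _]; apply: differentiable_continuous; apply/derivable1_diffP. Qed.

(** By the law of sines the inverse Jacobian sin^3 w / (s^2 sin a sin b) equals the factor on the
    right, which depends on u and a only. *)
Lemma inner_substitution (G : R * R -> R) (a : R) :
  continuous G -> (forall z, 0 <= G z) -> a \in `]0, pi[ ->
  (\int[mu]_(b in `]0%R, pi[) (G (uk a b, vk a b))%:E =
   \int[mu]_(u in `](-1)%R, 1%R[)
     (G (u, chord u a) *
      (s * sin a / ((1 - chord u a ^+ 2) * Num.sqrt (1 - u ^+ 2))))%:E)%E.
Proof.
move=> cG G0 aI; have sa := sin_gt0_itv aI.
have sa0 : sin a != 0 by rewrite gt_eqF.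
pose f b := - (s ^+ 2 * sin a * sin b / swk a b ^+ 3).
pose H u := G (u, chord u a) *
      (s * sin a / ((1 - chord u a ^+ 2) * Num.sqrt (1 - u ^+ 2))).
have S0 b : 0 < swk a b := sinw_gt0 ks s0 b sa0.
have df b : b \in `]0, pi[ -> is_derive b 1 (uk a) (f b).
  by move=> bI; exact: is_derive_velu.
have cf b : b \in `]0, pi[ -> {for b, continuous f}.
  move=> bI; rewrite /f; apply: cvgN; apply: cvgM.
    by apply: cvgM; [exact: cvg_cst|exact: continuous_sin].
  apply: (@continuous_comp _ _ _ (fun x => swk a x ^+ 3) GRing.inv).
    apply: (@continuous_comp _ _ _ (swk a) (fun x => x ^+ 3)).
      exact: continuous_is_derive (is_derive_sinw ks s0 b sa0).
    exact: exprn_continuous.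
  by apply: inv_continuous; rewrite expf_neq0// gt_eqF.
have f0 b : b \in `]0, pi[ -> f b < 0.
  move=> bI; rewrite /f oppr_lt0 divr_gt0 ?exprn_gt0// !mulr_gt0// ?exprn_gt0//.
  exact: sin_gt0_itv.
have cF : {within `[0, pi], continuous (uk a)}.
  apply: continuous_subspaceT => b.
  exact: continuous_is_derive (is_derive_velu ks s0 b sa0).
have cH u : u \in `]-1, 1[ -> {for u, continuous H}.
  move=> uI.
  have csq : {for u, continuous (fun x : R => Num.sqrt (1 - x ^+ 2))}.
    apply: (@continuous_comp _ _ _ (fun x : R => 1 - x ^+ 2) (@Num.sqrt R)); last exact: sqrt_continuous.
    by apply: cvgB; [exact: cvg_cst|exact: exprn_continuous].
  have cch : {for u, continuous (fun x : R => chord x a)}.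
    apply: cvgD; first by apply: cvgM; [exact: cvg_cst|exact: cvg_id].
    apply: cvgM; last exact: cvg_cst.
    by apply: cvgM; [exact: csq|exact: cvg_cst].
  apply: cvgM.
    apply: (@continuous2_cvg _ _ _ _ _ _ id (fun x => chord x a) (fun x y => G (x, y))).
    - rewrite (_ : (fun z => G (z.1, z.2)) = G); first exact: cG.
      by apply/funext => -[].
    - exact: cvg_id.
    - exact: cch.
  apply: cvgM; first exact: cvg_cst.
  apply: (@continuous_comp _ _ _ (fun x => (1 - chord x a ^+ 2) * Num.sqrt (1 - x ^+ 2)) GRing.inv).
    apply: cvgM; last exact: csq.
    apply: cvgB; first exact: cvg_cst.
    apply: (@continuous_comp _ _ _ (fun x => chord x a) (fun x => x ^+ 2)); first exact: cch.
    exact: exprn_continuous.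
  apply: inv_continuous; rewrite mulf_neq0// gt_eqF//.
    exact: onem_chord_gt0.
  exact: sqrt_onem_gt0.
have H0 u : u \in `]-1, 1[ -> 0 <= H u.
  move=> uI; apply: mulr_ge0; first exact: G0.
  apply: divr_ge0; first by rewrite mulr_ge0// ltW.
  by rewrite mulr_ge0 ?sqrtr_ge0// ltW// onem_chord_gt0.
have subst := ge0_substitution_decreasing_oo (pi_gt0 R) df cf f0 cF.
rewrite velu0// velu_pi// in subst.
rewrite (subst H)//.
apply: eq_integral => b; rewrite inE/= => bI.
have sb := sin_gt0_itv bI.
congr (EFin _); rewrite /H /f opprK.
have E : chord (uk a b) a = vk a b by rewrite (velvE ks s0)// ltW.
rewrite E -mulrA -[LHS]mulr1; congr (_ * _).
rewrite (sqrt_onem_velu ks s0)// ?ltW// (onem_velv_sq ks s0)//.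
by field; rewrite !gt_eqF.
Qed.

(** Completing the square in v writes the slice of the ellipse as (v + k u)^2 < s^2 (1 - u^2). *)
Lemma in_ellipseP (u v : R) : u \in `]-1, 1[ ->
  (v \in `]chord u pi, chord u 0[) = in_ellipse k u v.
Proof.
move=> uI; have r0 := sqrt_onem_gt0 uI; have hr := sqr_sqrt_onem uI.
rewrite /chord cospi cos0 mulrN1 mulr1 in_itv/= /in_ellipse.
set r := Num.sqrt _ in r0 hr *.
have rs0 : 0 < r * s by rewrite mulr_gt0.
transitivity ((v + k * u) ^+ 2 < (r * s) ^+ 2).
  move: (r * s) rs0 => q q0; apply/andP/idP => [[h1 h2]|h]; first by nra.
  by split; rewrite ltNge; apply/negP => h'; nra.
by rewrite exprMn hr ks; apply/idP/idP => h; nra.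
Qed.

End change_of_variables.

Section velocity_law.
Variable R : realType.
Variables k s : R.
Hypothesis ks : s ^+ 2 = 1 - k ^+ 2.
Hypothesis s0 : 0 < s.
Local Notation mu := (@lebesgue_measure R).
Local Notation uk := (velu k).
Local Notation vk := (velv k).
Local Notation chk := (chord k s).

Lemma in_ellipse_onem (u v : R) : in_ellipse k u v ->
  0 < 1 - u ^+ 2 /\ 0 < 1 - v ^+ 2.
Proof.
rewrite /in_ellipse => h.
have s2 : 0 < s ^+ 2 by rewrite exprn_gt0.
split.
  have : 0 < s ^+ 2 * (1 - u ^+ 2).
    by rewrite ks; have := sqr_ge0 (v + k * u); nra.
  by rewrite pmulr_rgt0.
have : 0 < s ^+ 2 * (1 - v ^+ 2).
  by rewrite ks; have := sqr_ge0 (u + k * v); nra.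
by rewrite pmulr_rgt0.
Qed.

Lemma arcsine_density_ge0 (u v : R) : 0 <= arcsine_density k u v.
Proof.
rewrite /arcsine_density; case: ifPn => // /in_ellipse_onem[hu hv].
by rewrite invr_ge0 mulr_ge0// ltW.
Qed.

(** The derivative of the chord is - sqrt (1 - u^2) s sin a: it absorbs the factor s sin a left by
    the inner substitution and completes sqrt (1 - u^2) to 1 - u^2. *)
Lemma outer_substitution (G : R * R -> R) (u : R) :
  continuous G -> (forall z, 0 <= G z) -> u \in `]-1, 1[ ->
  (\int[mu]_(a in `]0%R, pi[) (G (u, chk u a) *
      (s * sin a / ((1 - chk u a ^+ 2) * Num.sqrt (1 - u ^+ 2))))%:E =
   \int[mu]_v (G (u, v) * arcsine_density k u v)%:E)%E.
Proof.
move=> cG G0 uI; have r0 := sqrt_onem_gt0 uI; have hr := sqr_sqrt_onem uI.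
pose f a := - (Num.sqrt (1 - u ^+ 2) * s * sin a).
pose H v := G (u, v) * ((1 - u ^+ 2) * (1 - v ^+ 2))^-1.
have dF (a : R) : is_derive a 1 (chk u) (f a).
  have D := is_deriveD (is_derive_cst (- k * u) a 1)
    (is_deriveZ (Num.sqrt (1 - u ^+ 2) * s) (is_derive_cos a)).
  have -> : f a = 0 + (Num.sqrt (1 - u ^+ 2) * s) *: - sin a.
    by rewrite /f /GRing.scale/=; ring.
  exact: D.
have df (a : R) : a \in `]0, pi[ -> is_derive a 1 (chk u) (f a) by [].
have cf (a : R) : a \in `]0, pi[ -> {for a, continuous f}.
  move=> _; apply: cvgN; apply: cvgM; first exact: cvg_cst.
  exact: continuous_sin.
have f0 a : a \in `]0, pi[ -> f a < 0.
  by move=> /sin_gt0_itv sa; rewrite /f oppr_lt0 !mulr_gt0.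
have cF : {within `[0, pi], continuous (chk u)}.
  apply: continuous_subspaceT => a; exact: continuous_is_derive (dF a).
have cH v : v \in `]chk u pi, chk u 0[ -> {for v, continuous H}.
  rewrite (in_ellipseP ks s0)// => /in_ellipse_onem[hu hv].
  apply: cvgM.
    apply: (@continuous2_cvg _ _ _ _ _ _ (fun=> u) id (fun x y => G (x, y))).
    - rewrite (_ : (fun z => G (z.1, z.2)) = G); first exact: cG.
      by apply/funext => -[].
    - exact: cvg_cst.
    - exact: cvg_id.
  apply: (@continuous_comp _ _ _ (fun x : R => (1 - u ^+ 2) * (1 - x ^+ 2)) GRing.inv).
    apply: cvgM; first exact: cvg_cst.
    by apply: cvgB; [exact: cvg_cst|exact: exprn_continuous].
  by apply: inv_continuous; rewrite mulf_neq0// gt_eqF.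
have H0 v : v \in `]chk u pi, chk u 0[ -> 0 <= H v.
  rewrite (in_ellipseP ks s0)// => /in_ellipse_onem[hu hv].
  by rewrite /H mulr_ge0// invr_ge0 mulr_ge0// ltW.
have subst := ge0_substitution_decreasing_oo (pi_gt0 R) df cf f0 cF cH H0.
transitivity (\int[mu]_(v in `]chk u pi, chk u 0[) (H v)%:E)%E.
  rewrite subst; apply: eq_integral => a; rewrite inE/= => aI.
  congr (EFin _); rewrite /H /f opprK.
  have h := onem_chord_gt0 ks s0 uI aI.
  rewrite -[RHS]mulrA; congr (_ * _).
  move: h hr r0; set w := 1 - chk u a ^+ 2; set r := Num.sqrt _ => h hr' r0'.
  rewrite -hr'.
  by field; rewrite !gt_eqF.
rewrite [LHS]integral_mkcond; apply: eq_integral => v _.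
rewrite patchE /arcsine_density -(in_ellipseP ks s0)//.
by rewrite (_ : (v \in [set` _]) = (v \in `]chk u pi, chk u 0[)) ?mem_setE//;
  case: ifP => //; rewrite mulr0.
Qed.

Lemma measurable_velu : measurable_fun setT (fun z : R * R => uk z.1 z.2).
Proof. by rewrite /velu /sinw /numu /cosw; mfun. Qed.

Lemma measurable_velv : measurable_fun setT (fun z : R * R => vk z.1 z.2).
Proof. by rewrite /velv /sinw /numv /cosw; mfun. Qed.

Let Q : set (R * R) := `]0, pi[%classic `*` `]0, pi[%classic.

Lemma ge0_integral_velocity (G : R * R -> R) :
  continuous G -> measurable_fun setT G -> (forall z, 0 <= G z) ->
  (\int[mu \x mu]_(z in Q) (G (uk z.1 z.2, vk z.1 z.2))%:E =
   \int[mu \x mu]_z (G z * arcsine_density k z.1 z.2)%:E)%E.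
Proof.
move=> cG mG G0.
have mi : measurable (`]0, pi[%classic : set R) by [].
rewrite tonelli_rect1//; last first.
  apply: (measurableT_comp mG); apply: measurable_fun_pair => /=.
    exact: measurable_velu.
  exact: measurable_velv.
under eq_integral.
  move=> a; rewrite inE/= => aI.
  rewrite (inner_substitution ks s0)//.
  over.
pose K (z : R * R) := G (z.2, chk z.2 z.1) *
   (s * sin z.1 / ((1 - chk z.2 z.1 ^+ 2) * Num.sqrt (1 - z.2 ^+ 2))).
have mK : measurable_fun setT K.
  have mc : measurable_fun setT (fun z : R * R => chk z.2 z.1).
    by rewrite /chord; mfun.
  apply: mfunM; last by mfun.
  by apply: (measurableT_comp mG); apply: measurable_fun_pair => /=; mfun.
have mi' : measurable (`]-1, 1[%classic : set R) by [].
have K0 (a u : R) : `]0, pi[%classic a -> `]-1, 1[%classic u -> 0 <= K (a, u).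
  move=> aI uI; rewrite /K/= mulr_ge0// divr_ge0//.
    by rewrite mulr_ge0// ltW// (sin_gt0_itv aI).
  by rewrite mulr_ge0 ?sqrtr_ge0// ltW// (onem_chord_gt0 ks s0).
(* The order of integration changes between the substitutions: the first one fixes a, the second one
   u. *)
rewrite -[LHS](tonelli_rect1 mi mi' mK K0) (tonelli_rect2 mi mi' mK K0).
under eq_integral.
  move=> u; rewrite inE/= => uI.
  rewrite (outer_substitution cG)//.
  over.
(* The density vanishes for u outside ]-1, 1[, so the integral in u extends to the line. *)
rewrite integral_mkcond -setXTT (tonelli_rect1 (g := fun z => G z * arcsine_density k z.1 z.2))//.
- apply: eq_integral => u _; rewrite patchE; case: ifPn => //= uI.
  rewrite integral0_eq// => v _; rewrite /arcsine_density.
  case: ifPn; rewrite ?mulr0// => /in_ellipse_onem[h _].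
  by move/negP: uI; case; rewrite inE/= in_itv/=; apply/andP; split; nra.
- by apply: mfunM => //; rewrite /arcsine_density /in_ellipse; mfun.
- by move=> *; rewrite mulr_ge0// arcsine_density_ge0.
Qed.

(** Positive and negative parts are transported separately: a maximum with 0 stays continuous, and
    the nonnegative density passes inside it. *)
Lemma integral_velocity (G : R * R -> R) :
  continuous G -> measurable_fun setT G ->
  (\int[mu \x mu]_(z in Q) (G (uk z.1 z.2, vk z.1 z.2))%:E =
   \int[mu \x mu]_z (G z * arcsine_density k z.1 z.2)%:E)%E.
Proof.
move=> cG mG; rewrite [LHS]integralE [RHS]integralE.
have cmax (H : R * R -> R) : continuous H -> continuous (fun z => Num.max (H z) 0).
  by move=> cH z; apply: continuous_max; [exact: cH|exact: cvg_cst].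
have mmax (H : R * R -> R) : measurable_fun setT H ->
    measurable_fun setT (fun z => Num.max (H z) 0).
  by move=> mH; apply: measurable_maxr => //; exact: measurable_cst.
have max0 (x : R) : 0 <= Num.max x 0 by rewrite le_max lexx orbT.
congr (_ - _)%E.
  rewrite -[RHS](_ : (\int[mu \x mu]_z (Num.max (G z) 0 * arcsine_density k z.1 z.2)%:E =
     _)%E); last first.
    apply: eq_integral => z _; rewrite funeposE -EFin_max; congr EFin.
    by rewrite -{2}(mul0r (arcsine_density k z.1 z.2)) maxr_pMl// arcsine_density_ge0.
  rewrite -ge0_integral_velocity//; [|exact: cmax|exact: mmax].
  by apply: eq_integral => z _; rewrite funeposE -EFin_max.
rewrite -[RHS](_ : (\int[mu \x mu]_z (Num.max (- G z) 0 * arcsine_density k z.1 z.2)%:E =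
     _)%E); last first.
  apply: eq_integral => z _; rewrite funenegE -EFinN -EFin_max; congr EFin.
  by rewrite -mulNr -{2}(mul0r (arcsine_density k z.1 z.2)) maxr_pMl// arcsine_density_ge0.
have cN : continuous (fun z => - G z) by move=> z; apply: cvgN; exact: cG.
rewrite -(ge0_integral_velocity (G := fun z => Num.max (- G z) 0))//.
- by apply: eq_integral => z _; rewrite funenegE -EFinN -EFin_max.
- exact: (cmax (fun z => - G z)).
- by apply: (mmax (fun z => - G z)); exact: mfunN.
Qed.

(** The change of variables with G = 1 computes the total mass as the area pi^2 of the square of
    frequencies, although the density blows up where the ellipse touches the lines u, v = 1 and
    -1. *)
Lemma integrable_arcsine_density :
  (mu \x mu)%E.-integrable setT (EFin \o (fun z => arcsine_density k z.1 z.2)).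
Proof.
apply/integrableP; split.
  by apply/measurable_EFinP; rewrite /arcsine_density /in_ellipse; mfun.
have -> : (\int[mu \x mu]_z `|(EFin \o (fun z => arcsine_density k z.1 z.2)) z| =
   \int[mu \x mu]_z (cst 1 z * arcsine_density k z.1 z.2)%:E)%E.
  apply: eq_integral => z _ /=; rewrite mul1r ger0_norm//.
  exact: arcsine_density_ge0.
rewrite -ge0_integral_velocity//; last exact: cst_continuous.
rewrite -[ltLHS]/(\int[mu \x mu]_(z in Q) cst 1%E z)%E integral_cst//=; last exact: measurableX.
rewrite mul1e product_measure1E//= lebesgue_measure_itv/= lte_fin pi_gt0/=.
by rewrite -EFinB -EFinM ltry.
Qed.

End velocity_law.

(** * Fourier analysis of the walk *)

Section complex_pairing.
Local Open Scope complex_scope.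
Variable R : realType.
Implicit Types z w : R[i].

Definition expi (x : R) : R[i] := cos x +i* sin x.

(** The real part of z^* w; [idot] is its imaginary part. *)
Definition rdot z w : R := complex.Re z * complex.Re w + complex.Im z * complex.Im w.
Definition idot z w : R := complex.Re z * complex.Im w - complex.Im z * complex.Re w.

Lemma expiD (x y : R) : expi (x + y) = expi x * expi y.
Proof. by rewrite /expi cosD sinD; simpc; congr (_ +i* _); ring. Qed.

Lemma expi0 : expi 0 = 1.
Proof. by rewrite /expi cos0 sin0. Qed.

Lemma expiNK (x : R) : expi (- x) * expi x = 1.
Proof. by rewrite -expiD addNr expi0. Qed.

Lemma ReD z w : complex.Re (z + w) = complex.Re z + complex.Re w.
Proof. by case: z => a b; case: w => c d. Qed.

Lemma ImD z w : complex.Im (z + w) = complex.Im z + complex.Im w.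
Proof. by case: z => a b; case: w => c d. Qed.

Lemma Re_sum (I : Type) (r : seq I) (P : pred I) (F : I -> R[i]) :
  complex.Re (\sum_(i <- r | P i) F i) = \sum_(i <- r | P i) complex.Re (F i).
Proof. by apply: (big_morph _ ReD). Qed.

Lemma Im_sum (I : Type) (r : seq I) (P : pred I) (F : I -> R[i]) :
  complex.Im (\sum_(i <- r | P i) F i) = \sum_(i <- r | P i) complex.Im (F i).
Proof. by apply: (big_morph _ ImD). Qed.

Lemma rdot_sum (I J : finType) (F : I -> R[i]) (G : J -> R[i]) :
  rdot (\sum_i F i) (\sum_j G j) = \sum_i \sum_j rdot (F i) (G j).
Proof.
rewrite /rdot !Re_sum !Im_sum !big_distrlr/= -big_split; apply: eq_bigr => i _.
by rewrite -big_split.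
Qed.

Lemma idot_sum (I J : finType) (F : I -> R[i]) (G : J -> R[i]) :
  idot (\sum_i F i) (\sum_j G j) = \sum_i \sum_j idot (F i) (G j).
Proof.
rewrite /idot !Re_sum !Im_sum !big_distrlr/= -sumrB; apply: eq_bigr => i _.
by rewrite -sumrB.
Qed.

Lemma rdot_expi z w (x y : R) : rdot (z * expi x) (w * expi y) =
  rdot z w * cos (y - x) - idot z w * sin (y - x).
Proof.
rewrite cosB sinB; case: z => a b; case: w => c d.
by rewrite /expi /rdot /idot; simpc => /=; ring.
Qed.

Lemma idot_expi z w (x y : R) : idot (z * expi x) (w * expi y) =
  rdot z w * sin (y - x) + idot z w * cos (y - x).
Proof.
rewrite cosB sinB; case: z => a b; case: w => c d.
by rewrite /expi /rdot /idot; simpc => /=; ring.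
Qed.

Lemma rdotzz z : rdot z z = normsq z.
Proof. by rewrite /rdot /normsq; ring. Qed.

Lemma idotzz z : idot z z = 0.
Proof. by rewrite /idot; ring. Qed.

End complex_pairing.

(** * Orthogonality of exponentials on (0, pi)^2 *)

Section torus_integrals.
Variable R : realType.
Local Notation mu := (@lebesgue_measure R).
(* The walker stays on the sublattice x = y = t (mod 2), so the exponentials that occur are
   already orthogonal on (0, pi)^2; there w is smooth, with values in (0, pi). *)
Definition half_torus : set (R * R) := `]0, pi[%classic `*` `]0, pi[%classic.

Lemma measurable_half_torus : measurable half_torus.
Proof. exact: measurableX. Qed.

Lemma half_torus_lty : ((mu \x mu) half_torus < +oo)%E.
Proof.
rewrite product_measure1E//= lebesgue_measure_itv/= lte_fin pi_gt0/=.
by rewrite -EFinB -EFinM ltry.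
Qed.

Lemma integrable_half_torus (g : R * R -> R) (M : R) : measurable_fun setT g ->
  (forall z, half_torus z -> `|g z| <= M) ->
  (mu \x mu)%E.-integrable half_torus (EFin \o g).
Proof.
move=> mg gM; apply: measurable_bounded_integrable.
- exact: measurable_half_torus.
- exact: half_torus_lty.
- exact: measurable_funTS.
- exists M; split; first exact: num_real.
  by move=> x Mx z /gM gz; apply: le_trans (ltW Mx).
Qed.

Lemma fubini_half_torus (g : R * R -> R) :
  (mu \x mu)%E.-integrable half_torus (EFin \o g) ->
  (\int[mu \x mu]_(z in half_torus) (g z)%:E =
   \int[mu]_(x in `]0%R, pi[) \int[mu]_(y in `]0%R, pi[) (g (x, y))%:E)%E.
Proof.
move=> ig; rewrite integral_mkcond -integral12_prod_meas1; last first.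
  apply: (iffLR (@integrable_mkcond _ _ _ (mu \x mu)%E half_torus (EFin \o g) _)) ig.
  exact: measurableX.
rewrite [RHS]integral_mkcond; apply: eq_integral => x _.
rewrite /fubini_F patchE; case: ifPn => xA.
  rewrite [RHS]integral_mkcond; apply: eq_integral => y _.
  by rewrite !patchE in_setX/= xA.
rewrite integral0_eq// => y _.
by rewrite patchE in_setX/= (negbTE xA).
Qed.

(** The frequency 2 n is even, so (0, pi) holds whole periods and, for n nonzero, the antiderivative
    agrees at both ends. *)
Lemma integral_trig (al be ph : R) (n : int) :
  (\int[mu]_(y in `]0%R, pi[)
     (al * cos (ph + y * (2 * n)%:~R) - be * sin (ph + y * (2 * n)%:~R))%:E)%E
  = (if n == 0 then pi * (al * cos ph - be * sin ph) else 0)%:E.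
Proof.
pose N : R := (2 * n)%:~R.
pose f y := al * cos (ph + y * N) - be * sin (ph + y * N).
have dlin (y : R) : is_derive y 1 (fun y => ph + y * N) N.
  have -> : (fun y => ph + y * N) = (cst ph + N *: id)%R.
    by apply/funext => x; rewrite !fctE /GRing.scale/= mulrC.
  have D := is_deriveD (is_derive_cst ph y 1) (is_deriveZ N (is_derive_id y 1)).
  by move: D; rewrite add0r /GRing.scale/= mulr1.
have dcos (y : R) : is_derive y 1 (fun y => cos (ph + y * N)) (- sin (ph + y * N) * N).
  exact: (@is_derive1_comp _ cos (fun y => ph + y * N)).
have dsin (y : R) : is_derive y 1 (fun y => sin (ph + y * N)) (cos (ph + y * N) * N).
  exact: (@is_derive1_comp _ sin (fun y => ph + y * N)).
have cf : continuous f.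
  move=> y; apply: cvgB; (apply: cvgM; first exact: cvg_cst).
    have [+ _] := dcos y.
    by move/derivable1_diffP/differentiable_continuous.
  have [+ _] := dsin y.
  by move/derivable1_diffP/differentiable_continuous.
rewrite -[LHS]/(\int[mu]_(y in `]0%R, pi[) (f y)%:E)%E -(integral_itv_bndoo true false); last first.
  apply/measurable_EFinP; apply: measurable_funTS.
  exact: continuous_measurable_fun.
have [n0|n0] := eqVneq n 0.
  have -> : f = cst (al * cos ph - be * sin ph).
    by apply/funext => y; rewrite /f /N n0 /= mulr0 addr0.
  rewrite [LHS](_ : _ = \int[mu]_(y in `[0%R, pi]) cst (al * cos ph - be * sin ph)%:E y)%E//.
  rewrite integral_cst//= lebesgue_measure_itv/= lte_fin pi_gt0/=.
  by rewrite -EFinB -EFinM subr0 mulrC.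
have N0 : N != 0 by rewrite /N intr_eq0 mulf_neq0.
pose F y := (al * sin (ph + y * N) + be * cos (ph + y * N)) / N.
have dF (y : R) : is_derive y 1 F (f y).
  have -> : F = (N^-1 *: (al *: (fun y => sin (ph + y * N)) + be *: (fun y => cos (ph + y * N))))%R.
    by apply/funext => x; rewrite /F !fctE /GRing.scale/= mulrC.
  have D := is_deriveZ N^-1 (is_deriveD (is_deriveZ al (dsin y)) (is_deriveZ be (dcos y))).
  have -> : f y = N^-1 *: (al *: (cos (ph + y * N) * N) + be *: (- sin (ph + y * N) * N)).
    by rewrite /f /GRing.scale/=; field; rewrite intr_eq0.
  exact: D.
have cF : continuous F.
  by move=> y; have [+ _] := dF y; move/derivable1_diffP/differentiable_continuous.
rewrite (@continuous_FTC2 _ f F)//; first last.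
- by move=> y _; rewrite derive1E; have dFy := dF y; rewrite derive_val.
- split.
  + by move=> y _; have [] := dF y.
  + by apply: cvg_at_right_filter; exact: cF.
  + by apply: cvg_at_left_filter; exact: cF.
- exact: continuous_subspaceT.
- exact: pi_gt0.
have per (g : R -> R) : (forall x, g (x + 2 * pi) = g x) -> g (ph + pi * N) = g (ph + 0 * N).
  move=> gper; rewrite mul0r addr0.
  have gn (m : nat) x : g (x + (2 * pi) *+ m) = g x.
    elim: m x => [|m IH] x; first by rewrite mulr0n addr0.
    by rewrite mulrS addrA IH gper.
  rewrite /N; case: (n) => m.
    by rewrite -[RHS](gn m); congr (g (_ + _)); rewrite -mulr_natr intrM; ring.
  rewrite -[LHS](gn m.+1); congr (g _).
  by rewrite NegzE intrM mulrNz -mulr_natr; ring.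
rewrite /F (per sin); last by move=> x; rewrite mulr_natl mulr2n addrA !sinDpi opprK.
rewrite (per cos); last by move=> x; rewrite mulr_natl mulr2n addrA !cosDpi opprK.
by rewrite -EFinB subrr.
Qed.

End torus_integrals.

(** * Parseval for finite Fourier sums *)

Section parseval.
Local Open Scope complex_scope.
Variable R : realType.
Local Notation mu := (@lebesgue_measure R).

Lemma trig_le (al be x : R) : `|al * cos x - be * sin x| <= `|al| + `|be|.
Proof.
apply: (le_trans (ler_normB _ _)); rewrite !normrM.
apply: lerD; rewrite ler_piMr// ler_norml.
  by rewrite cos_geN1 cos_le1.
by rewrite sin_geN1 sin_le1.
Qed.

Let trig2 (al be ph p q : R) (z : R * R) :=
  al * cos (ph + z.1 * p + z.2 * q) - be * sin (ph + z.1 * p + z.2 * q).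

Let integrable_trig2 (al be ph p q : R) :
  (mu \x mu)%E.-integrable (@half_torus R) (EFin \o trig2 al be ph p q).
Proof.
apply: (@integrable_half_torus R _ (`|al| + `|be|)); first by rewrite /trig2; mfun.
by move=> z _; exact: trig_le.
Qed.

Lemma integral_trig2 (al be ph : R) (m n : int) :
  (\int[mu \x mu]_(z in @half_torus R)
     (trig2 al be ph (2 * m)%:~R (2 * n)%:~R z)%:E)%E
  = (if (m == 0) && (n == 0) then pi ^+ 2 * (al * cos ph - be * sin ph) else 0)%:E.
Proof.
rewrite fubini_half_torus; last exact: integrable_trig2.
under eq_integral do rewrite /trig2/= integral_trig.
have [n0|n0] := eqVneq n 0; last by rewrite andbF integral0.
rewrite andbT; under eq_integral do rewrite mulrBr !mulrA.
rewrite integral_trig; case: ifPn => // _.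
by congr (_%:E); ring.
Qed.

Variables (I : finType) (X Y : I -> int) (f : I -> R[i]).
Hypothesis inj : forall i j, X i = X j -> Y i = Y j -> i = j.
Hypothesis par : forall i j, f i != 0 -> f j != 0 ->
  exists m n, X i - X j = 2 * m /\ Y i - Y j = 2 * n.

Let phase (th1 th2 : R) i j (z : R * R) := th1 * (X j)%:~R + th2 * (Y j)%:~R
   + z.1 * (X i - X j)%:~R + z.2 * (Y i - Y j)%:~R.

(** The coefficients [al] and [be] are left free so as to serve both the real and the imaginary
    part. An off-diagonal term vanishes because its coefficients do, or because its frequencies are
    even by [par] and not both 0 by [inj]. *)
Let parseval_gen (al be : I -> I -> R) (th1 th2 : R) :
  (forall i j, f i = 0 \/ f j = 0 -> al i j = 0 /\ be i j = 0) ->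
  (\int[mu \x mu]_(z in @half_torus R) (\sum_i \sum_j
     (al i j * cos (phase th1 th2 i j z) - be i j * sin (phase th1 th2 i j z)))%:E
   = (pi ^+ 2 * \sum_i (al i i * cos (th1 * (X i)%:~R + th2 * (Y i)%:~R)
                     - be i i * sin (th1 * (X i)%:~R + th2 * (Y i)%:~R)))%:E)%E.
Proof.
move=> h0.
under eq_integral do rewrite pair_big/= -sumEFin.
rewrite (@integral_sum _ _ _ (mu \x mu)%E _ _ _ (fun p z => (al p.1 p.2 * cos (phase th1 th2 p.1 p.2 z)
  - be p.1 p.2 * sin (phase th1 th2 p.1 p.2 z))%:E))//=; first last.
- by move=> p; exact: integrable_trig2.
- exact: measurableX.
rewrite mulr_sumr -sumEFin.
have E i j : (\int[mu \x mu]_(z in @half_torus R)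
    (al i j * cos (phase th1 th2 i j z) - be i j * sin (phase th1 th2 i j z))%:E
  = (if i == j then pi ^+ 2 * (al i i * cos (th1 * (X i)%:~R + th2 * (Y i)%:~R)
                     - be i i * sin (th1 * (X i)%:~R + th2 * (Y i)%:~R)) else 0)%:E)%E.
  have [->|ij] := eqVneq i j.
    have := integral_trig2 (al j j) (be j j) (th1 * (X j)%:~R + th2 * (Y j)%:~R) 0 0.
    rewrite eqxx/= => <-; apply: eq_integral => z _.
    by rewrite /trig2 /phase !subrr mulr0.
  have [fi|fi] := eqVneq (f i) 0.
    have [-> ->] := h0 i j (or_introl fi).
    by under eq_integral do rewrite !mul0r subrr; rewrite integral0.
  have [fj|fj] := eqVneq (f j) 0.
    have [-> ->] := h0 i j (or_intror fj).
    by under eq_integral do rewrite !mul0r subrr; rewrite integral0.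
  have [m [n [hm hn]]] := par fi fj.
  have := integral_trig2 (al i j) (be i j) (th1 * (X j)%:~R + th2 * (Y j)%:~R) m n.
  rewrite ifF; first by rewrite /trig2 /phase hm hn.
  apply/negP => /andP[/eqP m0 /eqP n0]; move/eqP: ij; apply; apply: inj.
    by apply/eqP; rewrite -subr_eq0 hm m0 mulr0.
  by apply/eqP; rewrite -subr_eq0 hn n0 mulr0.
pose t i := pi ^+ 2 * (al i i * cos (th1 * (X i)%:~R + th2 * (Y i)%:~R)
                     - be i i * sin (th1 * (X i)%:~R + th2 * (Y i)%:~R)).
transitivity (\sum_i \sum_j (if i == j then t i else 0)%:E)%E.
  by rewrite pair_big; apply: eq_bigr => p _; rewrite E.
apply: eq_bigr => i _; rewrite (bigD1 i)//= eqxx big1 ?adde0// => j ji.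
by rewrite eq_sym (negbTE ji).
Qed.

Definition fourier (a b : R) : R[i] :=
  \sum_i f i * expi (- (a * (X i)%:~R + b * (Y i)%:~R)).

Let phaseE th1 th2 i j (z : R * R) :
  - ((z.1 - th1) * (X j)%:~R + (z.2 - th2) * (Y j)%:~R)
  - - (z.1 * (X i)%:~R + z.2 * (Y i)%:~R) = phase th1 th2 i j z.
Proof. by rewrite /phase !rmorphB/=; ring. Qed.

(** Shifting the frequency in one factor inserts a phase in the sum of |f|^2: this is the real part
    of the characteristic function of the law |f|^2, at (th1, th2). *)
Lemma parseval_re (th1 th2 : R) :
  (\int[mu \x mu]_(z in @half_torus R)
     (rdot (fourier z.1 z.2) (fourier (z.1 - th1) (z.2 - th2)))%:E
   = (pi ^+ 2 * \sum_i normsq (f i) * cos (th1 * (X i)%:~R + th2 * (Y i)%:~R))%:E)%E.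
Proof.
pose ph i := th1 * (X i)%:~R + th2 * (Y i)%:~R.
have -> : \sum_i normsq (f i) * cos (ph i) =
    \sum_i (rdot (f i) (f i) * cos (ph i) - idot (f i) (f i) * sin (ph i)).
  by apply: eq_bigr => i _; rewrite idotzz mul0r subr0 rdotzz.
rewrite -(parseval_gen (al := fun i j => rdot (f i) (f j))
  (be := fun i j => idot (f i) (f j))); last by move=> i j [->|->]; rewrite /rdot /idot/= !(mul0r,mulr0) subrr addr0.
apply: eq_integral => z _; rewrite rdot_sum; congr (_%:E).
apply: eq_bigr => i _; apply: eq_bigr => j _.
by rewrite rdot_expi phaseE.
Qed.

Lemma parseval_im (th1 th2 : R) :
  (\int[mu \x mu]_(z in @half_torus R)
     (idot (fourier z.1 z.2) (fourier (z.1 - th1) (z.2 - th2)))%:E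
   = (pi ^+ 2 * \sum_i normsq (f i) * sin (th1 * (X i)%:~R + th2 * (Y i)%:~R))%:E)%E.
Proof.
pose ph i := th1 * (X i)%:~R + th2 * (Y i)%:~R.
have -> : \sum_i normsq (f i) * sin (ph i) =
    \sum_i (idot (f i) (f i) * cos (ph i) - - rdot (f i) (f i) * sin (ph i)).
  by apply: eq_bigr => i _; rewrite idotzz mul0r sub0r mulNr opprK rdotzz.
rewrite -(parseval_gen (al := fun i j => idot (f i) (f j))
  (be := fun i j => - rdot (f i) (f j))); last by move=> i j [->|->]; rewrite /rdot /idot/= !(mul0r,mulr0) subrr addr0 oppr0.
apply: eq_integral => z _; rewrite idot_sum; congr (_%:E).
apply: eq_bigr => i _; apply: eq_bigr => j _.
by rewrite idot_expi phaseE mulNr opprK addrC.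
Qed.

End parseval.

(** * Sums over growing boxes *)

Section box_sums.
Local Open Scope complex_scope.
Variable V : zmodType.

Definition boxsum (t : nat) (F : int -> int -> V) : V :=
  \sum_(0 <= i < (2 * t).+1) \sum_(0 <= j < (2 * t).+1) F (i%:Z - t%:Z) (j%:Z - t%:Z).

(** The larger range has two more terms, and after a shift by 1 or -1 both lie at the same end,
    outside [-t, t]. *)
Lemma sum_shift (t : nat) (g : int -> V) (e : int) : (e == 1) || (e == -1) ->
  (forall x : int, (t%:Z < `|x|)%R -> g x = 0) ->
  \sum_(0 <= i < (2 * t.+1).+1) g (i%:Z - t.+1%:Z + e) =
  \sum_(0 <= i < (2 * t).+1) g (i%:Z - t%:Z).
Proof.
move=> he g0; have -> : (2 * t.+1).+1 = (2 * t).+3 by lia.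
case/orP: he => /eqP->.
  rewrite !(big_nat_recr (2 * t).+2)//= (big_nat_recr (2 * t).+1)//=.
  rewrite g0 ?[X in _ + X]g0 ?addr0; [|lia|lia].
  by apply: eq_bigr => i _; congr g; lia.
rewrite !(big_nat_recl (2 * t).+2)//= (big_nat_recl (2 * t).+1)//=.
rewrite [X in X + _]g0 ?[X in _ + (X + _)]g0 ?add0r; [|lia|lia].
by apply: eq_bigr => i _; congr g; lia.
Qed.

Lemma boxsum_shift (t : nat) (F : int -> int -> V) (e1 e2 : int) :
  (e1 == 1) || (e1 == -1) -> (e2 == 1) || (e2 == -1) ->
  (forall x y : int, (t%:Z < `|x|)%R || (t%:Z < `|y|)%R -> F x y = 0) ->
  boxsum t.+1 (fun x y => F (x + e1) (y + e2)) = boxsum t F.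
Proof.
move=> h1 h2 F0; rewrite /boxsum.
rewrite (sum_shift (g := fun x => \sum_(0 <= j < (2 * t.+1).+1) F x (j%:Z - t.+1%:Z + e2)))//.
  apply: eq_bigr => i _; apply: (sum_shift (g := F _)) => // y hy.
  by rewrite F0// hy orbT.
by move=> x hx; rewrite big1// => j _; rewrite F0// hx.
Qed.

End box_sums.

(** * The walk in Fourier space *)

Section walk_fourier.
Local Open Scope complex_scope.
Variables (R : realType) (c s : R) (nu0 nu1 : R[i]).

Definition amp (t : nat) (i : 'I_2) (x y : int) : R[i] :=
  qw_state (coinU c s) nu0 nu1 t x y i ord0.

Let i1 : 'I_2 := lift ord0 ord0.

Lemma amp_stepE (t : nat) (x y : int) :
  amp t.+1 ord0 x y =
    c%:C * (c%:C * amp t ord0 (x + 1) (y + 1) + s%:C * amp t i1 (x + 1) (y + 1))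
  + s%:C * (s%:C * amp t ord0 (x - 1) (y + 1) - c%:C * amp t i1 (x - 1) (y + 1))
  /\ amp t.+1 i1 x y =
    s%:C * (c%:C * amp t ord0 (x + 1) (y - 1) + s%:C * amp t i1 (x + 1) (y - 1))
  - c%:C * (s%:C * amp t ord0 (x - 1) (y - 1) - c%:C * amp t i1 (x - 1) (y - 1)).
Proof.
rewrite /amp /qw_state iterS; set psi := iter _ _ _.
rewrite /qw_step /shiftY /applyU /shiftX !mxE !big_ord_recl !big_ord0 !mxE/=.
rewrite !big_ord_recl !big_ord0 !mxE/= -/i1 !addr0.
by rewrite !rmorphN/= !mulNr.
Qed.

(* Records both |x|, |y| <= t and x = y = t (mod 2). *)
Definition in_support (t : nat) (x y : int) : Prop :=
  exists m n : nat, [/\ (m <= t)%N, (n <= t)%N, x = (2 * m)%:Z - t%:Z & y = (2 * n)%:Z - t%:Z].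

Lemma amp_support (t : nat) (x y : int) (i : 'I_2) : amp t i x y != 0 -> in_support t x y.
Proof.
have I2 (j : 'I_2) : j = ord0 \/ j = i1.
  by case: j => -[|[|//]] hj; [left|right]; apply: val_inj.
elim: t x y i => [|t IH] x y i.
  rewrite /amp /qw_state/= /qw_init.
  case: ifPn => [/andP[/eqP-> /eqP->] _|_]; last by rewrite mxE eqxx.
  by exists 0%N, 0%N.
have [E0 E1] := amp_stepE t x y.
have suppS (e1 e2 : int) : (e1 == 1) || (e1 == -1) -> (e2 == 1) || (e2 == -1) ->
    in_support t (x + e1) (y + e2) -> in_support t.+1 x y.
  move=> h1 h2 [m [n [hm hn hx hy]]].
  (* m and n count the moves in the positive directions; arriving from x + 1 is a negative move and
     leaves m unchanged. *)
  exists (if e1 == 1 then m else m.+1), (if e2 == 1 then n else n.+1).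
  by case/orP: h1 => /eqP he1; case/orP: h2 => /eqP he2; rewrite he1 he2/= in hx hy *; split; lia.
have zero (e1 e2 : int) : (e1 == 1) || (e1 == -1) -> (e2 == 1) || (e2 == -1) ->
    ~ in_support t.+1 x y -> forall j, amp t j (x + e1) (y + e2) = 0.
  move=> h1 h2 ns j; apply/eqP; apply: contra_notT ns => /IH; exact: suppS.
move=> ai; apply: contrapT => ns; move/eqP: ai; apply.
by case: (I2 i) => ->; rewrite ?E0 ?E1 !(zero _ _ _ _ ns)// !mulr0 ?subrr ?addr0 !mulr0 ?subrr ?addr0.
Qed.

(** With this sign in the exponent, the move x |-> x - 1 of the coin state 0 becomes the factor e^(i
    a), as in R(k). *)
Definition amp_hat (t : nat) (i : 'I_2) (a b : R) : R[i] :=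
  boxsum t (fun x y => amp t i x y * expi (- (a * x%:~R + b * y%:~R))).

Lemma amp_out (t : nat) (i : 'I_2) (x y : int) :
  (t%:Z < `|x|)%R || (t%:Z < `|y|)%R -> amp t i x y = 0.
Proof.
move=> h; apply/eqP; apply: contraT => /amp_support[m [n [hm hn hx hy]]].
by exfalso; move: h; rewrite hx hy; lia.
Qed.

Let boxsumD t (F G : int -> int -> R[i]) :
  boxsum t (fun x y => F x y + G x y) = boxsum t F + boxsum t G.
Proof. by rewrite /boxsum -big_split; apply: eq_bigr => i _; rewrite -big_split. Qed.

Let boxsumZ t z (F : int -> int -> R[i]) :
  boxsum t (fun x y => z * F x y) = z * boxsum t F.
Proof. by rewrite /boxsum mulr_sumr; apply: eq_bigr => i _; rewrite mulr_sumr. Qed.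

Let amp_hat_shift t i a b (e1 e2 : int) :
  (e1 == 1) || (e1 == -1) -> (e2 == 1) || (e2 == -1) ->
  boxsum t.+1 (fun x y => amp t i (x + e1) (y + e2) * expi (- (a * x%:~R + b * y%:~R)))
  = expi (a * e1%:~R + b * e2%:~R) * amp_hat t i a b.
Proof.
move=> h1 h2; rewrite /amp_hat.
rewrite -(boxsum_shift h1 h2 (F := fun x y => amp t i x y * expi (- (a * x%:~R + b * y%:~R)))).
  rewrite -boxsumZ /boxsum; apply: eq_bigr => j _; apply: eq_bigr => l _.
  rewrite mulrCA -expiD; congr (_ * expi _); rewrite !rmorphD/=; ring.
by move=> x y h; rewrite amp_out// mul0r.
Qed.

Lemma amp_hat0 a b : amp_hat 0 ord0 a b = nu0 /\ amp_hat 0 i1 a b = nu1.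
Proof.
by rewrite /amp_hat /boxsum !big_nat1/= /amp /qw_state/= /qw_init subrr eqxx/= !mxE/=
  !mulr0 addr0 oppr0 expi0 !mulr1.
Qed.

(* The symbol R(b) U R(a) U of one step. *)
Definition walk_symbol (a b : R) (p : R[i] * R[i]) : R[i] * R[i] :=
  let q0 := expi a * (c%:C * p.1 + s%:C * p.2) in
  let q1 := expi (- a) * (s%:C * p.1 - c%:C * p.2) in
  (expi b * (c%:C * q0 + s%:C * q1), expi (- b) * (s%:C * q0 - c%:C * q1)).

Lemma amp_hat_step t a b : (amp_hat t.+1 ord0 a b, amp_hat t.+1 i1 a b) =
  walk_symbol a b (amp_hat t ord0 a b, amp_hat t i1 a b).
Proof.
have h1 : ((1 : int) == 1) || ((1 : int) == -1) by [].
have hN : ((-1 : int) == 1) || ((-1 : int) == -1) by [].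
(* Both components at time t + 1 combine four shifted amplitudes with a common shift in y; the
   transform is computed once for arbitrary coefficients. *)
have E (z0 z1 z2 z3 : R[i]) (e2 : int) (he : (e2 == 1) || (e2 == -1)) :
    boxsum t.+1 (fun x y => (z0 * amp t ord0 (x + 1) (y + e2) + z1 * amp t i1 (x + 1) (y + e2)
     + (z2 * amp t ord0 (x - 1) (y + e2) + z3 * amp t i1 (x - 1) (y + e2)))
       * expi (- (a * x%:~R + b * y%:~R)))
   = expi (b * e2%:~R) * (expi a * (z0 * amp_hat t ord0 a b + z1 * amp_hat t i1 a b)
        + expi (- a) * (z2 * amp_hat t ord0 a b + z3 * amp_hat t i1 a b)).
  have S1 := amp_hat_shift t ord0 a b h1 he; have S2 := amp_hat_shift t i1 a b h1 he.
  have S3 := amp_hat_shift t ord0 a b hN he; have S4 := amp_hat_shift t i1 a b hN he.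
  transitivity (z0 * (expi (a * 1%:~R + b * e2%:~R) * amp_hat t ord0 a b)
     + z1 * (expi (a * 1%:~R + b * e2%:~R) * amp_hat t i1 a b)
     + (z2 * (expi (a * (-1)%:~R + b * e2%:~R) * amp_hat t ord0 a b)
     + z3 * (expi (a * (-1)%:~R + b * e2%:~R) * amp_hat t i1 a b))).
    rewrite -S1 -S2 -S3 -S4 -!boxsumZ -!boxsumD /boxsum.
    by apply: eq_bigr => j _; apply: eq_bigr => l _; rewrite !mulrDl !mulrA.
  have e1 : a * 1%:~R = a by exact: mulr1.
  have eN : a * (-1)%:~R = - a by rewrite mulrNz mulr1z mulrN1.
  rewrite !expiD e1 eN.
  ring.
rewrite /walk_symbol/=; congr pair.
  rewrite [LHS]/amp_hat; transitivity (boxsum t.+1 (fun x y =>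
     (c%:C * c%:C * amp t ord0 (x + 1) (y + 1) + c%:C * s%:C * amp t i1 (x + 1) (y + 1)
     + (s%:C * s%:C * amp t ord0 (x - 1) (y + 1) + - (s%:C * c%:C) * amp t i1 (x - 1) (y + 1)))
       * expi (- (a * x%:~R + b * y%:~R)))).
    rewrite /boxsum; apply: eq_bigr => j _; apply: eq_bigr => l _; congr (_ * _).
    by rewrite (amp_stepE t _ _).1; move: c%:C s%:C => c' s'; ring.
  rewrite (E _ _ _ _ 1)// mulr1.
  move: c%:C s%:C => c' s'; ring.
rewrite [LHS]/amp_hat; transitivity (boxsum t.+1 (fun x y =>
     (s%:C * c%:C * amp t ord0 (x + 1) (y + -1) + s%:C * s%:C * amp t i1 (x + 1) (y + -1)
     + (- (c%:C * s%:C) * amp t ord0 (x - 1) (y + -1) + (c%:C * c%:C) * amp t i1 (x - 1) (y + -1)))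
       * expi (- (a * x%:~R + b * y%:~R)))).
  rewrite /boxsum; apply: eq_bigr => j _; apply: eq_bigr => l _; congr (_ * _).
  by rewrite (amp_stepE t _ _).2; move: c%:C s%:C => c' s'; ring.
rewrite (E _ _ _ _ (-1))// mulrN1.
move: c%:C s%:C => c' s'; ring.
Qed.

End walk_fourier.

(** * Real and imaginary pairings on C^2 *)

Section pair_pairing.
Local Open Scope complex_scope.
Variable R : realType.
Implicit Types p q : R[i] * R[i].

Definition rdot2 p q : R := rdot p.1 q.1 + rdot p.2 q.2.
Definition idot2 p q : R := idot p.1 q.1 + idot p.2 q.2.
Definition comb2 (x y : R) p q : R[i] * R[i] :=
  (x%:C * p.1 + y%:C * q.1, x%:C * p.2 + y%:C * q.2).

Lemma rdot2C p q : rdot2 p q = rdot2 q p.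
Proof. by rewrite /rdot2 /rdot; ring. Qed.

Lemma idot2C p q : idot2 p q = - idot2 q p.
Proof. by rewrite /idot2 /idot; ring. Qed.

Lemma rdot2_combr r x y p q : rdot2 r (comb2 x y p q) = x * rdot2 r p + y * rdot2 r q.
Proof.
case: r => [[a b] [a' b']]; case: p => [[d e] [d' e']]; case: q => [[f g] [f' g']].
by rewrite /rdot2 /rdot /comb2; simpc => /=; ring.
Qed.

Lemma idot2_combr r x y p q : idot2 r (comb2 x y p q) = x * idot2 r p + y * idot2 r q.
Proof.
case: r => [[a b] [a' b']]; case: p => [[d e] [d' e']]; case: q => [[f g] [f' g']].
by rewrite /idot2 /idot /comb2; simpc => /=; ring.
Qed.

Lemma rdot2_combl r x y p q : rdot2 (comb2 x y p q) r = x * rdot2 p r + y * rdot2 q r.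
Proof. by rewrite rdot2C rdot2_combr (rdot2C r p) (rdot2C r q). Qed.

Lemma idot2_combl r x y p q : idot2 (comb2 x y p q) r = x * idot2 p r + y * idot2 q r.
Proof. by rewrite idot2C idot2_combr (idot2C r p) (idot2C r q); ring. Qed.

Lemma idot2pp p : idot2 p p = 0.
Proof. by rewrite /idot2 !idotzz addr0. Qed.

(** Cauchy-Schwarz for unit vectors: the squares (x - y)^2 and (x + y)^2 of matching coordinates,
    summed, bound the pairing on both sides. *)
Lemma rdot2_le p q : rdot2 p p = 1 -> rdot2 q q = 1 -> `|rdot2 p q| <= 1.
Proof.
move=> hp hq; rewrite ler_norml; move: hp hq; rewrite /rdot2 /rdot => hp hq.
have := sqr_ge0 (complex.Re p.1 - complex.Re q.1).
have := sqr_ge0 (complex.Im p.1 - complex.Im q.1).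
have := sqr_ge0 (complex.Re p.2 - complex.Re q.2).
have := sqr_ge0 (complex.Im p.2 - complex.Im q.2).
have := sqr_ge0 (complex.Re p.1 + complex.Re q.1).
have := sqr_ge0 (complex.Im p.1 + complex.Im q.1).
have := sqr_ge0 (complex.Re p.2 + complex.Re q.2).
have := sqr_ge0 (complex.Im p.2 + complex.Im q.2).
by move=> *; apply/andP; split; nra.
Qed.

Lemma idot2_le p q : rdot2 p p = 1 -> rdot2 q q = 1 -> `|idot2 p q| <= 1.
Proof.
move=> hp hq; rewrite ler_norml; move: hp hq; rewrite /rdot2 /idot2 /rdot /idot => hp hq.
have := sqr_ge0 (complex.Re p.1 - complex.Im q.1).
have := sqr_ge0 (complex.Im p.1 - complex.Re q.1).
have := sqr_ge0 (complex.Re p.2 - complex.Im q.2).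
have := sqr_ge0 (complex.Im p.2 - complex.Re q.2).
have := sqr_ge0 (complex.Re p.1 + complex.Im q.1).
have := sqr_ge0 (complex.Im p.1 + complex.Re q.1).
have := sqr_ge0 (complex.Re p.2 + complex.Im q.2).
have := sqr_ge0 (complex.Im p.2 + complex.Re q.2).
by move=> *; apply/andP; split; nra.
Qed.

End pair_pairing.

(** * Algebra of the one-step symbol *)

Section dynamics.
Local Open Scope complex_scope.
Variables (R : realType) (c s : R).
Hypothesis cs1 : c ^+ 2 + s ^+ 2 = 1.
Let k := s ^+ 2 - c ^+ 2.
Local Notation V := (walk_symbol c s).

(** 2 |c s| is the sine of the angle with cosine k, hence the parameter [s] of the spherical
    sections; it is not the sine of the coin angle. *)
Lemma coin_gap_sq : (2 * `|c * s|) ^+ 2 = 1 - k ^+ 2.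
Proof.
by rewrite exprMn real_normK ?num_real// -(expr1n _ 2) -[X in _ = X ^+ 2 - _]cs1 /k; ring.
Qed.

Lemma coin_gap_gt0 : c != 0 -> s != 0 -> 0 < 2 * `|c * s|.
Proof. by move=> c0 s0; rewrite mulr_gt0// normr_gt0 mulf_neq0. Qed.

Lemma expiN (x : R) : expi (- x) = cos x -i* sin x.
Proof. by rewrite /expi cosN sinN. Qed.

Lemma walk_symbol_isometry a b p q : rdot2 (V a b p) (V a b q) = rdot2 p q.
Proof.
have E x (z w : R[i]) : rdot (expi x * z) (expi x * w) = rdot z w.
  by rewrite !(mulrC (expi x)) rdot_expi subrr cos0 sin0 mulr1 mulr0 subr0.
have R2 (z w z' w' : R[i]) : rdot (c%:C * z + s%:C * w) (c%:C * z' + s%:C * w')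
   + rdot (s%:C * z - c%:C * w) (s%:C * z' - c%:C * w') = rdot z z' + rdot w w'.
  rewrite -[RHS]mul1r -cs1; case: z => z0 z1; case: w => w0 w1; case: z' => z0' z1'; case: w' => w0' w1'.
  by rewrite /rdot; simpc => /=; ring.
by rewrite /rdot2 /walk_symbol/= !E R2 !E R2.
Qed.

(** V is in SU(2) with trace 2 cos w, so V plus its adjoint is 2 cos w times the identity. *)
Lemma rdot2_walk_symbol a b p : rdot2 p (V a b p) = cosw k a b * rdot2 p p.
Proof.
(* Inserting c^2 + s^2 in front of cos a cos b makes both sides homogeneous in c and s, so that the
   identity becomes polynomial. *)
rewrite /rdot2 /walk_symbol !expiN /cosw /k -[cos a * _]mul1r -[X in X * (cos a * _)]cs1.
case: p => [[x y] [z w]]; rewrite /expi /rdot; simpc => /=; ring.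
Qed.

(** V - cos w is i times a traceless Hermitian matrix. This is its quadratic form, written in the
    Bloch components of p. *)
Lemma idot2_walk_symbol a b p : idot2 p (V a b p) =
  (normsq p.1 - normsq p.2) * numv k a b
  + 4 * c * s * (rdot p.1 p.2 * (sin a * cos b) - idot p.1 p.2 * (sin a * sin b)).
Proof.
rewrite /idot2 /walk_symbol !expiN /numv /k -[cos a * _]mul1r -[X in X * (cos a * _)]cs1.
case: p => [[x y] [z w]]; rewrite /expi /rdot /idot /normsq; simpc => /=; ring.
Qed.

Lemma walk_symbol_cayley a b p :
  V a b (V a b p) = comb2 (2 * cosw k a b) (-1) (V a b p) p.
Proof.
have ea := expiNK a; have eb := expiNK b.
have Ecos : (2 * cosw k a b)%:C = c%:C ^+ 2 * (expi a * expi b + expi (- a) * expi (- b))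
   + s%:C ^+ 2 * (expi a * expi (- b) + expi (- a) * expi b).
  rewrite /cosw /k !expiN /expi -[cos a * _]mul1r -[X in X * (cos a * _)]cs1 !expr2.
  by apply/eqP; rewrite eq_complex; apply/andP; split; apply/eqP => /=; ring.
have cs1' : c%:C ^+ 2 + s%:C ^+ 2 = 1 :> R[i] by rewrite -!rmorphXn -rmorphD cs1.
rewrite /comb2 /walk_symbol/= Ecos rmorphN rmorph1.
move: ea eb cs1' {Ecos}; case: p => p0 p1 /=.
move: (expi a) (expi (- a)) (expi b) (expi (- b)) c%:C s%:C => A A' B B' d e.
move=> hA hB hd.
(* Explicit cofactors for the relations A' A = 1, B' B = 1 and d^2 + e^2 = 1; z is the component of
   p concerned. *)
have H (x y z : R[i]) : x - y = - (B * B' * (d ^+ 2 + e ^+ 2) ^+ 2 * z) * (A' * A - 1)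
    - ((d ^+ 2 + e ^+ 2) ^+ 2 * z) * (B' * B - 1)
    - ((d ^+ 2 + e ^+ 2 + 1) * z) * (d ^+ 2 + e ^+ 2 - 1) -> x = y.
  by rewrite hA hB hd !subrr !mulr0 !subr0 => /eqP; rewrite subr_eq0 => /eqP.
by congr pair; [apply: (H _ _ p0)|apply: (H _ _ p1)]; ring.
Qed.

End dynamics.

Lemma comb2_comb2 (R : realType) (x y x1 y1 x2 y2 : R) (p q : R[i] * R[i]) :
  comb2 x y (comb2 x1 y1 p q) (comb2 x2 y2 p q)
  = comb2 (x * x1 + y * x2) (x * y1 + y * y2) p q.
Proof.
rewrite /comb2/= !rmorphD !rmorphM/=.
by congr pair; ring.
Qed.

Lemma comb2_10 (R : realType) (p q : R[i] * R[i]) : comb2 1 0 p q = p.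
Proof. by rewrite /comb2 rmorph1 rmorph0 !mul1r !mul0r !addr0; case: p. Qed.

Lemma rdot2_comb2 (R : realType) (x y x' y' : R) (p q p' q' : R[i] * R[i]) :
  rdot2 (comb2 x y p q) (comb2 x' y' p' q') =
  x * x' * rdot2 p p' + y * x' * rdot2 q p' + x * y' * rdot2 p q' + y * y' * rdot2 q q'.
Proof. by rewrite rdot2_combr !rdot2_combl; ring. Qed.

Lemma idot2_comb2 (R : realType) (x y x' y' : R) (p q p' q' : R[i] * R[i]) :
  idot2 (comb2 x y p q) (comb2 x' y' p' q') =
  x * x' * idot2 p p' + y * x' * idot2 q p' + x * y' * idot2 p q' + y * y' * idot2 q q'.
Proof. by rewrite idot2_combr !idot2_combl; ring. Qed.

Lemma cvg_bounded_mul0 (R : realType) (u v : nat -> R) :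
  (forall n, `|u n| <= 1) -> v @ \oo --> (0 : R) -> (fun n => u n * v n) @ \oo --> (0 : R).
Proof.
move=> u1 v0; apply/norm_cvg0P.
have nv0 : (fun n => `|v n|) @ \oo --> (0 : R) by apply/norm_cvg0P.
apply: (squeeze_cvgr _ (cvg_cst 0) nv0); near=> n.
by rewrite normr_ge0/= normrM ler_piMl.
Unshelve. all: end_near. Qed.

(** Meant for f(h) = w(k - h xi): the phase gained over n steps by a frequency shift xi/n is a
    difference quotient of step 1/n. *)
Lemma cvg_is_derive_seq (R : realType) (f : R -> R) (d : R) : is_derive (0 : R) 1 f d ->
  (fun n : nat => n%:R * (f n%:R^-1 - f 0)) @ \oo --> d.
Proof.
move=> [df <-]; rewrite -cvg_shiftS /=.
have -> : (fun n => n.+1%:R * (f n.+1%:R^-1 - f 0))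
  = (fun n : nat => (@harmonic R n)^-1 *: ((f \o shift 0) (@harmonic R n *: (1 : R)) - f 0)).
  by apply/funext => n; rewrite /harmonic/= invrK /GRing.scale/= mulr1 addr0.
apply: ((cvgr_dnbhsP (fun h : R => h^-1 *: ((f \o shift 0) (h *: (1 : R)) - f 0)) _ _).1 df).
by split; [move=> n; rewrite invr_neq0|exact: cvg_harmonic].
Qed.

Lemma cvg_seq_comp (R : realType) (f : R -> R) (u : nat -> R) (l : R) :
  continuous f -> u @ \oo --> l -> (fun n => f (u n)) @ \oo --> f l.
Proof. by move=> cf ul; exact: (cvg_comp u f ul (cf l)). Qed.

(** * Pointwise limit of the pairings *)

Section pointwise_limit.
Local Open Scope complex_scope.
Variables (R : realType) (c s : R) (phi : R[i] * R[i]).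
Hypothesis cs1 : c ^+ 2 + s ^+ 2 = 1.
Hypothesis phi1 : rdot2 phi phi = 1.
Let k := s ^+ 2 - c ^+ 2.
Variable sg : R.
Hypothesis ks : sg ^+ 2 = 1 - k ^+ 2.
Hypothesis sg0 : 0 < sg.
Local Notation V := (walk_symbol c s).

Definition walk_state (t : nat) (a b : R) := iter t (V a b) phi.

(* In [V^t phi = cos (t w) phi + sin (t w) B], the vector B. *)
Definition walk_dir (a b : R) :=
  comb2 (sinw k a b)^-1 (- (cosw k a b / sinw k a b)) (V a b phi) phi.

Definition walk_phase (a b : R) := acos (cosw k a b).

Lemma cosw_itv (a b : R) : sin a != 0 -> -1 < cosw k a b < 1.
Proof. by move=> sa; have := sinw_sq_gt0 ks sg0 b sa; move=> h; apply/andP; split; nra. Qed.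

Lemma cos_walk_phase (a b : R) : sin a != 0 -> cos (walk_phase a b) = cosw k a b.
Proof. by move=> /(cosw_itv b)/andP[h1 h2]; rewrite acosK// in_itv/= !ltW. Qed.

Lemma sin_walk_phase (a b : R) : sin a != 0 -> sin (walk_phase a b) = sinw k a b.
Proof. by move=> /(cosw_itv b)/andP[h1 h2]; rewrite sin_acos// !ltW. Qed.

Lemma walk_state_norm t a b : rdot2 (walk_state t a b) (walk_state t a b) = 1.
Proof. by elim: t => //= t IH; rewrite /walk_state/= walk_symbol_isometry. Qed.

(** The recurrence V^(t+2) = 2 cos w V^(t+1) - V^t is also that of cos (t w) and sin (t w); it has
    order two, so the induction carries consecutive pairs. *)
Lemma walk_stateE t (a b : R) : sin a != 0 ->
  walk_state t a b = comb2 (cos (t%:R * walk_phase a b)) (sin (t%:R * walk_phase a b))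
    phi (walk_dir a b).
Proof.
move=> sa; have cw := cos_walk_phase b sa; have sw := sin_walk_phase b sa.
have S0 : sinw k a b != 0 by rewrite gt_eqF// (sinw_gt0 ks sg0).
have phiE : comb2 0 1 (V a b phi) phi = phi.
  by rewrite /comb2 rmorph1 rmorph0 !mul1r !mul0r !add0r; case: (phi).
have E x y : comb2 x y phi (walk_dir a b) =
    comb2 (y / sinw k a b) (x - y * (cosw k a b / sinw k a b)) (V a b phi) phi.
  rewrite -{1}phiE /walk_dir comb2_comb2; congr comb2; ring.
suff: walk_state t a b = comb2 (cos (t%:R * walk_phase a b)) (sin (t%:R * walk_phase a b))
    phi (walk_dir a b) /\ walk_state t.+1 a b =
   comb2 (cos (t.+1%:R * walk_phase a b)) (sin (t.+1%:R * walk_phase a b))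
    phi (walk_dir a b) by case.
elim: t => [|t [IH1 IH2]].
  rewrite !mul0r cos0 sin0 comb2_10 mul1r cw sw; split => //.
  by rewrite E divff// mulrC divfK// subrr comb2_10.
split => //.
rewrite /walk_state !iterS walk_symbol_cayley// -/(walk_state t a b).
rewrite -[V a b (walk_state t a b)]/(walk_state t.+1 a b) IH1 IH2 comb2_comb2.
have e1 : t.+2%:R * walk_phase a b = t.+1%:R * walk_phase a b + walk_phase a b.
  by rewrite -[in LHS]addn1 natrD mulrDl mul1r.
have e2 : t%:R * walk_phase a b = t.+1%:R * walk_phase a b - walk_phase a b.
  by rewrite -[t.+1]addn1 natrD mulrDl mul1r addrK.
rewrite e1 e2 -/k -cw; congr comb2.
  by rewrite cosB cosD; ring.
by rewrite sinB sinD; ring.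
Qed.

(** [walk_dir] is i N phi with N Hermitian, so its Hermitian product with phi is purely
    imaginary. *)
Lemma rdot2_phi_dir (a b : R) : sin a != 0 -> rdot2 phi (walk_dir a b) = 0.
Proof.
move=> sa; have S0 : sinw k a b != 0 by rewrite gt_eqF// (sinw_gt0 ks sg0).
by rewrite /walk_dir rdot2_combr rdot2_walk_symbol// phi1 -/k; field.
Qed.

Lemma rdot2_dir_dir (a b : R) : sin a != 0 -> rdot2 (walk_dir a b) (walk_dir a b) = 1.
Proof.
move=> sa; have S0 : sinw k a b != 0 by rewrite gt_eqF// (sinw_gt0 ks sg0).
have S2 := sqr_sinw ks sg0 b sa.
rewrite /walk_dir rdot2_combr !rdot2_combl walk_symbol_isometry// (rdot2C _ phi).
rewrite rdot2_walk_symbol// phi1 -/k.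
transitivity ((1 - cosw k a b ^+ 2) / sinw k a b ^+ 2); first by field.
by rewrite -S2 divff// expf_neq0.
Qed.

Lemma cvg_cosw (u v : nat -> R) (a b : R) : u @ \oo --> a -> v @ \oo --> b ->
  (fun n => cosw k (u n) (v n)) @ \oo --> cosw k a b.
Proof.
move=> ua vb.
have cc (x : nat -> R) y : x @ \oo --> y -> (fun n => cos (x n)) @ \oo --> cos y.
  exact/cvg_seq_comp/continuous_cos.
have cs (x : nat -> R) y : x @ \oo --> y -> (fun n => sin (x n)) @ \oo --> sin y.
  exact/cvg_seq_comp/continuous_sin.
apply: cvgD; first by apply: cvgM; exact: cc.
by apply: cvgM; [apply: cvgM; [exact: cvg_cst|exact: cs]|exact: cs].
Qed.

Lemma cvg_sinw (u v : nat -> R) (a b : R) : u @ \oo --> a -> v @ \oo --> b ->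
  (fun n => sinw k (u n) (v n)) @ \oo --> sinw k a b.
Proof.
move=> ua vb; have cw := cvg_cosw ua vb.
apply: (cvg_seq_comp (f := Num.sqrt)); first exact: sqrt_continuous.
by apply: cvgB; [exact: cvg_cst|rewrite expr2; under eq_fun do rewrite expr2; exact: cvgM].
Qed.

Lemma cvg_pairing_expi (z w : R[i]) (u : nat -> R) l : u @ \oo --> l ->
  (fun n => rdot z (expi (u n) * w)) @ \oo --> rdot z (expi l * w) /\
  (fun n => idot z (expi (u n) * w)) @ \oo --> idot z (expi l * w).
Proof.
move=> ul.
have E x : rdot z (expi x * w) = rdot z w * cos x - idot z w * sin x.
  by rewrite (mulrC (expi x)) -[z in LHS]mulr1 -(expi0 R) rdot_expi subr0.
have E' x : idot z (expi x * w) = rdot z w * sin x + idot z w * cos x.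
  by rewrite (mulrC (expi x)) -[z in LHS]mulr1 -(expi0 R) idot_expi subr0.
have cu : (fun n => cos (u n)) @ \oo --> cos l.
  exact: cvg_seq_comp (@continuous_cos R) ul.
have su : (fun n => sin (u n)) @ \oo --> sin l.
  exact: cvg_seq_comp (@continuous_sin R) ul.
split.
  rewrite E; under eq_fun do rewrite E.
  by apply: cvgB; apply: cvgM => //; exact: cvg_cst.
rewrite E'; under eq_fun do rewrite E'.
by apply: cvgD; apply: cvgM => //; exact: cvg_cst.
Qed.

Lemma cvg_pairing_symbol (x : R[i] * R[i]) (u v : nat -> R) (a b : R) :
  u @ \oo --> a -> v @ \oo --> b ->
  (fun n => rdot2 x (V (u n) (v n) phi)) @ \oo --> rdot2 x (V a b phi) /\
  (fun n => idot2 x (V (u n) (v n) phi)) @ \oo --> idot2 x (V a b phi).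
Proof.
move=> ua vb.
pose q := c%:C * phi.1 + s%:C * phi.2; pose r := s%:C * phi.1 - c%:C * phi.2.
have E a' b' : V a' b' phi = (expi (b' + a') * (c%:C * q) + expi (b' - a') * (s%:C * r),
    expi (- b' + a') * (s%:C * q) + expi (- b' - a') * (- c%:C * r)).
  rewrite /walk_symbol/= -/q -/r !expiD.
  by congr pair; ring.
have rD (z w w' : R[i]) : rdot z (w + w') = rdot z w + rdot z w'.
  by rewrite /rdot ReD ImD; ring.
have iD (z w w' : R[i]) : idot z (w + w') = idot z w + idot z w'.
  by rewrite /idot ReD ImD; ring.
have h1 : (fun n => v n + u n) @ \oo --> b + a by exact: cvgD.
have h2 : (fun n => v n - u n) @ \oo --> b - a by exact: cvgB.
have h3 : (fun n => - v n + u n) @ \oo --> - b + a by apply: cvgD => //; exact: cvgN.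
have h4 : (fun n => - v n - u n) @ \oo --> - b - a by apply: cvgB => //; exact: cvgN.
split.
  have Er a' b' : rdot2 x (V a' b' phi) = rdot x.1 (expi (b' + a') * (c%:C * q)) +
      rdot x.1 (expi (b' - a') * (s%:C * r)) + (rdot x.2 (expi (- b' + a') * (s%:C * q)) +
      rdot x.2 (expi (- b' - a') * (- c%:C * r))) by rewrite E /rdot2/= !rD.
  rewrite Er; under eq_fun do rewrite Er.
  apply: cvgD; apply: cvgD.
  - by have [] := cvg_pairing_expi x.1 (c%:C * q) h1.
  - by have [] := cvg_pairing_expi x.1 (s%:C * r) h2.
  - by have [] := cvg_pairing_expi x.2 (s%:C * q) h3.
  - by have [] := cvg_pairing_expi x.2 (- c%:C * r) h4.
have Ei a' b' : idot2 x (V a' b' phi) = idot x.1 (expi (b' + a') * (c%:C * q)) +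
      idot x.1 (expi (b' - a') * (s%:C * r)) + (idot x.2 (expi (- b' + a') * (s%:C * q)) +
      idot x.2 (expi (- b' - a') * (- c%:C * r))) by rewrite E /idot2/= !iD.
rewrite Ei; under eq_fun do rewrite Ei.
apply: cvgD; apply: cvgD.
- by have [] := cvg_pairing_expi x.1 (c%:C * q) h1.
- by have [] := cvg_pairing_expi x.1 (s%:C * r) h2.
- by have [] := cvg_pairing_expi x.2 (s%:C * q) h3.
- by have [] := cvg_pairing_expi x.2 (- c%:C * r) h4.
Qed.

Lemma cvg_pairing_dir (x : R[i] * R[i]) (u v : nat -> R) (a b : R) : sin a != 0 ->
  u @ \oo --> a -> v @ \oo --> b ->
  (fun n => rdot2 x (walk_dir (u n) (v n))) @ \oo --> rdot2 x (walk_dir a b) /\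
  (fun n => idot2 x (walk_dir (u n) (v n))) @ \oo --> idot2 x (walk_dir a b).
Proof.
move=> sa ua vb; have S0 : sinw k a b != 0 by rewrite gt_eqF// (sinw_gt0 ks sg0).
have cw := cvg_cosw ua vb.
have ci : (fun n => (sinw k (u n) (v n))^-1) @ \oo --> (sinw k a b)^-1.
  by apply: cvgV => //; exact: cvg_sinw.
have [hr hi] := cvg_pairing_symbol x ua vb.
split.
  rewrite rdot2_combr; under eq_fun do rewrite rdot2_combr.
  apply: cvgD; first exact: cvgM.
  by apply: cvgM; [apply: cvgN; exact: cvgM|exact: cvg_cst].
rewrite idot2_combr; under eq_fun do rewrite idot2_combr.
apply: cvgD; first exact: cvgM.
by apply: cvgM; [apply: cvgN; exact: cvgM|exact: cvg_cst].
Qed.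

Variables (xi eta : R).
Let un (a : R) (n : nat) : R := a - xi * n%:R^-1.
Let vn (b : R) (n : nat) : R := b - eta * n%:R^-1.

Let cvg_inv_nat : (fun n : nat => n%:R^-1 : R) @ \oo --> (0 : R).
Proof. by rewrite -cvg_shiftS; exact: cvg_harmonic. Qed.

Let cvg_un a : un a @ \oo --> a.
Proof.
rewrite -[X in _ --> X]subr0 -(mulr0 xi); apply: cvgB; first exact: cvg_cst.
by apply: cvgM; [exact: cvg_cst|exact: cvg_inv_nat].
Qed.

Let cvg_vn b : vn b @ \oo --> b.
Proof.
rewrite -[X in _ --> X]subr0 -(mulr0 eta); apply: cvgB; first exact: cvg_cst.
by apply: cvgM; [exact: cvg_cst|exact: cvg_inv_nat].
Qed.

Let near_sin_un a : 0 < sin a -> \forall n \near \oo, sin (un a n) != 0.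
Proof.
move=> sa; have su : (fun n => sin (un a n)) @ \oo --> sin a.
  exact: cvg_seq_comp (@continuous_sin R) (@cvg_un a).
near=> n; rewrite gt_eqF//; near: n.
exact: (cvgr_gt _ su).
Unshelve. all: end_near. Qed.

(** Both phases diverge in general, but their difference tends to minus the derivative of w in the
    direction (xi, eta). *)
Lemma cvg_walk_phase (a b : R) : 0 < sin a ->
  (fun n : nat => n%:R * walk_phase (un a n) (vn b n) - n%:R * walk_phase a b) @ \oo -->
  - (xi * velu k a b + eta * velv k a b).
Proof.
move=> sa; have sa0 : sin a != 0 by rewrite gt_eqF.
have S0 : sinw k a b != 0 by rewrite gt_eqF// (sinw_gt0 ks sg0).
pose f (t : R) := walk_phase (a - xi * t) (b - eta * t).
pose A (t : R) := a - xi * t; pose B (t : R) := b - eta * t.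
have dA : is_derive (0 : R) 1 A (- xi).
  have -> : A = (cst a - xi *: id)%R by apply/funext => t; rewrite /A !fctE.
  by apply: is_derive_eq; rewrite /GRing.scale/=; ring.
have dB : is_derive (0 : R) 1 B (- eta).
  have -> : B = (cst b - eta *: id)%R by apply/funext => t; rewrite /B !fctE.
  by apply: is_derive_eq; rewrite /GRing.scale/=; ring.
have A0 : A 0 = a by rewrite /A mulr0 subr0.
have B0 : B 0 = b by rewrite /B mulr0 subr0.
have dC (F : R -> R) d : is_derive (0 : R) 1 F d ->
    is_derive (0 : R) 1 (fun t => cos (F t)) (- sin (F 0) * d).
  by move=> dF; exact: (@is_derive1_comp _ (@cos R) F).
have dS (F : R -> R) d : is_derive (0 : R) 1 F d ->
    is_derive (0 : R) 1 (fun t => sin (F t)) (cos (F 0) * d).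
  by move=> dF; exact: (@is_derive1_comp _ (@sin R) F).
have dcA := dC _ _ dA; have dcB := dC _ _ dB; have dsA := dS _ _ dA; have dsB := dS _ _ dB.
have dw : is_derive (0 : R) 1 (fun t => cosw k (A t) (B t)) (xi * numu k a b + eta * numv k a b).
  have -> : (fun t => cosw k (A t) (B t)) = ((fun t => cos (A t)) * (fun t => cos (B t))
     + k *: ((fun t => sin (A t)) * (fun t => sin (B t))))%R.
    by apply/funext => t; rewrite /cosw !fctE /GRing.scale/= mulrA.
  have D := is_deriveD (is_deriveM dcA dcB) (is_deriveZ k (is_deriveM dsA dsB)).
  rewrite (_ : xi * _ + _ = cos (A 0) *: (- sin (B 0) * - eta) + cos (B 0) *: (- sin (A 0) * - xi)
    + k *: (sin (A 0) *: (cos (B 0) * - eta) + sin (B 0) *: (cos (A 0) * - xi))).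
    exact: D.
  by rewrite /GRing.scale/= A0 B0 /numu /numv; ring.
have w0 : cosw k (A 0) (B 0) = cosw k a b by rewrite A0 B0.
have df : is_derive (0 : R) 1 f (- (xi * velu k a b + eta * velv k a b)).
  have da : is_derive (cosw k (A 0) (B 0)) 1 (@acos R) (- (sinw k a b)^-1).
    by rewrite w0; apply: is_derive1_acos; exact: cosw_itv.
  have := @is_derive1_comp _ (@acos R) (fun t => cosw k (A t) (B t)) 0 _ _ da dw.
  move=> H; rewrite (_ : - _ = - (sinw k a b)^-1 * (xi * numu k a b + eta * numv k a b)).
    exact: H.
  by rewrite /velu /velv; ring.
have := cvg_is_derive_seq df.
rewrite (_ : (fun n : nat => n%:R * (f n%:R^-1 - f 0)) =
  (fun n : nat => n%:R * walk_phase (un a n) (vn b n) - n%:R * walk_phase a b))//.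
by apply/funext => n; rewrite /f /un /vn !mulr0 !subr0 mulrBr.
Qed.

Let abs_cos (x : R) : `|cos x| <= 1.
Proof. by rewrite ler_norml cos_geN1 cos_le1. Qed.

Let abs_sin (x : R) : `|sin x| <= 1.
Proof. by rewrite ler_norml sin_geN1 sin_le1. Qed.

Let abs_mul (x y : R) : `|x| <= 1 -> `|y| <= 1 -> `|x * y| <= 1.
Proof. by move=> hx hy; rewrite normrM mulr_ile1. Qed.

(** The states are expanded on phi and the direction B at either frequency. The oscillating factors
    stay bounded while the pairings tend to those of the orthonormal pair (phi, B), so what survives
    is cos w cos w' + sin w sin w' = cos (w' - w). *)
Lemma cvg_walk_rdot2 (a b : R) : 0 < sin a ->
  (fun n => rdot2 (walk_state n a b) (walk_state n (un a n) (vn b n))) @ \oo -->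
  cos (xi * velu k a b + eta * velv k a b).
Proof.
move=> sa; have sa0 : sin a != 0 by rewrite gt_eqF.
pose w (n : nat) := n%:R * walk_phase a b.
pose w' (n : nat) := n%:R * walk_phase (un a n) (vn b n).
have cp : (fun n => cos (w' n - w n)) @ \oo --> cos (xi * velu k a b + eta * velv k a b).
  rewrite -cosN; exact: cvg_seq_comp (@continuous_cos R) (@cvg_walk_phase a b sa).
have [dd _] := cvg_pairing_dir (walk_dir a b) sa0 (@cvg_un a) (@cvg_vn b).
have [pd _] := cvg_pairing_dir phi sa0 (@cvg_un a) (@cvg_vn b).
rewrite rdot2_dir_dir// in dd; rewrite rdot2_phi_dir// in pd.
have dd0 : (fun n => rdot2 (walk_dir a b) (walk_dir (un a n) (vn b n)) - 1) @ \oo --> (0 : R).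
  by rewrite -(subrr (1 : R)); apply: cvgB => //; exact: cvg_cst.
have t1 := cvg_bounded_mul0 (fun n => abs_mul (abs_sin (w n)) (abs_sin (w' n))) dd0.
have t2 := cvg_bounded_mul0 (fun n => abs_mul (abs_cos (w n)) (abs_sin (w' n))) pd.
have lim : (fun n => cos (w' n - w n)
   + (sin (w n) * sin (w' n) * (rdot2 (walk_dir a b) (walk_dir (un a n) (vn b n)) - 1)
   + cos (w n) * sin (w' n) * rdot2 phi (walk_dir (un a n) (vn b n)))) @ \oo -->
   cos (xi * velu k a b + eta * velv k a b) + (0 + 0).
  by apply: cvgD => //; exact: cvgD.
rewrite !addr0 in lim; move: lim; apply: cvg_trans; apply: near_eq_cvg.
near=> n.
have sn : sin (un a n) != 0 by near: n; exact: near_sin_un.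
rewrite !walk_stateE// -/(w n) -/(w' n) rdot2_comb2 phi1.
rewrite (rdot2C (walk_dir a b) phi) (@rdot2_phi_dir a b)// cosB.
by ring.
Unshelve. all: end_near. Qed.

(** Imaginary parts of squared norms vanish, so only the two cross terms survive; they are
    antisymmetric and combine into sin (w' - w). *)
Lemma cvg_walk_idot2 (a b : R) : 0 < sin a ->
  (fun n => idot2 (walk_state n a b) (walk_state n (un a n) (vn b n))) @ \oo -->
  - sin (xi * velu k a b + eta * velv k a b) * idot2 phi (walk_dir a b).
Proof.
move=> sa; have sa0 : sin a != 0 by rewrite gt_eqF.
pose w (n : nat) := n%:R * walk_phase a b.
pose w' (n : nat) := n%:R * walk_phase (un a n) (vn b n).
have cp : (fun n => sin (w' n - w n)) @ \oo --> - sin (xi * velu k a b + eta * velv k a b).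
  rewrite -sinN; exact: cvg_seq_comp (@continuous_sin R) (@cvg_walk_phase a b sa).
have [_ dd] := cvg_pairing_dir (walk_dir a b) sa0 (@cvg_un a) (@cvg_vn b).
have [_ pd] := cvg_pairing_dir phi sa0 (@cvg_un a) (@cvg_vn b).
rewrite idot2pp in dd.
pose rho := idot2 phi (walk_dir a b); rewrite -/rho in pd *.
have pd0 : (fun n => idot2 phi (walk_dir (un a n) (vn b n)) - rho) @ \oo --> (0 : R).
  by rewrite -(subrr rho); apply: cvgB => //; exact: cvg_cst.
have t1 := cvg_bounded_mul0 (fun n => abs_mul (abs_sin (w n)) (abs_sin (w' n))) dd.
have t2 := cvg_bounded_mul0 (fun n => abs_mul (abs_cos (w n)) (abs_sin (w' n))) pd0.
have lim : (fun n => sin (w' n - w n) * rho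
   + (sin (w n) * sin (w' n) * idot2 (walk_dir a b) (walk_dir (un a n) (vn b n))
   + cos (w n) * sin (w' n) * (idot2 phi (walk_dir (un a n) (vn b n)) - rho))) @ \oo -->
   - sin (xi * velu k a b + eta * velv k a b) * rho + (0 + 0).
  apply: cvgD; last exact: cvgD.
  by apply: cvgM => //; exact: cvg_cst.
rewrite !addr0 in lim; move: lim; apply: cvg_trans; apply: near_eq_cvg.
near=> n.
have sn : sin (un a n) != 0 by near: n; exact: near_sin_un.
rewrite !walk_stateE// -/(w n) -/(w' n) idot2_comb2 idot2pp.
rewrite (idot2C (walk_dir a b) phi) -/rho sinB.
by ring.
Unshelve. all: end_near. Qed.

(** The combination u + k v of the velocities isolates sin a cos b / sin w, since 1 - k^2 = 4 c^2
    s^2. The sin a sin b term is the only one not linear in the velocity; it is invariant under the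
    reflection of both frequencies. *)
Lemma idot2_phi_dirE (a b : R) : c != 0 -> s != 0 -> sin a != 0 ->
  idot2 phi (walk_dir a b) = (normsq phi.1 - normsq phi.2) * velv k a b
   + rdot phi.1 phi.2 / (c * s) * (velu k a b + k * velv k a b)
   - 4 * c * s * idot phi.1 phi.2 * (sin a * sin b / sinw k a b).
Proof.
move=> c0 s0 sa; have S0 : sinw k a b != 0 by rewrite gt_eqF// (sinw_gt0 ks sg0).
rewrite /walk_dir idot2_combr idot2pp idot2_walk_symbol// -/k.
have E : numu k a b + k * numv k a b = 4 * (c * s) ^+ 2 * (sin a * cos b).
  have -> : 4 * (c * s) ^+ 2 = 1 - k ^+ 2 by rewrite /k -(expr1n _ 2) -[X in X ^+ 2 - _]cs1; ring.
  by rewrite /numu /numv; ring.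
have -> : sin a * cos b = (numu k a b + k * numv k a b) / (4 * (c * s) ^+ 2).
  by rewrite E; field; apply/andP.
by rewrite /velu /velv; field; rewrite S0 c0 s0.
Qed.

End pointwise_limit.

(** * Limit of the characteristic function *)

Section reflection.
Variable R : realType.
Local Notation mu := (@lebesgue_measure R).

Lemma lebesgue_measure_reflection (c : R) (A : set R) : measurable A ->
  pushforward mu ((fun x => c - x) : measurableTypeR R -> measurableTypeR R) A = mu A.
Proof.
have mr : measurable_fun setT ((fun x => c - x) : measurableTypeR R -> measurableTypeR R).
  exact: measurable_funB.
move=> mA; apply/esym/lebesgue_measure_unique => //= _ [[a b]] _ <-.
rewrite /pushforward.
have -> : (fun x => c - x) @^-1` `]a, b] = `[c - b, c - a[%classic.
  by apply/seteqP; split => x /=; rewrite !in_itv/= => /andP[h1 h2]; apply/andP; split; lra.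
rewrite /= !lebesgue_measure_itv/= !lte_fin ltrD2l ltrN2.
by case: ifP => // _; rewrite -!EFinB; congr EFin; ring.
Qed.

Lemma ge0_integral_reflection (c : R) (f : R -> \bar R) :
  measurable_fun setT f -> (forall x, 0 <= f x)%E ->
  (\int[mu]_(x in `]0%R, c[) f x = \int[mu]_(x in `]0%R, c[) f (c - x)%R)%E.
Proof.
move=> mf f0.
have mr : measurable_fun setT ((fun x => c - x) : measurableTypeR R -> measurableTypeR R).
  exact: measurable_funB.
have {2}-> : `]0, c[%classic = ((fun x => c - x) : measurableTypeR R -> measurableTypeR R) @^-1` `]0, c[.
  by apply/seteqP; split => x /=; rewrite !in_itv/= => /andP[h1 h2]; apply/andP; split; lra.
transitivity (\int[pushforward mu ((fun x => c - x)%R : measurableTypeR R -> measurableTypeR R)]_(x in `]0%R, c[) f x)%E.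
  by apply: eq_measure_integral => //= A mA AS; exact/esym/lebesgue_measure_reflection.
refine (@ge0_integral_pushforward _ _ _ _ _ _ mr mu `]0, c[%classic f _ _ _) => //.
exact: measurable_funTS.
Qed.

Let mi : measurable (`]0, pi[%classic : set R).
Proof. by []. Qed.

Lemma ge0_half_torus_reflection (g : R * R -> R) :
  measurable_fun setT g -> (forall z, 0 <= g z) ->
  (\int[mu \x mu]_(z in @half_torus R) (g z)%:E =
   \int[mu \x mu]_(z in @half_torus R) (g (pi - z.1, pi - z.2)%R)%:E)%E.
Proof.
move=> mg g0.
have mp1 (x : R) : measurable_fun setT (fun y : R => (x, y)) by exact: measurable_fun_pair.
have mp2 (y : R) : measurable_fun setT (fun x : R => (x, y)) by exact: measurable_fun_pair.
have mg' : measurable_fun setT (fun z : R * R => g (z.1, pi - z.2)).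
  by apply: (measurableT_comp mg); apply: measurable_fun_pair => /=; mfun.
have mg'' : measurable_fun setT (fun z : R * R => g (pi - z.1, pi - z.2)).
  by apply: (measurableT_comp mg); apply: measurable_fun_pair => /=; mfun.
rewrite /half_torus [LHS]tonelli_rect1// [RHS]tonelli_rect2//.
transitivity (\int[mu]_(x in `]0%R, pi[) \int[mu]_(y in `]0%R, pi[) (g (x, pi - y)%R)%:E)%E.
  apply: eq_integral => x _.
  rewrite (@ge0_integral_reflection pi (fun y => (g (x, y))%:E))//.
    by apply/measurable_EFinP; exact: (measurableT_comp mg).
  by move=> y; rewrite lee_fin.
rewrite -(tonelli_rect1 mi mi mg')// (tonelli_rect2 mi mi mg')//=.
apply: eq_integral => y _.
rewrite (@ge0_integral_reflection pi (fun x => (g (x, pi - y))%:E))//.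
  by apply/measurable_EFinP; apply: (measurableT_comp mg).
by move=> x; rewrite lee_fin.
Qed.

Lemma integral_half_torus_odd (g : R * R -> R) :
  measurable_fun setT g -> (mu \x mu)%E.-integrable (@half_torus R) (EFin \o g) ->
  (forall z, g (pi - z.1, pi - z.2) = - g z) ->
  (\int[mu \x mu]_(z in @half_torus R) (g z)%:E = 0)%E.
Proof.
move=> mg ig godd; rewrite integralE.
have -> : (\int[mu \x mu]_(z in @half_torus R) (fun z => (g z)%:E)^\- z =
   \int[mu \x mu]_(z in @half_torus R) (fun z => (g z)%:E)^\+ z)%E.
  transitivity (\int[mu \x mu]_(z in @half_torus R) (Num.max (g z) 0)%:E)%E; last first.
    by apply: eq_integral => z _; rewrite funeposE -EFin_max.
  rewrite ge0_half_torus_reflection; first last.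
  - by move=> z; rewrite le_max lexx orbT.
  - by apply: measurable_maxr => //; exact: measurable_cst.
  by apply: eq_integral => z _; rewrite funenegE -EFinN -EFin_max -godd.
rewrite subee//; apply: integrable_pos_fin_num => //; exact: measurableX.
Qed.

End reflection.

(** * Characteristic function as a mean over frequencies *)

Section characteristic_function.
Local Open Scope complex_scope.
Variables (R : realType) (c s : R) (nu0 nu1 : R[i]).
Hypothesis cs1 : c ^+ 2 + s ^+ 2 = 1.
Hypothesis c0 : c != 0.
Hypothesis s0 : s != 0.
Hypothesis hnu : normsq nu0 + normsq nu1 = 1.
Local Notation mu := (@lebesgue_measure R).
Local Notation k := (s ^+ 2 - c ^+ 2).
Local Notation W := (walk_state c s (nu0, nu1)).
Local Notation half := (@half_torus R).
Let i1 : 'I_2 := lift ord0 ord0.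

Definition walk_mean (t : nat) (g : R -> R -> R) : R :=
  boxsum t (fun x y => qw_prob (coinU c s) nu0 nu1 t x y
     * g (x%:~R / t%:R) (y%:~R / t%:R)).

Let phi1 : rdot2 (nu0, nu1) (nu0, nu1) = 1.
Proof. by rewrite /rdot2/= !rdotzz. Qed.

Lemma walk_stateE_amp t a b :
  W t a b = (amp_hat c s nu0 nu1 t ord0 a b, amp_hat c s nu0 nu1 t i1 a b).
Proof.
elim: t => [|t IH]; first by have [-> ->] := amp_hat0 c s nu0 nu1 a b.
by rewrite /walk_state iterS -/(walk_state c s (nu0, nu1) t a b) IH amp_hat_step.
Qed.

Let X (t : nat) (p : 'I_(2 * t).+1 * 'I_(2 * t).+1) : int := p.1%:Z - t%:Z.
Let Y (t : nat) (p : 'I_(2 * t).+1 * 'I_(2 * t).+1) : int := p.2%:Z - t%:Z.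

Let boxsumE (V : zmodType) t (F : int -> int -> V) :
  boxsum t F = \sum_p F (@X t p) (@Y t p).
Proof.
rewrite /boxsum big_mkord.
under eq_bigr do rewrite big_mkord.
by rewrite pair_big.
Qed.

Let amp_hat_fourier t i a b : amp_hat c s nu0 nu1 t i a b =
  fourier (@X t) (@Y t) (fun p => amp c s nu0 nu1 t i (X p) (Y p)) a b.
Proof. by rewrite /amp_hat boxsumE. Qed.

Let XY_inj t (p q : 'I_(2 * t).+1 * 'I_(2 * t).+1) : X p = X q -> Y p = Y q -> p = q.
Proof.
case: p q => [p1 p2] [q1 q2]; rewrite /X /Y/= => h1 h2.
by congr pair; apply: val_inj => /=; lia.
Qed.

Let XY_even t i (p q : 'I_(2 * t).+1 * 'I_(2 * t).+1) :
  amp c s nu0 nu1 t i (X p) (Y p) != 0 -> amp c s nu0 nu1 t i (X q) (Y q) != 0 ->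
  exists m n, X p - X q = 2 * m /\ Y p - Y q = 2 * n.
Proof.
move=> /amp_support[m [n [_ _ -> ->]]] /amp_support[m' [n' [_ _ -> ->]]].
by exists (m%:Z - m'%:Z), (n%:Z - n'%:Z); split; lia.
Qed.

Lemma measurable_pairing t (f g f' g' : R * R -> R) i :
  measurable_fun setT f -> measurable_fun setT g ->
  measurable_fun setT f' -> measurable_fun setT g' ->
  measurable_fun setT (fun z =>
    rdot (amp_hat c s nu0 nu1 t i (f z) (g z)) (amp_hat c s nu0 nu1 t i (f' z) (g' z))) /\
  measurable_fun setT (fun z =>
    idot (amp_hat c s nu0 nu1 t i (f z) (g z)) (amp_hat c s nu0 nu1 t i (f' z) (g' z))).
Proof.
have mA (f1 g1 : R * R -> R) : measurable_fun setT f1 -> measurable_fun setT g1 ->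
   measurable_fun setT (fun z => complex.Re (amp_hat c s nu0 nu1 t i (f1 z) (g1 z))) /\
   measurable_fun setT (fun z => complex.Im (amp_hat c s nu0 nu1 t i (f1 z) (g1 z))).
  move=> mf1 mg1; split.
    under eq_fun do rewrite amp_hat_fourier /fourier Re_sum.
    apply: measurable_sum => p; case: (amp _ _ _ _ _ _ _ _) => u v.
    by rewrite /expi/=; mfun.
  under eq_fun do rewrite amp_hat_fourier /fourier Im_sum.
  apply: measurable_sum => p; case: (amp _ _ _ _ _ _ _ _) => u v.
  by rewrite /expi/=; mfun.
move=> mf mg mf' mg'; have [m1 m2] := mA f g mf mg; have [m3 m4] := mA f' g' mf' mg'.
by rewrite /rdot /idot; split; mfun.
Qed.

Let comp_le t i a b : rdot (amp_hat c s nu0 nu1 t i a b) (amp_hat c s nu0 nu1 t i a b) <= 1.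
Proof.
have := walk_state_norm cs1 phi1 t a b; rewrite walk_stateE_amp /rdot2/= => <-.
have I2 : i = ord0 \/ i = i1.
  by case: i => -[|[|//]] hj; [left|right]; apply: val_inj.
by rewrite !rdotzz /normsq; case: I2 => ->; rewrite ?lerDl ?lerDr addr_ge0 ?sqr_ge0.
Qed.

Let comp_pairing_le t i a b a' b' :
  `|rdot (amp_hat c s nu0 nu1 t i a b) (amp_hat c s nu0 nu1 t i a' b')| <= 1 /\
  `|idot (amp_hat c s nu0 nu1 t i a b) (amp_hat c s nu0 nu1 t i a' b')| <= 1.
Proof.
have := comp_le t i a b; have := comp_le t i a' b'.
case: (amp_hat _ _ _ _ _ _ a b) => x y; case: (amp_hat _ _ _ _ _ _ a' b') => x' y'.
rewrite /rdot /idot/= => h h'.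
have h1 := sqr_ge0 (x - x'); have h2 := sqr_ge0 (x + x').
have h3 := sqr_ge0 (y - y'); have h4 := sqr_ge0 (y + y').
have h5 := sqr_ge0 (x - y'); have h6 := sqr_ge0 (x + y').
have h7 := sqr_ge0 (y - x'); have h8 := sqr_ge0 (y + x').
by rewrite !ler_norml; split; apply/andP; split; nra.
Qed.

Let walk_meanE t (F : R -> R) xi eta :
  walk_mean t (fun u v => F (xi * u + eta * v)) =
  \sum_p normsq (amp c s nu0 nu1 t ord0 (@X t p) (@Y t p)) *
      F (xi * t%:R^-1 * (X p)%:~R + eta * t%:R^-1 * (Y p)%:~R) +
  \sum_p normsq (amp c s nu0 nu1 t i1 (@X t p) (@Y t p)) *
      F (xi * t%:R^-1 * (X p)%:~R + eta * t%:R^-1 * (Y p)%:~R).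
Proof.
rewrite /walk_mean boxsumE -big_split; apply: eq_bigr => p _ /=.
rewrite /qw_prob !big_ord_recl big_ord0 addr0 -mulrDl; congr (_ * F _).
by rewrite !mulrA -!(mulrAC _ (t%:R^-1)).
Qed.

Let mshift (x : R) : measurable_fun setT (fun z : R * R => z.1 - x) /\
  measurable_fun setT (fun z : R * R => z.2 - x).
Proof. by split; mfun. Qed.

Lemma measurable_walk_pairing t th1 th2 : measurable_fun setT (fun z : R * R =>
     rdot2 (W t z.1 z.2) (W t (z.1 - th1) (z.2 - th2))) /\
  measurable_fun setT (fun z : R * R =>
     idot2 (W t z.1 z.2) (W t (z.1 - th1) (z.2 - th2))).
Proof.
have [m1 _] := mshift th1; have [_ m2] := mshift th2.
have h i := measurable_pairing t i measurable_fst measurable_snd m1 m2.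
split; under eq_fun do rewrite !walk_stateE_amp.
  by apply: mfunD; [have [] := h ord0|have [] := h i1].
by apply: mfunD; [have [] := h ord0|have [] := h i1].
Qed.

(** Parseval for each coin component, with the frequency shift (xi, eta) / t; pi^2 is the area of
    the square. *)
Lemma walk_mean_cos t xi eta :
  ((pi ^+ 2 * walk_mean t (fun u v => cos (xi * u + eta * v)))%:E =
  \int[mu \x mu]_(z in half) (rdot2 (W t z.1 z.2)
     (W t (z.1 - xi * t%:R^-1) (z.2 - eta * t%:R^-1)))%:E)%E.
Proof.
have [m1 _] := mshift (xi * t%:R^-1); have [_ m2] := mshift (eta * t%:R^-1).
have h i := measurable_pairing t i measurable_fst measurable_snd m1 m2.
have ig i : (mu \x mu)%E.-integrable half (EFin \o (fun z : R * R =>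
    rdot (amp_hat c s nu0 nu1 t i z.1 z.2)
      (amp_hat c s nu0 nu1 t i (z.1 - xi * t%:R^-1) (z.2 - eta * t%:R^-1)))).
  apply: (@integrable_half_torus _ _ 1); first by have [] := h i.
  by move=> z _; have [] := comp_pairing_le t i z.1 z.2 (z.1 - xi * t%:R^-1) (z.2 - eta * t%:R^-1).
under eq_integral do rewrite !walk_stateE_amp /rdot2/= EFinD.
rewrite [RHS]integralD//; [|exact: measurableX|exact: ig|exact: ig].
under eq_integral do rewrite !amp_hat_fourier.
rewrite (parseval_re (@XY_inj t) (@XY_even t ord0)).
under eq_integral do rewrite !amp_hat_fourier.
by rewrite (parseval_re (@XY_inj t) (@XY_even t i1)) -EFinD -mulrDr -(walk_meanE t cos).
Qed.

Lemma walk_mean_sin t xi eta :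
  ((pi ^+ 2 * walk_mean t (fun u v => sin (xi * u + eta * v)))%:E =
  \int[mu \x mu]_(z in half) (idot2 (W t z.1 z.2)
     (W t (z.1 - xi * t%:R^-1) (z.2 - eta * t%:R^-1)))%:E)%E.
Proof.
have [m1 _] := mshift (xi * t%:R^-1); have [_ m2] := mshift (eta * t%:R^-1).
have h i := measurable_pairing t i measurable_fst measurable_snd m1 m2.
have ig i : (mu \x mu)%E.-integrable half (EFin \o (fun z : R * R =>
    idot (amp_hat c s nu0 nu1 t i z.1 z.2)
      (amp_hat c s nu0 nu1 t i (z.1 - xi * t%:R^-1) (z.2 - eta * t%:R^-1)))).
  apply: (@integrable_half_torus _ _ 1); first by have [] := h i.
  by move=> z _; have [] := comp_pairing_le t i z.1 z.2 (z.1 - xi * t%:R^-1) (z.2 - eta * t%:R^-1).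
under eq_integral do rewrite !walk_stateE_amp /idot2/= EFinD.
rewrite [RHS]integralD//; [|exact: measurableX|exact: ig|exact: ig].
under eq_integral do rewrite !amp_hat_fourier.
rewrite (parseval_im (@XY_inj t) (@XY_even t ord0)).
under eq_integral do rewrite !amp_hat_fourier.
by rewrite (parseval_im (@XY_inj t) (@XY_even t i1)) -EFinD -mulrDr -(walk_meanE t sin).
Qed.

End characteristic_function.

(** * Passage to the limit and symmetrisation *)

Section characteristic_limit.
Local Open Scope complex_scope.
Variables (R : realType) (c s : R) (nu0 nu1 : R[i]).
Hypothesis cs1 : c ^+ 2 + s ^+ 2 = 1.
Hypothesis c0 : c != 0.
Hypothesis s0 : s != 0.
Hypothesis hnu : normsq nu0 + normsq nu1 = 1.
Local Notation mu := (@lebesgue_measure R).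
Local Notation k := (s ^+ 2 - c ^+ 2).
Local Notation W := (walk_state c s (nu0, nu1)).
Local Notation half := (@half_torus R).

Let phi1 : rdot2 (nu0, nu1) (nu0, nu1) = 1.
Proof. by rewrite /rdot2/= !rdotzz. Qed.

Let sg := 2 * `|c * s|.

Let ksg : sg ^+ 2 = 1 - k ^+ 2 := coin_gap_sq cs1.

Let sg0 : 0 < sg := coin_gap_gt0 c0 s0.

(** The bracket of the limit density: c^2 (u - v) + s^2 (u + v) = u + k v, and the numerator nu0
    nu1^* + nu0^* nu1 is twice [rdot nu0 nu1]. *)
Definition qw_weight (u v : R) : R :=
  1 - (normsq nu0 - normsq nu1) * v - rdot nu0 nu1 / (c * s) * (u + k * v).

Let mhalf : measurable half. Proof. exact: measurableX. Qed.

Let sin_half z : half z -> 0 < sin z.1 /\ 0 < sin z.2.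
Proof. by case=> h1 h2; split; apply: sin_gt0_itv. Qed.

Let mvelu : measurable_fun setT (fun z : R * R => velu k z.1 z.2).
Proof. exact: measurable_velu. Qed.

Let mvelv : measurable_fun setT (fun z : R * R => velv k z.1 z.2).
Proof. exact: measurable_velv. Qed.

Let mtilt : measurable_fun setT (fun z : R * R => sin z.1 * sin z.2 / sinw k z.1 z.2).
Proof. by rewrite /sinw /cosw; mfun. Qed.

Lemma integrable_half_cst (x : R) : (mu \x mu)%E.-integrable half (EFin \o cst x).
Proof. by apply: (@integrable_half_torus _ _ `|x|) => //; exact: measurable_cst. Qed.

Let dct (f : nat -> R * R -> R) (g : R * R -> R) (M : R) :
  (forall n, measurable_fun setT (f n)) -> measurable_fun setT g ->
  (forall n z, `|f n z| <= M) ->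
  (forall z, half z -> (fun n => f n z) @ \oo --> g z) ->
  (fun n => \int[mu \x mu]_(z in half) (f n z)%:E)%E @ \oo -->
  (\int[mu \x mu]_(z in half) (g z)%:E)%E.
Proof.
move=> mf mg fM fg.
have mD : measurable half by exact: measurableX.
have p1 n : measurable_fun half (fun z => (f n z)%:E).
  by apply/measurable_EFinP; exact: measurable_funTS.
have p2 : measurable_fun half (fun z => (g z)%:E).
  by apply/measurable_EFinP; exact: measurable_funTS.
have p3 : {ae (mu \x mu)%E, forall z, half z -> (fun n => (f n z)%:E) @ \oo --> (g z)%:E}.
  by apply: aeW => z hz; apply: cvg_EFin; [exact: nearW|exact: fg].
have p5 : {ae (mu \x mu)%E, forall z n, half z -> (`|(f n z)%:E| <= cst M%:E z)%E}.
  by apply: aeW => z n hz; rewrite lee_fin.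
by have [] := @dominated_convergence _ _ _ (mu \x mu)%E half mD
  (fun n z => (f n z)%:E) (fun z => (g z)%:E) (cst M%:E) p1 p2 p3 (integrable_half_cst M) p5.
Qed.

Lemma mean_cos_limit xi eta :
  (fun t => (pi ^+ 2 * walk_mean c s nu0 nu1 t (fun u v => cos (xi * u + eta * v)))%:E) @ \oo -->
  (\int[mu \x mu]_(z in half) (cos (xi * velu k z.1 z.2 + eta * velv k z.1 z.2))%:E)%E.
Proof.
under eq_fun do rewrite walk_mean_cos//.
apply: (@dct _ _ 1).
- by move=> t; have [] := measurable_walk_pairing c s nu0 nu1 t (xi * t%:R^-1) (eta * t%:R^-1).
- by mfun.
- by move=> t z; apply: rdot2_le; exact: walk_state_norm.
- by move=> z /sin_half[sa _]; exact: (cvg_walk_rdot2 cs1 phi1 ksg sg0).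
Qed.

Lemma mean_sin_limit xi eta :
  (fun t => (pi ^+ 2 * walk_mean c s nu0 nu1 t (fun u v => sin (xi * u + eta * v)))%:E) @ \oo -->
  (\int[mu \x mu]_(z in half) (sin (xi * velu k z.1 z.2 + eta * velv k z.1 z.2)
    * (qw_weight (velu k z.1 z.2) (velv k z.1 z.2) - 1
       + 4 * c * s * idot nu0 nu1 * (sin z.1 * sin z.2 / sinw k z.1 z.2)))%:E)%E.
Proof.
under eq_fun do rewrite walk_mean_sin//.
apply: (@dct _ _ 1).
- by move=> t; have [] := measurable_walk_pairing c s nu0 nu1 t (xi * t%:R^-1) (eta * t%:R^-1).
- by rewrite /qw_weight; mfun.
- by move=> t z; apply: idot2_le; exact: walk_state_norm.
- move=> z /sin_half[sa _].
  rewrite (_ : _ * _ = - sin (xi * velu k z.1 z.2 + eta * velv k z.1 z.2) *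
      idot2 (nu0, nu1) (walk_dir c s (nu0, nu1) z.1 z.2)).
    exact: (cvg_walk_idot2 cs1 ksg sg0).
  by rewrite (idot2_phi_dirE (nu0, nu1) cs1 ksg sg0)// ?gt_eqF// /qw_weight/=; ring.
Qed.

Lemma vel_le1 z : half z -> `|velu k z.1 z.2| <= 1 /\ `|velv k z.1 z.2| <= 1.
Proof.
move=> /sin_half[sa sb]; have sa0 : sin z.1 != 0 by rewrite gt_eqF.
have hu := onem_velu_sq ksg sg0 z.2 sa0; have hv := onem_velv_sq ksg sg0 z.2 sa0.
have := sqr_ge0 (sg * sin z.2 / sinw k z.1 z.2); rewrite -hu.
have := sqr_ge0 (sg * sin z.1 / sinw k z.1 z.2); rewrite -hv.
by move=> h1 h2; rewrite !ler_norml; split; apply/andP; split; nra.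
Qed.

(** By the law of sines, sg sin b / sin w is the sine of an angle. The quotient therefore stays
    bounded near the corners where sin w tends to 0. *)
Lemma tilt_le z : half z -> `|sin z.1 * sin z.2 / sinw k z.1 z.2| <= sg^-1.
Proof.
move=> /sin_half[sa sb]; have sa0 : sin z.1 != 0 by rewrite gt_eqF.
have hu := onem_velu_sq ksg sg0 z.2 sa0.
have S0 := sinw_gt0 ksg sg0 z.2 sa0.
have h0 : 0 <= sg * sin z.2 / sinw k z.1 z.2.
  by rewrite divr_ge0 ?ltW// mulr_gt0.
have h : sg * sin z.2 / sinw k z.1 z.2 <= 1.
  by have := sqr_ge0 (velu k z.1 z.2); nra.
rewrite ger0_norm; last by rewrite divr_ge0 ?ltW// mulr_gt0.
rewrite -[leRHS]mul1r ler_pdivlMr//.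
rewrite (_ : _ * sg = sin z.1 * (sg * sin z.2 / sinw k z.1 z.2)); last by ring.
have := sin_le1 z.1; move: h h0 sa; set y := sg * _ / _.
by move=> *; nra.
Qed.

Lemma vel_reflection (z : R * R) :
  velu k (pi - z.1) (pi - z.2) = - velu k z.1 z.2 /\
  velv k (pi - z.1) (pi - z.2) = - velv k z.1 z.2 /\
  sinw k (pi - z.1) (pi - z.2) = sinw k z.1 z.2.
Proof.
have sp (x : R) : sin (pi - x) = sin x by rewrite sinB sinpi cospi; ring.
have cp (x : R) : cos (pi - x) = - cos x by rewrite cosB sinpi cospi; ring.
have sw : sinw k (pi - z.1) (pi - z.2) = sinw k z.1 z.2.
  by rewrite /sinw /cosw !sp !cp !mulrNN.
by rewrite /velu /velv sw /numu /numv !sp !cp -!mulNr; split; [|split] => //; congr (_ / _); ring.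
Qed.

Let integrable_bounded3 (F : R -> R) (A B C : R) (xi eta : R) :
  (forall x, `|F x| <= 1) -> measurable_fun setT F ->
  (mu \x mu)%E.-integrable half (EFin \o (fun z : R * R =>
    F (xi * velu k z.1 z.2 + eta * velv k z.1 z.2) *
    (A + B * velu k z.1 z.2 + C * velv k z.1 z.2))).
Proof.
move=> F1 mF; apply: (@integrable_half_torus _ _ (`|A| + `|B| + `|C|)).
  by apply: mfunM; mfun; apply: (measurableT_comp mF); mfun.
move=> z hz; have [hu hv] := vel_le1 hz.
rewrite normrM -[leRHS]mul1r ler_pM//.
apply: (le_trans (ler_normD _ _)); apply: lerD; last first.
  by rewrite normrM ler_piMr.
apply: (le_trans (ler_normD _ _)); apply: lerD => //.
by rewrite normrM ler_piMr.
Qed.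

Let B := - (rdot nu0 nu1 / (c * s)).
Let C := - (normsq nu0 - normsq nu1) - rdot nu0 nu1 / (c * s) * k.

Let weightE u v : qw_weight u v = 1 + B * u + C * v.
Proof. by rewrite /qw_weight /B /C; ring. Qed.

Let abs_cos (x : R) : `|cos x| <= 1.
Proof. by rewrite ler_norml cos_geN1 cos_le1. Qed.

Let abs_sin (x : R) : `|sin x| <= 1.
Proof. by rewrite ler_norml sin_geN1 sin_le1. Qed.

Let mcos : measurable_fun setT (@cos R).
Proof. by apply: mfun_cos; exact: measurable_id. Qed.

Let msin : measurable_fun setT (@sin R).
Proof. by apply: mfun_sin; exact: measurable_id. Qed.

Lemma half_torus_weight (F : R -> R) xi eta : continuous F -> measurable_fun setT F ->
  (\int[mu \x mu]_(z in half) (F (xi * velu k z.1 z.2 + eta * velv k z.1 z.2)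
     * qw_weight (velu k z.1 z.2) (velv k z.1 z.2))%:E =
   \int[mu \x mu]_z (F (xi * z.1 + eta * z.2) * qw_weight z.1 z.2
     * arcsine_density k z.1 z.2)%:E)%E.
Proof.
move=> cF mF.
have cfst : continuous (fst : R * R -> R) by move=> z; exact: cvg_fst.
have csnd : continuous (snd : R * R -> R) by move=> z; exact: cvg_snd.
rewrite -(integral_velocity ksg sg0 (G := fun z => F (xi * z.1 + eta * z.2) * qw_weight z.1 z.2))//.
  move=> z; apply: cvgM.
    apply: (@continuous_comp _ _ _ (fun z : R * R => xi * z.1 + eta * z.2) F); last exact: cF.
    apply: cvgD; (apply: cvgM; first exact: cvg_cst).
      exact: cfst.
    exact: csnd.
  apply: cvgB.
    apply: cvgB; first exact: cvg_cst.
    by apply: cvgM; [exact: cvg_cst|exact: csnd].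
  apply: cvgM; first exact: cvg_cst.
  apply: cvgD; first exact: cfst.
  by apply: cvgM; [exact: cvg_cst|exact: csnd].
rewrite /qw_weight; apply: mfunM; last by mfun.
by apply: (measurableT_comp mF); mfun.
Qed.

(* The reflection k |-> (pi, pi) - k changes the sign of the velocity, so the terms by which
   the limit differs from the integral against the density are odd and integrate to 0. *)
Lemma mean_cos_density xi eta :
  (fun t => (pi ^+ 2 * walk_mean c s nu0 nu1 t (fun u v => cos (xi * u + eta * v)))%:E) @ \oo -->
  (\int[mu \x mu]_z (cos (xi * z.1 + eta * z.2) * qw_weight z.1 z.2
     * arcsine_density k z.1 z.2)%:E)%E.
Proof.
rewrite -(half_torus_weight xi eta (@continuous_cos R) mcos).
rewrite (_ : (\int[_]_(_ in _) _)%E = (\int[mu \x mu]_(z in half)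
   (cos (xi * velu k z.1 z.2 + eta * velv k z.1 z.2))%:E)%E); first exact: mean_cos_limit.
pose g1 (z : R * R) := cos (xi * velu k z.1 z.2 + eta * velv k z.1 z.2)
   * (1 + 0 * velu k z.1 z.2 + 0 * velv k z.1 z.2).
pose g2 (z : R * R) := cos (xi * velu k z.1 z.2 + eta * velv k z.1 z.2)
   * (0 + B * velu k z.1 z.2 + C * velv k z.1 z.2).
have i1 : (mu \x mu)%E.-integrable half (EFin \o g1) by exact: integrable_bounded3.
have i2 : (mu \x mu)%E.-integrable half (EFin \o g2) by exact: integrable_bounded3.
transitivity (\int[mu \x mu]_(z in half) ((g1 z)%:E + (g2 z)%:E))%E.
  by apply: eq_integral => z _; rewrite weightE -EFinD /g1 /g2; congr EFin; ring.
rewrite integralD//.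
rewrite (integral_half_torus_odd (g := g2))//.
- by rewrite adde0; apply: eq_integral => z _; rewrite /g1 !mul0r !addr0 mulr1.
- by rewrite /g2; mfun.
- move=> z; rewrite /g2/=; have [-> [-> _]] := vel_reflection z.
  by rewrite !mulrN -opprD cosN; ring.
Qed.

(** The sine is odd in the velocity, so here the even terms integrate to 0: the constant 1 may be
    supplied to the weight and the sin a sin b term dropped. *)
Lemma mean_sin_density xi eta :
  (fun t => (pi ^+ 2 * walk_mean c s nu0 nu1 t (fun u v => sin (xi * u + eta * v)))%:E) @ \oo -->
  (\int[mu \x mu]_z (sin (xi * z.1 + eta * z.2) * qw_weight z.1 z.2
     * arcsine_density k z.1 z.2)%:E)%E.
Proof.
rewrite -(half_torus_weight xi eta (@continuous_sin R) msin).
rewrite (_ : (\int[_]_(_ in _) _)%E = (\int[mu \x mu]_(z in half)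
   (sin (xi * velu k z.1 z.2 + eta * velv k z.1 z.2)
    * (qw_weight (velu k z.1 z.2) (velv k z.1 z.2) - 1
       + 4 * c * s * idot nu0 nu1 * (sin z.1 * sin z.2 / sinw k z.1 z.2)))%:E)%E);
  first exact: mean_sin_limit.
pose tilt (z : R * R) := sin z.1 * sin z.2 / sinw k z.1 z.2.
pose g1 (z : R * R) := sin (xi * velu k z.1 z.2 + eta * velv k z.1 z.2)
   * (1 + B * velu k z.1 z.2 + C * velv k z.1 z.2).
pose g2 (z : R * R) := sin (xi * velu k z.1 z.2 + eta * velv k z.1 z.2)
   * (4 * c * s * idot nu0 nu1 * tilt z - 1).
have i1 : (mu \x mu)%E.-integrable half (EFin \o g1) by exact: integrable_bounded3.
have mg2 : measurable_fun setT g2 by rewrite /g2 /tilt; mfun.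
have i2 : (mu \x mu)%E.-integrable half (EFin \o g2).
  apply: (@integrable_half_torus _ _ (`|4 * c * s * idot nu0 nu1| * sg^-1 + 1)) => //.
  move=> z hz; rewrite /g2 normrM -[leRHS]mul1r ler_pM//.
  apply: (le_trans (ler_normB _ _)); rewrite normr1 lerD2r normrM.
  by rewrite ler_wpM2l// tilt_le.
transitivity (\int[mu \x mu]_(z in half) ((g1 z)%:E + (g2 z)%:E))%E; last first.
  apply: eq_integral => z _; rewrite weightE -EFinD /g1 /g2 /tilt; congr EFin.
  by move: (sin z.1 * _ / _) => T; ring.
rewrite [RHS]integralD//.
rewrite (integral_half_torus_odd (g := g2))//.
- by rewrite adde0; apply: eq_integral => z _; rewrite /g1 weightE.
- move=> z; rewrite /g2 /tilt/=; have [-> [-> ->]] := vel_reflection z.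
  have sp (x : R) : sin (pi - x) = sin x by rewrite sinB sinpi cospi; ring.
  by rewrite !sp !mulrN -opprD sinN; move: (sin z.1 * _ / _) => T; ring.
Qed.

End characteristic_limit.

(** * From trigonometric polynomials to quadrants *)

Section smoothing.
Variable R : realType.

(* w |-> w (3 - w^2) / 2 pushes [-1, 1] minus 0 towards the fixed points -1 and 1. *)
Definition smooth_sign (n : nat) (w : R) : R :=
  iter n (fun w => w * (3 - w ^+ 2) / 2) w.

Lemma smooth_signS n w : smooth_sign n.+1 w =
  smooth_sign n w * (3 - smooth_sign n w ^+ 2) / 2.
Proof. by []. Qed.

Lemma smooth_signN n w : smooth_sign n (- w) = - smooth_sign n w.
Proof. by elim: n => //= n; rewrite /smooth_sign /= => ->; rewrite sqrrN; ring. Qed.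

(** As 1 - w (3 - w^2) / 2 = (1 - w) (1 - w) (2 + w) / 2, each iteration multiplies the distance to
    1 by at most 1 - y / 2, and values above y stay above y. *)
Lemma smooth_sign_gt (n : nat) (y w : R) : 0 < y -> y <= w -> w <= 1 ->
  y <= smooth_sign n w /\ smooth_sign n w <= 1 /\
  1 - smooth_sign n w <= (1 - y / 2) ^+ n.
Proof.
move=> y0 yw w1; elim: n => [|n [h1 [h2 h3]]]; first by rewrite expr0 /=; split=> //; split => //; lra.
rewrite /smooth_sign iterS -/(smooth_sign n w) (exprS (1 - y / 2)).
move: (smooth_sign n w) h1 h2 h3 => v h1 h2 h3.
have e : 1 - v * (3 - v ^+ 2) / 2 = (1 - v) * ((1 - v) * (2 + v) / 2) by field.
have h4 : 0 <= (1 - v) * (2 + v) / 2 by nra.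
have h5 : (1 - v) * (2 + v) / 2 <= 1 - y / 2 by nra.
split; first by nra.
split.
  rewrite -subr_ge0 e mulr_ge0// subr_ge0//.
by rewrite e (mulrC (1 - v)); apply: ler_pM => //; rewrite subr_ge0.
Qed.

Lemma smooth_sign_le1 n w : `|w| <= 1 -> `|smooth_sign n w| <= 1.
Proof.
rewrite !ler_norml => /andP[h1 h2].
have pos x : 0 < x -> x <= 1 -> -1 <= smooth_sign n x <= 1.
  move=> x0 x1; have [h3 [h4 _]] := smooth_sign_gt n x0 (lexx x) x1.
  by apply/andP; split; lra.
have [w0|w0|<-] := ltgtP 0 w.
- exact: pos.
- have := pos (- w); rewrite smooth_signN oppr_gt0 => /(_ w0) H.
  by have /andP[] := H ltac:(lra); move=> *; apply/andP; split; lra.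
- have -> : smooth_sign n 0 = 0.
    by elim: n {pos} => //= n; rewrite /smooth_sign/= => ->; rewrite !mul0r.
  by apply/andP; split; lra.
Qed.

(** (1 - y)^n (1 + y)^n <= 1, together with Bernoulli's inequality for (1 + y)^n. *)
Lemma geometric_le (y : R) n : 0 < y -> y <= 1 -> (1 - y) ^+ n <= (1 + n%:R * y)^-1.
Proof.
move=> y0 y1.
have h : 1 + n%:R * y <= (1 + y) ^+ n.
  elim: n => [|n IH]; first by rewrite mul0r expr0; lra.
  rewrite exprSr -natr1.
  have : 0 <= n%:R * y by rewrite mulr_ge0// ltW.
  by move=> hn; nra.
have p0 : 0 < 1 + n%:R * y by rewrite ltr_pwDl// mulr_ge0// ltW.
rewrite -[leRHS]mul1r ler_pdivlMr//.
apply: (@le_trans _ _ ((1 - y) ^+ n * (1 + y) ^+ n)).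
  by rewrite ler_wpM2l// exprn_ge0// subr_ge0.
by rewrite -exprMn exprn_ile1//; nra.
Qed.

(* The scaling keeps u and x in the range where sin is increasing, so that the sign of
   [step_slope x u] is that of u - x for all u in [-1, 1]. *)
Definition step_slope (x u : R) : R :=
  (sin ((`|x| + 1)^-1 * u) - sin ((`|x| + 1)^-1 * x)) / 4.

(** The bound 1 / 2, due to the division by 4, leaves room for a shift by at most 1 / 4 within
    [-1, 1], where the iteration behaves well. *)
Lemma step_slopeP (x u : R) : `|u| <= 1 ->
  [/\ `|step_slope x u| <= 1 / 2, u <= x -> step_slope x u <= 0,
      u < x -> step_slope x u < 0 & x < u -> 0 < step_slope x u].
Proof.
move=> u1; set M := (`|x| + 1)^-1.
have M0 : 0 < M by rewrite invr_gt0 ltr_wpDl.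
have M1 : M <= 1 by rewrite invf_le1 ?ltr_wpDl// lerDr.
have pi2 : 1 <= pi / 2 :> R by have := pi_ge2 R; lra.
have inI z : `|z| <= `|x| \/ `|z| <= 1 -> M * z \in `[- (pi / 2), pi / 2].
  move=> hz; have : `|M * z| <= 1.
    rewrite normrM gtr0_norm// /M mulrC ler_pdivrMr ?ltr_wpDl// mul1r.
    by case: hz => hz; have := normr_ge0 x; have := normr_ge0 z; lra.
  by rewrite in_itv/= ler_norml => /andP[h1 h2]; apply/andP; split; lra.
have uI := inI u (or_intror u1); have xI := inI x (or_introl (lexx _)).
rewrite /step_slope -/M; split.
- have := sin_le1 (M * u); have := sin_geN1 (M * u).
  have := sin_le1 (M * x); have := sin_geN1 (M * x).
  by move=> *; rewrite ler_norml; apply/andP; split; lra.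
- move=> ux; have : sin (M * u) <= sin (M * x).
    by rewrite leNgt ltr_sin// -leNgt ler_pM2l.
  lra.
- move=> ux; have : sin (M * u) < sin (M * x) by rewrite ltr_sin// ltr_pM2l.
  lra.
- move=> xu; have : sin (M * x) < sin (M * u) by rewrite ltr_sin// ltr_pM2l.
  lra.
Qed.

(** A smoothed indicator of u <= x. At distance 1 / (m + 4) from the sign change, (m + 4)^2
    iterations leave an error of at most 1 / (m + 4). The shift e = - 1 / (m + 4) or 1 / (m + 4)
    puts the step above or below the indicator up to that error; m + 4 ensures |e| <= 1 / 4. *)
Definition smooth_step (m : nat) (e : R) (x u : R) : R :=
  (1 - smooth_sign (m.+4 ^ 2)%N (step_slope x u + e)) / 2.

Let eta (m : nat) : R := m.+4%:R^-1.

Let eta_gt0 m : 0 < eta m. Proof. by rewrite invr_gt0. Qed.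

Let eta_le m : eta m <= 1 / 4.
Proof. by rewrite div1r lef_pV2 ?posrE// ler_nat. Qed.

Lemma smooth_step_itv (m : nat) (e x u : R) : `|e| <= 1 / 4 -> `|u| <= 1 ->
  0 <= smooth_step m e x u <= 1.
Proof.
move=> e1 u1; have [h _ _ _] := step_slopeP x u1.
have : `|step_slope x u + e| <= 1 by apply: (le_trans (ler_normD _ _)); lra.
move/(@smooth_sign_le1 (m.+4 ^ 2)%N); rewrite ler_norml => /andP[h1 h2].
by rewrite /smooth_step; apply/andP; split; lra.
Qed.

Let sign_bound (m : nat) (y w : R) : 0 < y -> y <= w -> w <= 1 ->
  1 - smooth_sign (m.+4 ^ 2)%N w <= 2 / y * eta m ^+ 2.
Proof.
move=> y0 yw w1; have [_ [_ h]] := smooth_sign_gt (m.+4 ^ 2)%N y0 yw w1.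
apply: (le_trans h).
have y2 : y / 2 <= 1 by lra.
apply: (le_trans (geometric_le _ _ y2)); first by rewrite divr_gt0.
have N0 : 0 < m.+4%:R :> R by rewrite ltr0n.
rewrite /eta natrX exprVn; move: (m.+4%:R : R) N0 => N N0.
have p : 0 < N ^+ 2 * (y / 2) by rewrite mulr_gt0 ?exprn_gt0// divr_gt0.
rewrite (_ : 2 / y / N ^+ 2 = (N ^+ 2 * (y / 2))^-1); last by field; rewrite !gt_eqF.
by rewrite lef_pV2 ?posrE ?addr_gt0// lerDr.
Qed.

Lemma smooth_step_upper (m : nat) (x u : R) : `|u| <= 1 -> u <= x ->
  1 - m.+4%:R^-1 <= smooth_step m (- m.+4%:R^-1) x u.
Proof.
move=> u1 ux; have [h1 h2 _ _] := step_slopeP x u1.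
rewrite -/(eta m) /smooth_step -[step_slope x u + _]opprK smooth_signN opprK.
move: h1; rewrite ler_norml => /andP[h1 _].
have := eta_le m; have e0 := eta_gt0 m => e4; have s0 := h2 ux.
have h : 1 - smooth_sign (m.+4 ^ 2)%N (- (step_slope x u - eta m)) <= 2 / eta m * eta m ^+ 2.
  by apply: sign_bound => //; lra.
have e : 2 / eta m * eta m ^+ 2 = 2 * eta m by field; rewrite gt_eqF.
by rewrite e in h; lra.
Qed.

Lemma smooth_step_lower (m : nat) (x u : R) : `|u| <= 1 -> x < u ->
  smooth_step m m.+4%:R^-1 x u <= m.+4%:R^-1.
Proof.
move=> u1 ux; have [h1 _ _ h2] := step_slopeP x u1.
rewrite -/(eta m) /smooth_step.
move: h1; rewrite ler_norml => /andP[_ h1].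
have := eta_le m; have e0 := eta_gt0 m => e4; have s0 := h2 ux.
have h : 1 - smooth_sign (m.+4 ^ 2)%N (step_slope x u + eta m) <= 2 / eta m * eta m ^+ 2.
  by apply: sign_bound => //; lra.
have e : 2 / eta m * eta m ^+ 2 = 2 * eta m by field; rewrite gt_eqF.
by rewrite e in h; lra.
Qed.

Lemma cvg_inv_natS4 : (fun m : nat => m.+4%:R^-1 : R) @ \oo --> (0 : R).
Proof.
rewrite (cvg_shiftS (fun m : nat => m.+3%:R^-1 : R)).
rewrite (cvg_shiftS (fun m : nat => m.+2%:R^-1 : R)).
rewrite (cvg_shiftS (fun m : nat => m.+1%:R^-1 : R)).
exact: cvg_harmonic.
Qed.

Lemma cvg_smooth_step (e : nat -> R) (x u : R) : `|u| <= 1 -> u != x ->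
  (forall m, `|e m| <= m.+4%:R^-1) ->
  (fun m => smooth_step m (e m) x u) @ \oo --> ((u <= x)%R%:R : R).
Proof.
move=> u1 ux he; have [h1 _ h2 h3] := step_slopeP x u1.
have := h1; rewrite ler_norml => /andP[h4 h5].
have lim0 C : (fun m : nat => C * eta m) @ \oo --> (0 : R).
  rewrite -[X in _ --> X](mulr0 C); apply: cvgM; first exact: cvg_cst.
  exact: cvg_inv_natS4.
have e2 m : eta m ^+ 2 <= eta m by have := eta_le m; have := eta_gt0 m; nra.
have eb m : - eta m <= e m <= eta m by rewrite -ler_norml he.
have e1 m : `|e m| <= 1 / 4 by apply: le_trans (he m) _; exact: eta_le.
have near_small (y : R) : 0 < y -> \forall m \near \oo, eta m <= y.
  by move=> y0; apply: (cvgr_le _ cvg_inv_natS4).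
move: ux; rewrite neq_lt => /orP[ux|xu].
- have s0 := h2 ux; rewrite (ltW ux) /=.
  (* Half of the slope: once |e m| <= y, the shifted argument keeps its sign and a distance y from
     0. *)
  pose y := - step_slope x u / 2; have y0 : 0 < y by rewrite /y; lra.
  have l1 : (fun m => 1 - 1 / y * eta m) @ \oo --> (1 : R).
    by rewrite -[X in _ --> X]subr0; apply: cvgB; [exact: cvg_cst|exact: lim0].
  apply: (squeeze_cvgr _ l1 (cvg_cst (1 : R))); near=> m.
  have /andP[_ ->] := smooth_step_itv m x (e1 m) u1; rewrite andbT.
  have em : eta m <= y by near: m; exact: near_small.
  rewrite /smooth_step -[step_slope x u + _]opprK smooth_signN opprK.
  have := eb m => /andP[b1 b2].
  have h : 1 - smooth_sign (m.+4 ^ 2)%N (- (step_slope x u + e m)) <= 2 / y * eta m ^+ 2.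
    apply: sign_bound => //; first by rewrite /y in em *; lra.
    by have := eta_le m; lra.
  have : 2 / y * eta m ^+ 2 <= 2 / y * eta m by rewrite ler_pM2l// divr_gt0.
  have -> : 2 / y * eta m = 2 * (1 / y * eta m) by ring.
  by lra.
- have s0 := h3 xu; rewrite leNgt xu /=.
  pose y := step_slope x u / 2; have y0 : 0 < y by rewrite /y; lra.
  have l1 := lim0 (1 / y).
  apply: (squeeze_cvgr _ (cvg_cst (0 : R)) l1); near=> m.
  have /andP[-> _] := smooth_step_itv m x (e1 m) u1; rewrite andTb.
  have em : eta m <= y by near: m; exact: near_small.
  rewrite /smooth_step; have := eb m => /andP[b1 b2].
  have h : 1 - smooth_sign (m.+4 ^ 2)%N (step_slope x u + e m) <= 2 / y * eta m ^+ 2.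
    apply: sign_bound => //; first by rewrite /y in em *; lra.
    by have := eta_le m; lra.
  have : 2 / y * eta m ^+ 2 <= 2 / y * eta m by rewrite ler_pM2l// divr_gt0.
  have -> : 2 / y * eta m = 2 * (1 / y * eta m) by ring.
  by lra.
Unshelve. all: end_near. Qed.

End smoothing.

(** * The algebra of trigonometric polynomials *)

Section trig_polynomials.
Variable R : realType.

(** An inductive predicate, so that the limit of the means is proved by induction from the cosine
    and sine means. *)
Inductive trig_poly : (R -> R -> R) -> Prop :=
| trig_cos xi eta : trig_poly (fun u v => cos (xi * u + eta * v))
| trig_sin xi eta : trig_poly (fun u v => sin (xi * u + eta * v))
| trig_add g h : trig_poly g -> trig_poly h -> trig_poly (fun u v => g u v + h u v)
| trig_scale a g : trig_poly g -> trig_poly (fun u v => a * g u v).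

Lemma trig_ext g h : (forall u v, g u v = h u v) -> trig_poly g -> trig_poly h.
Proof. by move=> gh; rewrite (_ : g = h)//; apply/funext => u; apply/funext => v. Qed.

Lemma trig_cst a : trig_poly (fun _ _ => a).
Proof.
apply: trig_ext (trig_scale a (trig_cos 0 0)) => u v.
by rewrite !mul0r addr0 cos0 mulr1.
Qed.

(** Product-to-sum formulas on the generators, extended by bilinearity. *)
Lemma trig_mul g h : trig_poly g -> trig_poly h -> trig_poly (fun u v => g u v * h u v).
Proof.
have dbl xi eta xi' eta' (u v : R) :
    (xi + xi') * u + (eta + eta') * v = (xi * u + eta * v) + (xi' * u + eta' * v) /\
    (xi - xi') * u + (eta - eta') * v = (xi * u + eta * v) - (xi' * u + eta' * v).
  by split; ring.
move=> hg; elim: hg h => {g} [xi eta h|xi eta h|g1 g2 _ I1 _ I2 h hh|a g _ I h hh].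
- elim=> {h} [xi' eta'|xi' eta'|h1 h2 _ I1 _ I2|a h _ I].
  + apply: trig_ext (trig_add (trig_scale 2^-1 (trig_cos (xi + xi') (eta + eta')))
      (trig_scale 2^-1 (trig_cos (xi - xi') (eta - eta')))) => u v.
    have [-> ->] := dbl xi eta xi' eta' u v.
    by move: (xi * u + eta * v) (xi' * u + eta' * v) => x y; rewrite cosB cosD; field.
  + apply: trig_ext (trig_add (trig_scale 2^-1 (trig_sin (xi + xi') (eta + eta')))
      (trig_scale (- 2^-1) (trig_sin (xi - xi') (eta - eta')))) => u v.
    have [-> ->] := dbl xi eta xi' eta' u v.
    by move: (xi * u + eta * v) (xi' * u + eta' * v) => x y; rewrite sinB sinD; field.
  + by apply: trig_ext (trig_add I1 I2) => u v; rewrite mulrDr.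
  + by apply: trig_ext (trig_scale a I) => u v; rewrite mulrCA.
- elim=> {h} [xi' eta'|xi' eta'|h1 h2 _ I1 _ I2|a h _ I].
  + apply: trig_ext (trig_add (trig_scale 2^-1 (trig_sin (xi + xi') (eta + eta')))
      (trig_scale 2^-1 (trig_sin (xi - xi') (eta - eta')))) => u v.
    have [-> ->] := dbl xi eta xi' eta' u v.
    by move: (xi * u + eta * v) (xi' * u + eta' * v) => x y; rewrite sinB sinD; field.
  + apply: trig_ext (trig_add (trig_scale 2^-1 (trig_cos (xi - xi') (eta - eta')))
      (trig_scale (- 2^-1) (trig_cos (xi + xi') (eta + eta')))) => u v.
    have [-> ->] := dbl xi eta xi' eta' u v.
    by move: (xi * u + eta * v) (xi' * u + eta' * v) => x y; rewrite cosB cosD; field.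
  + by apply: trig_ext (trig_add I1 I2) => u v; rewrite mulrDr.
  + by apply: trig_ext (trig_scale a I) => u v; rewrite mulrCA.
- by apply: trig_ext (trig_add (I1 _ hh) (I2 _ hh)) => u v; rewrite mulrDl.
- by apply: trig_ext (trig_scale a (I _ hh)) => u v; rewrite mulrA.
Qed.

Lemma trig_smooth_sign n g : trig_poly g -> trig_poly (fun u v => smooth_sign n (g u v)).
Proof.
move=> hg; elim: n => [|n IH]; first exact: hg.
apply: trig_ext (trig_mul IH (trig_add (trig_cst (3 / 2)) (trig_scale (- 2^-1) (trig_mul IH IH)))) => u v.
by rewrite smooth_signS; field.
Qed.

Lemma trig_smooth_step m e x :
  trig_poly (fun u v => smooth_step m e x u) /\ trig_poly (fun u v => smooth_step m e x v).
Proof.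
have h g : trig_poly g ->
    trig_poly (fun u v => (1 - smooth_sign (m.+4 ^ 2)%N (g u v)) / 2).
  move=> hg.
  apply: trig_ext (trig_add (trig_cst 2^-1) (trig_scale (- 2^-1) (trig_smooth_sign (m.+4 ^ 2) hg))) => u v.
  by field.
have hs (f : R -> R -> R) : trig_poly (fun u v => sin ((`|x| + 1)^-1 * f u v)) ->
    trig_poly (fun u v => step_slope x (f u v) + e).
  move=> hf; apply: trig_ext (trig_add (trig_scale 4^-1 hf)
    (trig_cst (- (sin ((`|x| + 1)^-1 * x) / 4) + e))) => u v.
  by rewrite /step_slope; field.
split; apply: h; apply: hs.
  by apply: trig_ext (trig_sin (`|x| + 1)^-1 0) => u v; rewrite mul0r addr0.
by apply: trig_ext (trig_sin 0 (`|x| + 1)^-1) => u v; rewrite mul0r add0r.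
Qed.

End trig_polynomials.

(** * Limit of the means of trigonometric polynomials *)

Section functional_limit.
Variables (R : realType) (c s : R) (nu0 nu1 : R[i]).
Hypothesis cs1 : c ^+ 2 + s ^+ 2 = 1.
Hypothesis c0 : c != 0.
Hypothesis s0 : s != 0.
Hypothesis hnu : normsq nu0 + normsq nu1 = 1.
Local Notation mu := (@lebesgue_measure R).
Local Notation k := (s ^+ 2 - c ^+ 2).
Local Notation mean := (walk_mean c s nu0 nu1).
Local Notation dens := (fun z : R * R => qw_density c s nu0 nu1 z.1 z.2).

Lemma ReD_conj : complex.Re (nu0 * nu1^* + nu0^* * nu1) = 2 * rdot nu0 nu1.
Proof.
have conjE (z : R[i]) : z^* = conjc z by [].
rewrite !conjE; case: nu0 => a b; case: nu1 => d e; rewrite /rdot; simpc => /=; ring.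
Qed.

Lemma inDE (u v : R) : inD c s u v = in_ellipse k u v.
Proof.
have c2 : 0 < c ^+ 2 by rewrite exprn_even_gt0.
have s2 : 0 < s ^+ 2 by rewrite exprn_even_gt0.
rewrite /inD /in_ellipse.
have -> : (u + v) ^+ 2 / (4 * c ^+ 2) + (u - v) ^+ 2 / (4 * s ^+ 2) =
  (u ^+ 2 + v ^+ 2 + 2 * k * u * v) / (4 * c ^+ 2 * s ^+ 2).
  have h : u ^+ 2 + v ^+ 2 = (c ^+ 2 + s ^+ 2) * (u ^+ 2 + v ^+ 2) by rewrite cs1 mul1r.
  by rewrite h; field; rewrite c0 s0.
rewrite ltr_pdivrMr ?mul1r; last by apply: mulr_gt0 => //; exact: mulr_gt0.
congr (_ < _); rewrite -(expr1n _ 2) -[X in _ = X ^+ 2 - _]cs1; ring.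
Qed.

Lemma qw_densityE (u v : R) : qw_density c s nu0 nu1 u v =
  pi ^- 2 * (qw_weight c s nu0 nu1 u v * arcsine_density k u v).
Proof.
rewrite /qw_density inDE /arcsine_density; case: ifPn => [h|_]; last by rewrite !mulr0.
rewrite ReD_conj.
have [hu hv] := in_ellipse_onem (coin_gap_sq cs1) (coin_gap_gt0 c0 s0) h.
have p0 : pi != 0 :> R by rewrite gt_eqF// pi_gt0.
rewrite /qw_weight.
have -> : c ^+ 2 * (u - v) + s ^+ 2 * (u + v) = (c ^+ 2 + s ^+ 2) * u + k * v by ring.
rewrite cs1 mul1r.
move: (1 - u ^+ 2) hu (1 - v ^+ 2) hv => U hu V hv.
move: (pi : R) p0 => P P0.
by field; rewrite c0 s0 P0 !gt_eqF.
Qed.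

Let sgk : (2 * `|c * s|) ^+ 2 = 1 - k ^+ 2 := coin_gap_sq cs1.

Let sg0 : 0 < 2 * `|c * s| := coin_gap_gt0 c0 s0.

Let K := 1 + `|normsq nu0 - normsq nu1| + `|rdot nu0 nu1 / (c * s)| * (1 + `|k|).

Let weight_le u v : in_ellipse k u v -> `|qw_weight c s nu0 nu1 u v| <= K.
Proof.
move=> h; have [hu hv] := in_ellipse_onem sgk sg0 h.
have u1 : `|u| <= 1 by rewrite ler_norml; apply/andP; split; nra.
have v1 : `|v| <= 1 by rewrite ler_norml; apply/andP; split; nra.
rewrite /qw_weight /K; apply: (le_trans (ler_normB _ _)); apply: lerD.
  apply: (le_trans (ler_normB _ _)); rewrite normr1 lerD2l normrM.
  by rewrite ler_piMr.
rewrite normrM ler_wpM2l//; apply: (le_trans (ler_normD _ _)); apply: lerD => //.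
by rewrite normrM ler_piMr.
Qed.

Let K0 : 0 <= K.
Proof. by rewrite /K !addr_ge0// mulr_ge0// addr_ge0. Qed.

Lemma measurable_qw_density : measurable_fun setT dens.
Proof.
rewrite (_ : dens = fun z => pi ^- 2 * (qw_weight c s nu0 nu1 z.1 z.2
    * arcsine_density k z.1 z.2)); last by apply/funext => z; exact: qw_densityE.
by rewrite /qw_weight /arcsine_density /in_ellipse; mfun.
Qed.

(** The bound is asked on the ellipse only, outside which the density vanishes; bounds known on
    [-1, 1]^2 thus suffice. *)
Lemma integrable_mul_density (g : R * R -> R) (M : R) : measurable_fun setT g ->
  (forall z, in_ellipse k z.1 z.2 -> `|g z| <= M) ->
  (mu \x mu)%E.-integrable setT (EFin \o (fun z => g z * dens z)).
Proof.
move=> mg gM.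
have iarc := integrable_arcsine_density sgk sg0.
have iK := integrableZl measurableT (M * K * pi ^- 2) iarc.
apply: (le_integrable _ _ _ iK) => //.
  by apply/measurable_EFinP; apply: mfunM => //; exact: measurable_qw_density.
move=> z _; rewrite /= lee_fin qw_densityE /arcsine_density; case: ifPn => h; last first.
  by rewrite !mulr0.
have M0 : 0 <= M by apply: le_trans (gM _ h).
rewrite !normrM (ger0_norm M0) (ger0_norm K0) -!mulrA ler_pM//; first exact: gM.
rewrite mulrCA ler_pM//; first exact: weight_le.
Qed.

Definition qw_mean (g : R -> R -> R) : R :=
  fine (\int[mu \x mu]_z (g z.1 z.2 * qw_density c s nu0 nu1 z.1 z.2)%:E).

Lemma qw_meanE (g : R -> R -> R) (M : R) : measurable_fun setT (fun z => g z.1 z.2) ->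
  (forall u v, in_ellipse k u v -> `|g u v| <= M) ->
  (\int[mu \x mu]_z (g z.1 z.2 * qw_density c s nu0 nu1 z.1 z.2)%:E)%E = (qw_mean g)%:E.
Proof.
move=> mg gM; rewrite /qw_mean fineK//.
by apply: integrable_fin_num => //; apply: (integrable_mul_density (M := M)) => // z; exact: gM.
Qed.

Let base_limit (F : R -> R) (xi eta : R) : (forall x, `|F x| <= 1) -> measurable_fun setT F ->
  (fun t => (pi ^+ 2 * mean t (fun u v => F (xi * u + eta * v)))%:E) @ \oo -->
  (\int[mu \x mu]_z (F (xi * z.1 + eta * z.2) * qw_weight c s nu0 nu1 z.1 z.2
     * arcsine_density k z.1 z.2)%:E)%E ->
  mean ^~ (fun u v => F (xi * u + eta * v)) @ \oo -->
  qw_mean (fun u v => F (xi * u + eta * v)).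
Proof.
move=> F1 mF lim.
have p0 : pi != 0 :> R by rewrite gt_eqF// pi_gt0.
have mg : measurable_fun setT (fun z : R * R => F (xi * z.1 + eta * z.2)).
  by apply: (measurableT_comp mF); mfun.
have ig := integrable_mul_density mg (fun z _ => F1 (xi * z.1 + eta * z.2)).
have E : (\int[mu \x mu]_z (F (xi * z.1 + eta * z.2) * qw_weight c s nu0 nu1 z.1 z.2
     * arcsine_density k z.1 z.2)%:E = (pi ^+ 2 * qw_mean (fun u v => F (xi * u + eta * v)))%:E)%E.
  rewrite EFinM -(qw_meanE (M := 1) mg)// -(integralZl _ ig)//.
  apply: eq_integral => z _ /=; rewrite -EFinM qw_densityE; congr EFin.
  by move: (pi : R) p0 => P P0; field.
rewrite E in lim.
have lim' : (fun t => pi ^+ 2 * mean t (fun u v => F (xi * u + eta * v))) @ \oo -->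
    pi ^+ 2 * qw_mean (fun u v => F (xi * u + eta * v)).
  by move/fine_cvgP : lim => [_].
have lim2 : (fun t => pi ^- 2 * (pi ^+ 2 * mean t (fun u v => F (xi * u + eta * v)))) @ \oo -->
    pi ^- 2 * (pi ^+ 2 * qw_mean (fun u v => F (xi * u + eta * v))).
  by apply: cvgM => //; exact: cvg_cst.
rewrite mulrA mulVf ?expf_neq0// mul1r in lim2.
rewrite (_ : mean ^~ _ = fun t => pi ^- 2 * (pi ^+ 2 * mean t (fun u v => F (xi * u + eta * v))))//.
by apply/funext => t; rewrite mulrA mulVf ?expf_neq0// mul1r.
Qed.

(** Boundedness and measurability are carried along: they give the integrability behind the
    linearity of [qw_mean]. *)
Lemma trig_poly_limit (g : R -> R -> R) : trig_poly g ->
  [/\ exists M, forall u v, `|g u v| <= M, measurable_fun setT (fun z => g z.1 z.2) &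
    mean ^~ g @ \oo --> qw_mean g].
Proof.
elim=> {g} [xi eta|xi eta|g h _ [[M gM] mg lg] _ [[N hN] mh lh]|a g _ [[M gM] mg lg]].
- have b x : `|cos x| <= 1 :> R by rewrite ler_norml cos_geN1 cos_le1.
  split; [by exists 1|by mfun|].
  by apply: base_limit => //; [apply: mfun_cos; exact: measurable_id|exact: mean_cos_density].
- have b x : `|sin x| <= 1 :> R by rewrite ler_norml sin_geN1 sin_le1.
  split; [by exists 1|by mfun|].
  by apply: base_limit => //; [apply: mfun_sin; exact: measurable_id|exact: mean_sin_density].
- have ig := integrable_mul_density mg (fun z _ => gM z.1 z.2).
  have ih := integrable_mul_density mh (fun z _ => hN z.1 z.2).
  split; [|exact: mfunD|].
    by exists (M + N) => u v; apply: (le_trans (ler_normD _ _)); exact: lerD.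
  have -> : qw_mean (fun u v => g u v + h u v) = qw_mean g + qw_mean h.
    apply: EFin_inj; rewrite EFinD.
    rewrite -(qw_meanE (M := M) mg)// -(qw_meanE (M := N) mh)//.
    rewrite -(qw_meanE (M := M + N) (mfunD mg mh)); last first.
      by move=> u v _; apply: (le_trans (ler_normD _ _)); exact: lerD.
    rewrite -integralD//; apply: eq_integral => z _ /=.
    by rewrite -EFinD mulrDl.
  rewrite (_ : mean ^~ _ = fun t => mean t g + mean t h); first exact: cvgD.
  apply/funext => t; rewrite /walk_mean /boxsum -big_split; apply: eq_bigr => i _.
  by rewrite -big_split; apply: eq_bigr => j _ /=; rewrite mulrDr.
- have ig := integrable_mul_density mg (fun z _ => gM z.1 z.2).
  split; [|by apply: mfunM; mfun|].
    by exists (`|a| * M) => u v; rewrite normrM ler_wpM2l.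
  have -> : qw_mean (fun u v => a * g u v) = a * qw_mean g.
    apply: EFin_inj; rewrite EFinM -(qw_meanE (M := M) mg)//.
    rewrite -(qw_meanE (M := `|a| * M)); [|by apply: mfunM; mfun|]; last first.
      by move=> u v _; rewrite normrM ler_wpM2l.
    rewrite -(integralZl _ ig)//; apply: eq_integral => z _ /=.
    by rewrite -EFinM mulrA.
  rewrite (_ : mean ^~ _ = fun t => a * mean t g).
    by apply: cvgM => //; exact: cvg_cst.
  apply/funext => t; rewrite /walk_mean /boxsum mulr_sumr; apply: eq_bigr => i _.
  by rewrite mulr_sumr; apply: eq_bigr => j _ /=; rewrite mulrCA.
Qed.

End functional_limit.

(** * Limit of the distribution function *)

Lemma cvg_sandwich (R : realType) (p : nat -> R) (lo up : nat -> nat -> R)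
    (l u : nat -> R) (L : R) :
  (forall m t, lo m t <= p t <= up m t) ->
  (forall m, lo m @ \oo --> l m) -> (forall m, up m @ \oo --> u m) ->
  l @ \oo --> L -> u @ \oo --> L -> p @ \oo --> L.
Proof.
move=> lpu lol upu lL uL; apply/cvgrPdist_le => e e0.
have e2 : 0 < e / 2 by rewrite divr_gt0.
have [m [hl hu]] : exists m, `|L - l m| <= e / 2 /\ `|L - u m| <= e / 2.
  near \oo => m; exists m; split; near: m.
    by move/cvgrPdist_le : lL => /(_ _ e2).
  by move/cvgrPdist_le : uL => /(_ _ e2).
near=> t.
have h1 : `|l m - lo m t| <= e / 2.
  by near: t; move/cvgrPdist_le : (lol m) => /(_ _ e2).
have h2 : `|u m - up m t| <= e / 2.
  by near: t; move/cvgrPdist_le : (upu m) => /(_ _ e2).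
have /andP[h3 h4] := lpu m t.
move: hl hu h1 h2; rewrite !ler_norml => /andP[? ?] /andP[? ?] /andP[? ?] /andP[? ?].
by apply/andP; split; lra.
Unshelve. all: end_near. Qed.

Section distribution_limit.
Variables (R : realType) (c s : R) (nu0 nu1 : R[i]).
Hypothesis cs1 : c ^+ 2 + s ^+ 2 = 1.
Hypothesis c0 : c != 0.
Hypothesis s0 : s != 0.
Hypothesis hnu : normsq nu0 + normsq nu1 = 1.
Variables x y : R.
Local Notation mu := (@lebesgue_measure R).
Local Notation k := (s ^+ 2 - c ^+ 2).
Local Notation mean := (walk_mean c s nu0 nu1).
Local Notation qmean := (qw_mean c s nu0 nu1).

Let ind (u v : R) : R := (u <= x)%R%:R * (v <= y)%R%:R.

Lemma qw_cdfE t : qw_cdf (coinU c s) nu0 nu1 t x y = mean t ind.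
Proof.
rewrite /qw_cdf /walk_mean /boxsum; apply: eq_bigr => i _; apply: eq_bigr => j _ /=.
by rewrite /ind -natrM mulnb; case: ifP; rewrite ?mulr1 ?mulr0.
Qed.

(** The rescaled points of the box lie in [-1, 1]^2, so a comparison there is enough. *)
Lemma walk_mean_le t (g h : R -> R -> R) :
  (forall u v, `|u| <= 1 -> `|v| <= 1 -> g u v <= h u v) -> mean t g <= mean t h.
Proof.
move=> gh; rewrite /walk_mean /boxsum !big_mkord; apply: ler_sum => i _.
rewrite !big_mkord; apply: ler_sum => j _.
rewrite ler_wpM2l//.
  by apply: sumr_ge0 => l _; rewrite /normsq addr_ge0// sqr_ge0.
have h1 (l : 'I_(2 * t).+1) : `|(l%:Z - t%:Z)%:~R / t%:R| <= 1 :> R.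
  (* At t = 0 the quotient is 0, the inverse of 0 being 0. *)
  have [t0|t0] := eqVneq t 0%N.
    by rewrite (_ : t%:R = 0 :> R) ?invr0 ?mulr0 ?normr0// t0.
  have tp : 0 < t%:R :> R by rewrite ltr0n lt0n.
  rewrite normrM normfV (gtr0_norm tp) ler_pdivrMr// mul1r rmorphB/= ler_norml.
  have : l%:R <= (2 * t)%:R :> R by rewrite ler_nat -ltnS ltn_ord.
  rewrite natrM; have : 0 <= l%:R :> R by [].
  by rewrite -!pmulrn => *; apply/andP; split; lra.
exact: gh.
Qed.

Let eta (m : nat) : R := m.+4%:R^-1.

Let eta0 m : 0 < eta m. Proof. by rewrite invr_gt0. Qed.

Let eta4 m : `|eta m| <= 1 / 4 /\ `|- eta m| <= 1 / 4.
Proof. by rewrite normrN gtr0_norm// div1r lef_pV2 ?posrE// ler_nat. Qed.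

Let upper m (u v : R) :=
  smooth_step m (- eta m) x u * smooth_step m (- eta m) y v + 2 * eta m.
Let lower m (u v : R) :=
  smooth_step m (eta m) x u * smooth_step m (eta m) y v - 2 * eta m.

(** On the quadrant both upper steps are at least 1 - eta, and A B >= A + B - 1 gives 1 - 2 eta; off
    it one lower step is at most eta and the other at most 1. The correction 2 eta covers both
    errors. *)
Let sandwich m u v : `|u| <= 1 -> `|v| <= 1 -> lower m u v <= ind u v <= upper m u v.
Proof.
move=> u1 v1; have [e1 e2] := eta4 m; have e0 := eta0 m; have : eta m <= 1 / 4.
  by apply: le_trans (ler_norm _) e1.
move=> e4.
have /andP[a0 a1] := smooth_step_itv m x e2 u1; have /andP[b0 b1] := smooth_step_itv m y e2 v1.
have /andP[d0 d1] := smooth_step_itv m x e1 u1; have /andP[f0 f1] := smooth_step_itv m y e1 v1.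
have a2 := @smooth_step_upper R m x u u1; have b2 := @smooth_step_upper R m y v v1.
have d2 := @smooth_step_lower R m x u u1; have f2 := @smooth_step_lower R m y v v1.
rewrite -/(eta m) in a2 b2 d2 f2.
rewrite /lower /upper /ind.
move: (smooth_step m (- eta m) x u) a0 a1 a2 => A a0 a1 a2.
move: (smooth_step m (- eta m) y v) b0 b1 b2 => B b0 b1 b2.
move: (smooth_step m (eta m) x u) d0 d1 d2 => D d0 d1 d2.
move: (smooth_step m (eta m) y v) f0 f1 f2 => F f0 f1 f2.
have AB0 := mulr_ge0 a0 b0.
have DF1 : D * F <= D by rewrite ler_piMr.
have DF2 : D * F <= F by rewrite ler_piMl.
have AB1 : A + B - 1 <= A * B.
  by rewrite -subr_ge0 (_ : _ - _ = (1 - A) * (1 - B)) ?mulr_ge0 ?subr_ge0//; ring.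
case: (leP u x) a2 d2 => ux a2 d2; last first.
  by rewrite mul0r; have {}d2 := d2 erefl; apply/andP; split; lra.
case: (leP v y) b2 f2 => vy b2 f2; last first.
  by rewrite mulr0; have {}f2 := f2 erefl; apply/andP; split; lra.
have {}a2 := a2 erefl; have {}b2 := b2 erefl.
by rewrite /= mulr1; apply/andP; split; lra.
Qed.

Let tp_upper m : trig_poly (upper m).
Proof.
apply: trig_add; last exact: trig_cst.
apply: (trig_mul (g := fun u v => smooth_step m (- eta m) x u) (h := fun u v => smooth_step m (- eta m) y v)).
  by have [] := trig_smooth_step m (- eta m) x.
by have [] := trig_smooth_step m (- eta m) y.
Qed.

Let tp_lower m : trig_poly (lower m).
Proof.
apply: (trig_add (h := fun _ _ => - (2 * eta m))); last exact: trig_cst.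
apply: (trig_mul (g := fun u v => smooth_step m (eta m) x u) (h := fun u v => smooth_step m (eta m) y v)).
  by have [] := trig_smooth_step m (eta m) x.
by have [] := trig_smooth_step m (eta m) y.
Qed.

Let mind : measurable_fun setT (fun z : R * R => ind z.1 z.2).
Proof.
have h (f : R * R -> R) (d : R) : measurable_fun setT f -> measurable_fun setT (fun z => (f z <= d)%R%:R : R).
  move=> mf; rewrite (_ : (fun z => _) = fun z => if d < f z then 0 else 1); first by mfun.
  by apply/funext => z; rewrite leNgt; case: ifP.
by apply: mfunM; apply: h; mfun.
Qed.

Let ind_le u v : `|ind u v| <= 1.
Proof. by rewrite /ind; case: (u <= x); case: (v <= y); rewrite ?mulr1 ?mulr0 ?normr1 ?normr0. Qed.

(** On these two lines the smoothed steps need not tend to the indicator; being null, they do not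
    affect the limit. *)
Let ae_off_lines : {ae (mu \x mu)%E, forall z : R * R, z.1 != x /\ z.2 != y}.
Proof.
exists (([set x] `*` setT) `|` (setT `*` [set y])); split.
- by apply: measurableU; apply: measurableX.
- apply: null_set_setU; [exact: measurableX|exact: measurableX| |].
    by rewrite [LHS]product_measure1E//= lebesgue_measure_set1 mul0e.
  by rewrite [LHS]product_measure1E//= lebesgue_measure_set1 mule0.
- move=> z /= /not_andP[/negP|/negP]; rewrite negbK => /eqP h; [left|right]; by split.
Qed.

Let sgk : (2 * `|c * s|) ^+ 2 = 1 - k ^+ 2 := coin_gap_sq cs1.

Let sg0 : 0 < 2 * `|c * s| := coin_gap_gt0 c0 s0.

Let ellipse_le1 u v : in_ellipse k u v -> `|u| <= 1 /\ `|v| <= 1.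
Proof.
move=> h; have [hu hv] := in_ellipse_onem sgk sg0 h.
by rewrite !ler_norml; split; apply/andP; split; nra.
Qed.

(** Dominated convergence: the density vanishes off the ellipse, so M times the density dominates in
    absolute value. *)
Let qmean_limit (g : nat -> R -> R -> R) (M : R) :
  (forall m, measurable_fun setT (fun z : R * R => g m z.1 z.2)) ->
  (forall m u v, in_ellipse k u v -> `|g m u v| <= M) ->
  (forall u v, `|u| <= 1 -> `|v| <= 1 -> u != x -> v != y -> (fun m => g m u v) @ \oo --> ind u v) ->
  (fun m => qmean (g m)) @ \oo --> qmean ind.
Proof.
move=> mg gM gl.
have md := measurable_qw_density nu0 nu1 cs1 c0 s0.
have p1 m : measurable_fun setT (fun z : R * R => (g m z.1 z.2 * qw_density c s nu0 nu1 z.1 z.2)%:E).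
  by apply/measurable_EFinP; exact: mfunM.
have p2 : measurable_fun setT (fun z : R * R => (ind z.1 z.2 * qw_density c s nu0 nu1 z.1 z.2)%:E).
  by apply/measurable_EFinP; exact: mfunM.
have p3 : {ae (mu \x mu)%E, forall z : R * R, setT z ->
   (fun m => (g m z.1 z.2 * qw_density c s nu0 nu1 z.1 z.2)%:E) @ \oo -->
   (ind z.1 z.2 * qw_density c s nu0 nu1 z.1 z.2)%:E}.
  have [N [mN N0 HN]] := ae_off_lines.
  exists N; split => // z nz; apply: HN => -[zx zy]; apply: nz => _.
  apply: cvg_EFin; first exact: nearW.
  have [h|h] := boolP (in_ellipse k z.1 z.2).
    have [u1 v1] := ellipse_le1 h.
    by apply: cvgM; [exact: gl|exact: cvg_cst].
  rewrite (_ : qw_density _ _ _ _ _ _ = 0).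
    by rewrite mulr0; under eq_fun do rewrite mulr0; exact: cvg_cst.
  by rewrite qw_densityE// /arcsine_density (negbTE h) !mulr0.
have i1 := integrable_mul_density nu0 nu1 cs1 c0 s0 (measurable_cst M) (fun z _ => lexx `|M|).
have p4 := integrable_abse i1.
have p5 : {ae (mu \x mu)%E, forall z m, setT z ->
   (`|(g m z.1 z.2 * qw_density c s nu0 nu1 z.1 z.2)%:E| <=
    (abse \o (EFin \o (fun z : R * R => (cst M z * qw_density c s nu0 nu1 z.1 z.2)%R))) z)%E}.
  apply: aeW => z m _; rewrite /= lee_fin.
  have [h|h] := boolP (in_ellipse k z.1 z.2).
    rewrite !normrM ler_wpM2r//; apply: le_trans (gM _ _ _ h) _; exact: ler_norm.
  by rewrite qw_densityE// /arcsine_density (negbTE h) !mulr0.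
have [_ _ H] := @dominated_convergence _ _ _ (mu \x mu)%E setT measurableT
  (fun m z => (g m z.1 z.2 * qw_density c s nu0 nu1 z.1 z.2)%:E)
  (fun z => (ind z.1 z.2 * qw_density c s nu0 nu1 z.1 z.2)%:E) _ p1 p2 p3 p4 p5.
move: H; rewrite (qw_meanE nu0 nu1 cs1 c0 s0 (M := 1) mind)// => H.
have {}H : (fun m => (qmean (g m))%:E) @ \oo --> (qmean ind)%:E.
  have E m := qw_meanE nu0 nu1 cs1 c0 s0 (M := M) (mg m) (gM m).
  by rewrite -(funext E).
by move/fine_cvgP : H => [_].
Qed.

Lemma qw_cdf_limit :
  (fun t => qw_cdf (coinU c s) nu0 nu1 t x y) @ \oo --> qmean ind.
Proof.
under eq_fun do rewrite qw_cdfE.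
apply: (cvg_sandwich (lo := fun m t => mean t (lower m)) (up := fun m t => mean t (upper m))
  (l := fun m => qmean (lower m)) (u := fun m => qmean (upper m))).
- move=> m t; apply/andP; split; apply: walk_mean_le => u v u1 v1.
    by have /andP[] := sandwich m u1 v1.
  by have /andP[] := sandwich m u1 v1.
- by move=> m; have [] := trig_poly_limit cs1 c0 s0 hnu (tp_lower m).
- by move=> m; have [] := trig_poly_limit cs1 c0 s0 hnu (tp_upper m).
- have eta_lim : (fun m => 2 * eta m) @ \oo --> (0 : R).
    rewrite -[X in _ --> X](mulr0 2); apply: cvgM; first exact: cvg_cst.
    exact: cvg_inv_natS4.
  apply: (@qmean_limit _ 2).
  + by move=> m; have [] := trig_poly_limit cs1 c0 s0 hnu (tp_lower m).
  + move=> m u v /ellipse_le1[u1 v1]; have [e1 _] := eta4 m.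
    have /andP[d0 d1] := smooth_step_itv m x e1 u1; have /andP[f0 f1] := smooth_step_itv m y e1 v1.
    rewrite /lower ler_norml; move: e1; rewrite ler_norml => /andP[e1 e2].
    have := mulr_ge0 d0 f0; have := mulr_ile1 d0 f0 d1 f1; have := eta0 m.
    by move=> *; apply/andP; split; lra.
  + move=> u v u1 v1 ux vy; rewrite -[X in _ --> X]subr0.
    by apply: cvgB => //; apply: cvgM; apply: cvg_smooth_step => // m; rewrite gtr0_norm.
- have eta_lim : (fun m => 2 * eta m) @ \oo --> (0 : R).
    rewrite -[X in _ --> X](mulr0 2); apply: cvgM; first exact: cvg_cst.
    exact: cvg_inv_natS4.
  apply: (@qmean_limit _ 2).
  + by move=> m; have [] := trig_poly_limit cs1 c0 s0 hnu (tp_upper m).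
  + move=> m u v /ellipse_le1[u1 v1]; have [_ e1] := eta4 m.
    have /andP[d0 d1] := smooth_step_itv m x e1 u1; have /andP[f0 f1] := smooth_step_itv m y e1 v1.
    rewrite /upper ler_norml; move: e1; rewrite ler_norml => /andP[e1 e2].
    have := mulr_ge0 d0 f0; have := mulr_ile1 d0 f0 d1 f1; have := eta0 m.
    by move=> *; apply/andP; split; lra.
  + move=> u v u1 v1 ux vy; rewrite -[X in _ --> X]addr0.
    by apply: cvgD => //; apply: cvgM; apply: cvg_smooth_step => // m; rewrite normrN gtr0_norm.
Qed.

Lemma qw_mean_quadrant : ((qmean ind)%:E =
  \int[mu]_(u in `]-oo, x]) \int[mu]_(v in `]-oo, y]) (qw_density c s nu0 nu1 u v)%:E)%E.
Proof.
rewrite -(qw_meanE nu0 nu1 cs1 c0 s0 (M := 1) mind)//.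
have ii := integrable_mul_density nu0 nu1 cs1 c0 s0 mind (fun z _ => ind_le z.1 z.2).
rewrite -(integral12_prod_meas1 ii) [RHS]integral_mkcond; apply: eq_integral => u _.
have memE (a b : R) : (a \in `]-oo, b]%classic) = (a <= b).
  by rewrite mem_setE in_itv.
rewrite /fubini_F patchE memE; case: ifPn => ux.
  rewrite [RHS]integral_mkcond; apply: eq_integral => v _.
  rewrite patchE memE /= /ind ux; case: ifPn => vy.
    by rewrite !mul1r.
  by rewrite mulr0 mul0r.
rewrite integral0_eq// => v _.
by rewrite /= /ind (negbTE ux) !mul0r.
Qed.

End distribution_limit.

Unset Implicit Arguments.

Theorem theorem3 (R : realType) (gamma : R) (nu0 nu1 : R[i])
  (hnu : normsq nu0 + normsq nu1 = 1)
  (hg0 : 0 < gamma) (hg1 : gamma < 2 * pi)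
  (hg2 : gamma != pi / 2) (hg3 : gamma != pi) (hg4 : gamma != 3 * pi / 2)
  (x y : R) :
  let c := cos gamma in
  let s := sin gamma in
  (fun t : nat => (qw_cdf (coinU c s) nu0 nu1 t x y)%:E) @ \oo -->
  (\int[lebesgue_measure]_(u in `]-oo, x])
     \int[lebesgue_measure]_(v in `]-oo, y])
        (qw_density c s nu0 nu1 u v)%:E)%E.
Proof.
move=> c s.
have cs1 : c ^+ 2 + s ^+ 2 = 1 by exact: cos2Dsin2.
have pi0 := pi_gt0 R.
(* The excluded angles are the zeros of sine and cosine in (0, 2 pi); translations by pi bring the
   remaining cases to intervals of known sign. *)
have s0 : s != 0.
  rewrite /s; have [gpi|gpi|gpi] := ltgtP gamma pi.
  - by rewrite gt_eqF// sin_gt0_pi// hg0.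
  - have -> : gamma = gamma - pi + pi by rewrite subrK.
    by rewrite sinDpi oppr_eq0 gt_eqF// sin_gt0_pi//; apply/andP; split; lra.
  - by rewrite gpi eqxx in hg3.
have c0 : c != 0.
  rewrite /c; have [g1|g1|g1] := ltgtP gamma (pi / 2).
  - by rewrite gt_eqF// cos_gt0_pihalf//; apply/andP; split; lra.
  - have [g2|g2|g2] := ltgtP gamma (3 * pi / 2).
    + have -> : gamma = gamma - pi + pi by rewrite subrK.
      by rewrite cosDpi oppr_eq0 gt_eqF// cos_gt0_pihalf//; apply/andP; split; lra.
    + have -> : gamma = gamma - 2 * pi + pi + pi by ring.
      by rewrite !cosDpi opprK gt_eqF// cos_gt0_pihalf//; apply/andP; split; lra.
    + by rewrite g2 eqxx in hg4.
  - by rewrite g1 eqxx in hg2.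
rewrite -(qw_mean_quadrant nu0 nu1 cs1 c0 s0).
apply: cvg_EFin; first exact: nearW.
exact: qw_cdf_limit.
Qed.
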